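(* Let $a\in(0,1/2)$. Among directed metrics of finite rate for which the geodesic from $(0,0)$ to $(0,1)$ passes through $(1,a)$, there is a unique metric of minimal rate, and it is of the form $e(F,\rho)$ where: $F:[0,1]\to\mathbb R$ consists of the line segment from $(0,0)$ to $(1,a)$, followed by a line segment from $(1,a)$ to some point $(x_B,t_B)$ with $a<t_B$ and $x_B<\frac{t_B}{a}$, followed by $F(t)=x_B\frac{\sqrt t-t}{\sqrt{t_B}-t_B}$ for $t\in[t_B,1]$; $\rho$ is constant on $[0,t_B]$ and $\rho(t)=\left(\frac{F(t)}{t}-F'(t)\right)^2$ for $t\in[t_B,1]$; $F'$ and $\rho$ are continuous at $t_B$; and $b:=\int_0^a(\rho(t)-F'(t)^2)\,dt+\frac1a$ satisfies $0<b\le\frac{1}{1-a}+\frac1a$.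
   Context: Spacetime points are written $(x,t)$ with $x$ spatial and $t$ time; a curve $F:[0,1]\to\mathbb R$ is identified with the path $t\mapsto(F(t),t)$. A directed metric is a continuous $e:\{(x,s,y,t):s<t\}\to\mathbb R\cup\{-\infty\}$ with $e(x,s,y,t)+e(y,t,z,u)\le e(x,s,z,u)$. The Dirichlet metric is $d(x,s,y,t)=-\frac{(y-x)^2}{t-s}$. For a curve $\gamma$ and a nonnegative density $\rho$, $e_{\gamma,\rho}(x_1,t_1,x_2,t_2)=\int_{t_1}^{t_2}(\rho(t)-\gamma'(t)^2)dt$ if $x_i=\gamma(t_i)$ and $-\infty$ otherwise. Finite-rate metrics are exactly those arising from planting nonnegative densities $\rho_i$ along finitely or countably many curves $\gamma_i$: the metric is the smallest directed metric $e$ with $e\ge d$ and $e\ge e_{\gamma_i,\rho_i}$ for all $i$, and its rate is $I(e)=\sum_i\frac43\int\rho_i^{3/2}dt$; all other metrics have infinite rate. $e(F,\rho)$ denotes the metric obtained by planting $\rho$ along the single curve $F$. A path $\pi$ from $(x,s)$ to $(y,t)$ is a geodesic of $e$ if its length (infimum over partitions $s=t_0<\dots<t_k=t$ of $\sum_i e(\pi(t_{i-1}),t_{i-1},\pi(t_i),t_i)$) equals $e(x,s,y,t)$. *)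

(* Defs.v *)
From HB Require Import structures.
From mathcomp Require Import all_boot all_order all_algebra.
From mathcomp Require Import all_classical all_reals all_analysis.
Set Implicit Arguments. Unset Strict Implicit. Unset Printing Implicit Defensive.
Import Order.TTheory GRing.Theory Num.Theory.
Import numFieldNormedType.Exports.
Local Open Scope classical_set_scope.
Local Open Scope ring_scope.

Section Defs.
Variable R : realType.

(* A (candidate) metric: e x s y t, only meaningful for s < t. *)
Definition metric4 := R -> R -> R -> R -> \bar R.

Definition unc4 (e : metric4) (p : R * R * R * R) : \bar R :=
  e p.1.1.1 p.1.1.2 p.1.2 p.2.

Definition domain4 : set (R * R * R * R) := [set p | p.1.1.2 < p.2].

Definition directed_metric (e : metric4) : Prop :=
  {within domain4, continuous (unc4 e)} /\
  (forall x s y t, s < t -> e x s y t != +oo%E) /\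
  (forall x s y t z u, s < t -> t < u ->
     (e x s y t + e y t z u <= e x s z u)%E).

Definition mle (e1 e2 : metric4) : Prop :=
  forall x s y t, s < t -> (e1 x s y t <= e2 x s y t)%E.
Definition meq (e1 e2 : metric4) : Prop :=
  forall x s y t, s < t -> e1 x s y t = e2 x s y t.

Definition dirichlet : metric4 :=
  fun x s y t => (- ((y - x) ^+ 2 / (t - s)))%:E.

Definition abs_cont_on (f : R -> R) (a b : R) : Prop :=
  forall eps : R, 0 < eps -> exists2 delta : R, 0 < delta &
    forall (n : nat) (u v : nat -> R),
      (forall i, (i < n)%N -> a <= u i /\ u i <= v i /\ v i <= b) ->
      (forall i j, (i < j)%N -> (j < n)%N -> v i <= u j) ->
      \sum_(i < n) (v i - u i) < delta ->
      \sum_(i < n) `|f (v i) - f (u i)| < eps.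

Definition energy (g : R -> R) (t1 t2 : R) : \bar R :=
  if `[< abs_cont_on g t1 t2 >] then
    (\int[lebesgue_measure]_(t in `[t1, t2]) ((derive1 g t) ^+ 2)%:E)%E
  else +oo%E.

(* Curves F : [0,1] -> R (values outside [0,1] are irrelevant).
   e_{gamma,rho}. *)
Definition curve_metric (g rho : R -> R) : metric4 :=
  fun x1 t1 x2 t2 =>
    if `[< 0 <= t1 /\ t1 < t2 /\ t2 <= 1 /\ x1 = g t1 /\ x2 = g t2 >] then
      ((\int[lebesgue_measure]_(t in `[t1, t2]) (rho t)%:E) - energy g t1 t2)%E
    else -oo%E.

Definition admissible (g rho : R -> R) : Prop :=
  {within (`[0%R, 1%R] : set R), continuous g} /\
  measurable_fun (`[0%R, 1%R] : set R) rho /\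
  (forall t, 0 <= t <= 1 -> 0 <= rho t).

Definition planted (gam rho : nat -> R -> R) (e : metric4) : Prop :=
  (forall i, admissible (gam i) (rho i)) /\
  directed_metric e /\ mle dirichlet e /\
  (forall i, mle (curve_metric (gam i) (rho i)) e) /\
  (forall e', directed_metric e' -> mle dirichlet e' ->
     (forall i, mle (curve_metric (gam i) (rho i)) e') -> mle e e').

Definition planted1 (F rho : R -> R) (e : metric4) : Prop :=
  admissible F rho /\
  directed_metric e /\ mle dirichlet e /\
  mle (curve_metric F rho) e /\
  (forall e', directed_metric e' -> mle dirichlet e' ->
     mle (curve_metric F rho) e' -> mle e e').

Definition family_rate (rho : nat -> R -> R) : \bar R :=
  (\sum_(0 <= i <oo)
     ((4 / 3)%:E *
      \int[lebesgue_measure]_(t in `[0%R, 1%R]) ((rho i t) `^ (3 / 2))%:E))%E.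

Definition finite_rate (e : metric4) : Prop :=
  exists gam rho, planted gam rho e /\ (family_rate rho < +oo)%E.

(* Rate I(e): infimum over all representations (+oo if none). *)
Definition rate (e : metric4) : \bar R :=
  ereal_inf [set family_rate rho | rho in
             [set rho | exists gam, planted gam rho e]].

Definition partition_sums (e : metric4) (pi : R -> R) (s t : R) : set (\bar R) :=
  [set S | exists (k : nat) (tt : nat -> R),
     (0 < k)%N /\ tt 0%N = s /\ tt k = t /\
     (forall i, (i < k)%N -> tt i < tt i.+1) /\
     S = (\sum_(i < k) e (pi (tt i)) (tt i) (pi (tt i.+1)) (tt i.+1))%E].

Definition path_length (e : metric4) (pi : R -> R) (s t : R) : \bar R :=
  ereal_inf (partition_sums e pi s t).

Definition geodesic (e : metric4) (pi : R -> R) (x s y t : R) : Prop :=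
  {within `[s, t], continuous pi} /\ pi s = x /\ pi t = y /\
  path_length e pi s t = e x s y t.

End Defs.

(* Main.v *)
(* With lambda = sqrt rho of the candidate, every rate of a family planting e is
   bounded pointwise by r = (2 S / lambda + lambda^2) / 3, where S is the sum of the
   rho_i^(3/2); hence e <= d + int r, which the length of the geodesic must obey on
   every time interval.  Writing the geodesic as t * phi(t), the identity
   (y-x)^2/(t-s) - y^2/t + x^2/s = s t (phi t - phi s)^2/(t-s), weighted by lambda,
   gives int S >= int lambda^3, with a quadratic deficit that vanishes only on F.
   So a metric e of minimal rate has geodesic F and, by the same bound along F, the
   same length along F as the candidate e0; thus e >= e0.  For e <= e0, one uses
   families planting e with int S close to the minimum.  A chain between close points
   of F gains nothing from rates outside a small tube around F, so the rates in the
   tube alone already have int S >= int lambda^3, and the rates off F have small mass.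
   Along any curve gamma, rho on the set where gamma touches F is already accounted
   for by e0, because F beats each excursion between two touching times; the remaining
   rates form a small density, and e <= e0 + small. *)

Require Import Defs.
From HB Require Import structures.
From mathcomp Require Import all_boot all_order all_algebra.
From mathcomp Require Import all_classical all_reals all_analysis.
From mathcomp Require Import measurable_realfun.
From mathcomp Require Import ring lra.
Set Implicit Arguments. Unset Strict Implicit. Unset Printing Implicit Defensive.
Import Order.TTheory GRing.Theory Num.Theory.
Import numFieldNormedType.Exports.
Local Open Scope classical_set_scope.
Local Open Scope ring_scope.

(** * Inequalities with quadratic error and the Dirichlet cost *)

Section RealLemmas.
Context {R : realType}.
Implicit Types (f : R -> R) (x y s t u v C : R).

(** The weight [lambda] acts as a multiplier. Integrated against it, the tangent bound [r] becomes
    [(2 S + lambda^3) / 3], so a lower bound [int lambda^3] for the weighted mass of [r] is the same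
    bound for [int S]. The Abel summation behind that lower bound works because [lambda] is
    nonincreasing and the length gained over straight lines from the origin is nonnegative. All
    constants are expressed by [q = sqrt (2 a)], with [t_B = q^2], and by the value [c] of [lambda]
    before [t_B]: the condition [F a = 1] reads [c (3 - 2 q) q^2 = 2], and then
    [int lambda^3 = 2 c^2]. Two obstacles shape the proof. The infimum that defines the rate need
    not be attained, so facts about a minimal metric are limits of estimates for families whose mass
    is within [eps] of [2 c^2]. A geodesic is only known to be continuous, so differential arguments
    along it are replaced by inequalities on short intervals with an error quadratic in their
    length, summed by repeated halving. The smallest metric itself has to be constructed, as a
    supremum over chains of steps, and its continuity proved. *)

Lemma le0_geometric x C : (forall n : nat, x <= C / 2 ^+ n) -> x <= 0.
Proof.
move=> h; rewrite leNgt; apply/negP => x0.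
have C0 : 0 < C by have := h 0%N; rewrite expr0 divr1; exact: lt_le_trans.
have [n hn] : exists n : nat, C / x < n%:R.
  by exists (Num.bound (C / x)); apply: archi_boundP; rewrite divr_ge0// ltW.
have h1 : n%:R < 2 ^+ n :> R by rewrite -natrX ltr_nat ltn_expl.
have := h n; rewrite leNgt => /negP; apply.
rewrite ltr_pdivrMr ?exprn_gt0//.
move: hn; rewrite ltr_pdivrMr// => hn.
by apply: (lt_trans hn); rewrite mulrC ltr_pM2l.
Qed.

(** After [n] halvings there are at most [2 ^ n] pairs of length at most [(v - u) / 2 ^ n], so the
    quadratic errors add up to at most [C (v - u)^2 / 2 ^ n]. A pair may lose a gap around its
    midpoint when it is split, because the touching times of a curve with F need not contain the
    midpoint. *)
Lemma le0_halving (P : R -> R -> Prop) (H : R -> R -> R) C u v :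
  (forall s t, s <= t -> P s t -> H s t <= C * (t - s) ^+ 2) ->
  (forall s t, s <= t -> P s t -> exists x y,
     [/\ s <= x, y <= t, x <= (s + t) / 2 & (s + t) / 2 <= y] /\
     [/\ P s x, P y t & H s t <= H s x + H y t]) ->
  u <= v -> P u v -> H u v <= 0.
Proof.
move=> hC hP uv Puv.
have [C' [C'0 hC']] : exists C', 0 <= C' /\
    forall s t, s <= t -> P s t -> H s t <= C' * (t - s) ^+ 2.
  exists `|C|; split => // s t st Pst; apply: (le_trans (hC _ _ st Pst)).
  by rewrite ler_wpM2r ?sqr_ge0 ?ler_norm.
have key : forall n s t, s <= t -> P s t -> H s t <= C' * (t - s) ^+ 2 / 2 ^+ n.
  elim => [|n IH] s t st Pst; first by rewrite expr0 divr1; exact: hC'.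
  have [x [y [[sx yt xm my] [Px Py hH]]]] := hP _ _ st Pst.
  apply: (le_trans hH).
  have e1 := IH _ _ sx Px.
  have e2 := IH _ _ yt Py.
  apply: (le_trans (lerD e1 e2)).
  rewrite -mulrDl (exprS _ n) invfM [leRHS]mulrA ler_wpM2r ?invr_ge0 ?exprn_ge0//.
  have h1 : (x - s) ^+ 2 <= ((t - s) / 2) ^+ 2.
    by rewrite ler_pXn2r ?nnegrE//; lra.
  have h2 : (t - y) ^+ 2 <= ((t - s) / 2) ^+ 2.
    by rewrite ler_pXn2r ?nnegrE//; lra.
  rewrite -mulrDr -mulrA; apply: ler_wpM2l => //.
  by apply: (le_trans (lerD h1 h2)); rewrite expr_div_n; lra.
by apply: le0_geometric => n; exact: key.
Qed.

(** A quadratic bound on increments does the work of a sign condition on a derivative, without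
    differentiability. *)
Lemma quad_nonincreasing f C u v : u <= v ->
  (forall s t, u <= s -> s < t -> t <= v -> f t - f s <= C * (t - s) ^+ 2) ->
  f v <= f u.
Proof.
move=> uv h; rewrite -subr_le0.
apply: (@le0_halving (fun s t => u <= s /\ t <= v) (fun s t => f t - f s) C) => //.
  move=> s t; rewrite le_eqVlt => /predU1P[-> _|st [us tv]].
    by rewrite !subrr expr0n mulr0.
  exact: h.
move=> s t st [us tv]; exists ((s + t) / 2), ((s + t) / 2).
by split; split; try lra; split; lra.
Qed.

(** The Dirichlet costs of two halves add up to at least the cost of the whole, so the bound passes
    from steps of length [d] to steps of length [2 d]. *)
Lemma local_to_global_action (f p : R -> R) (h : R -> R) (d u v : R) : 0 < d -> u < v ->
  (forall s t, u <= s -> s < t -> t <= v -> t - s <= d ->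
     f t - f s <= h t - h s - (p t - p s) ^+ 2 / (t - s)) ->
  f v - f u <= h v - h u - (p v - p u) ^+ 2 / (v - u).
Proof.
move=> d0 uv H.
have key : forall n s t, u <= s -> s < t -> t <= v -> t - s <= d * 2 ^+ n ->
     f t - f s <= h t - h s - (p t - p s) ^+ 2 / (t - s).
  elim => [|n IH] s t us st tv; first by rewrite expr0 mulr1; exact: H.
  rewrite exprS => ts.
  pose x := (s + t) / 2.
  have e1 : f x - f s <= h x - h s - (p x - p s) ^+ 2 / (x - s).
    by apply: IH; rewrite /x; lra.
  have e2 : f t - f x <= h t - h x - (p t - p x) ^+ 2 / (t - x).
    by apply: IH; rewrite /x; lra.
  have xs : x - s = (t - s) / 2 by rewrite /x; lra.
  have tx : t - x = (t - s) / 2 by rewrite /x; lra.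
  have : (p t - p s) ^+ 2 / (t - s) <=
         (p x - p s) ^+ 2 / (x - s) + (p t - p x) ^+ 2 / (t - x).
    rewrite xs tx invfM invrK -subr_ge0.
    have -> : (p x - p s) ^+ 2 * ((t - s)^-1 * 2) + (p t - p x) ^+ 2 * ((t - s)^-1 * 2)
       - (p t - p s) ^+ 2 / (t - s) = (2 * p x - p s - p t) ^+ 2 / (t - s).
      by ring.
    by rewrite divr_ge0 ?sqr_ge0// subr_ge0 ltW.
  lra.
have [n hn] : exists n : nat, (v - u) / d < n%:R.
  exists (Num.bound ((v - u) / d)); apply: archi_boundP.
  by rewrite divr_ge0 ?subr_ge0// ltW.
apply: (key n) => //.
have h1 : n%:R < 2 ^+ n :> R by rewrite -natrX ltr_nat ltn_expl.
by rewrite mulrC -ler_pdivrMr//; apply/ltW/(lt_trans hn).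
Qed.

(** Cauchy-Schwarz for slopes, with the divisions cleared so that a time interval may shrink to a
    point. *)
Lemma sqr_slope_subadd (x y z A B s t u : R) : s <= t -> t <= u ->
  0 <= A -> 0 <= B ->
  (y - x) ^+ 2 <= A * (t - s) -> (z - y) ^+ 2 <= B * (u - t) ->
  (z - x) ^+ 2 <= (A + B) * (u - s).
Proof.
move=> st tu A0 B0 h1 h2.
set p := y - x; set r := z - y.
have -> : z - x = p + r by rewrite /p /r; ring.
have [ts0|ts0] : t - s = 0 \/ 0 < t - s by lra.
  have p0 : p = 0 by apply/eqP; rewrite -sqrf_eq0 eq_le sqr_ge0 andbT; move: h1; rewrite ts0 mulr0.
  rewrite p0 add0r; apply: (le_trans h2).
  have -> : u - t = u - s by lra.
  by rewrite ler_wpM2r; lra.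
have [tu0|tu0] : u - t = 0 \/ 0 < u - t by lra.
  have p0 : r = 0 by apply/eqP; rewrite -sqrf_eq0 eq_le sqr_ge0 andbT; move: h2; rewrite tu0 mulr0.
  rewrite p0 addr0; apply: (le_trans h1).
  have -> : t - s = u - s by lra.
  by rewrite ler_wpM2r; lra.
set h := t - s in ts0 h1; set k := u - t in tu0 h2.
have -> : u - s = h + k by rewrite /h /k; ring.
(* [2 p r <= (k/h) p^2 + (h/k) r^2] *)
have e1 : (p + r) ^+ 2 <= p ^+ 2 / h * (h + k) + r ^+ 2 / k * (h + k).
  rewrite -subr_ge0.
  have -> : p ^+ 2 / h * (h + k) + r ^+ 2 / k * (h + k) - (p + r) ^+ 2
     = (k * p - h * r) ^+ 2 / (h * k) by field; rewrite !gt_eqF.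
  by rewrite divr_ge0 ?sqr_ge0// mulr_ge0 ?ltW.
apply: (le_trans e1); rewrite -mulrDl ler_wpM2r//; first by rewrite addr_ge0 ?ltW.
by rewrite lerD// ler_pdivrMr.
Qed.

Lemma dirichlet_superadd (x y z s t u : R) : s < t -> t < u ->
  (z - x) ^+ 2 / (u - s) <= (y - x) ^+ 2 / (t - s) + (z - y) ^+ 2 / (u - t).
Proof.
move=> st tu; rewrite ler_pdivrMr; last lra.
apply: (@sqr_slope_subadd _ y _ _ _ _ t); rewrite ?divr_ge0 ?sqr_ge0 ?divfK//; try lra.
all: by rewrite gt_eqF; lra.
Qed.

End RealLemmas.

(** * The optimal curve *)

Section Candidate.
Context {R : realType}.
Variables c q : R.
Hypotheses (c0 : 0 < c) (q0 : 0 < q) (q1 : q < 1).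
Implicit Types s t : R.

(* [q = sqrt (2 a)] and [c] is the constant value of [sqrt rho] before
   [t_B = 2 a = q ^+ 2]. *)
Definition opt_curve t : R :=
  if t <= q ^+ 2 / 2 then c * (3 - 2 * q) * t
  else if t <= q ^+ 2 then c * ((1 - 2 * q) * t + q ^+ 2)
  else 2 * c * q * (Num.sqrt t - t).

(** The primitive of [opt_weight ^+ 2 - F' ^+ 2] that vanishes at 0, hence the length along the
    candidate. It vanishes at 1 as well, so the curve is exactly as long as the straight segment it
    competes with. *)
Definition opt_action t : R :=
  if t <= q ^+ 2 / 2 then - (4 * c ^+ 2 * (1 - q) * (2 - q)) * t
  else if t <= q ^+ 2 then 4 * c ^+ 2 * (1 - q) * (q * t - q ^+ 2)
  else - (4 * c ^+ 2 * q ^+ 2) * (1 - Num.sqrt t) ^+ 2.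

(** The square root of the candidate density; past [q ^+ 2] it equals [F t / t - F' t]. *)
Definition opt_weight t : R := if t <= q ^+ 2 then c else c * q / Num.sqrt t.

Lemma opt_curve1 t : t <= q ^+ 2 / 2 -> opt_curve t = c * (3 - 2 * q) * t.
Proof. by rewrite /opt_curve => ->. Qed.

Lemma opt_curve2 t : q ^+ 2 / 2 <= t -> t <= q ^+ 2 ->
  opt_curve t = c * ((1 - 2 * q) * t + q ^+ 2).
Proof.
rewrite /opt_curve; case: ifPn => [h1 h2|_ _ ->//] _.
have -> : t = q ^+ 2 / 2 by apply/eqP; rewrite eq_le h1 h2.
by field.
Qed.

Let sqrtq2 : Num.sqrt (q ^+ 2) = q.
Proof. by rewrite sqrtr_sqr ger0_norm// ltW. Qed.

Let q2q2 : ~~ (q ^+ 2 <= q ^+ 2 / 2).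
Proof. by rewrite -ltNge ltr_pdivrMr// ltr_pMr ?exprn_gt0//; lra. Qed.

Lemma opt_curve3 t : q ^+ 2 <= t -> opt_curve t = 2 * c * q * (Num.sqrt t - t).
Proof.
move=> qt; have h : ~~ (t <= q ^+ 2 / 2).
  by apply: contra q2q2; exact: le_trans.
rewrite /opt_curve (negbTE h); case: ifPn => // tq.
have -> : t = q ^+ 2 by apply/eqP; rewrite eq_le qt tq.
by rewrite sqrtq2; ring.
Qed.

Lemma opt_action1 t : t <= q ^+ 2 / 2 ->
  opt_action t = - (4 * c ^+ 2 * (1 - q) * (2 - q)) * t.
Proof. by rewrite /opt_action => ->. Qed.

Lemma opt_action2 t : q ^+ 2 / 2 <= t -> t <= q ^+ 2 ->
  opt_action t = 4 * c ^+ 2 * (1 - q) * (q * t - q ^+ 2).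
Proof.
rewrite /opt_action; case: ifPn => [h1 h2|_ _ ->//] _.
have -> : t = q ^+ 2 / 2 by apply/eqP; rewrite eq_le h1 h2.
by field.
Qed.

Lemma opt_action3 t : q ^+ 2 <= t ->
  opt_action t = - (4 * c ^+ 2 * q ^+ 2) * (1 - Num.sqrt t) ^+ 2.
Proof.
move=> qt; have h : ~~ (t <= q ^+ 2 / 2).
  by apply: contra q2q2; exact: le_trans.
rewrite /opt_action (negbTE h); case: ifPn => // tq.
have -> : t = q ^+ 2 by apply/eqP; rewrite eq_le qt tq.
by rewrite sqrtq2; ring.
Qed.

Lemma opt_weight1 t : t <= q ^+ 2 -> opt_weight t = c.
Proof. by rewrite /opt_weight => ->. Qed.

Lemma opt_weight2 t : q ^+ 2 <= t -> opt_weight t = c * q / Num.sqrt t.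
Proof.
move=> qt; rewrite /opt_weight; case: ifPn => // tq.
have -> : t = q ^+ 2 by apply/eqP; rewrite eq_le qt tq.
by rewrite sqrtq2 mulfK// gt_eqF.
Qed.

Let sq_ge t : q ^+ 2 <= t -> exists2 w, q <= w & t = w ^+ 2 /\ Num.sqrt t = w.
Proof.
move=> qt; exists (Num.sqrt t).
  by rewrite -[leLHS]sqrtq2 ler_sqrt// (le_trans _ qt)// sqr_ge0.
by rewrite sqr_sqrtr// (le_trans _ qt)// sqr_ge0.
Qed.

Let q22 : q ^+ 2 / 2 <= q ^+ 2.
Proof. by apply: ltW; rewrite ltNge. Qed.

Lemma opt_weight_gt0 t : 0 < opt_weight t.
Proof.
rewrite /opt_weight; case: ifPn => //; rewrite -ltNge => qt.
rewrite divr_gt0 ?mulr_gt0// sqrtr_gt0; apply: lt_trans qt.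
by rewrite exprn_gt0.
Qed.

Lemma opt_weight_nonincreasing s t : s <= t -> opt_weight t <= opt_weight s.
Proof.
move=> st; have [tq|/ltW qt] := leP t (q ^+ 2).
  by rewrite (opt_weight1 tq) (opt_weight1 (le_trans st tq)).
have [w qw [tw ew]] := sq_ge qt.
have w0 : 0 < w by apply: lt_le_trans qw.
have [sq|/ltW qs] := leP s (q ^+ 2).
  by rewrite (opt_weight1 sq) (opt_weight2 qt) ew ler_pdivrMr// ler_wpM2l// ltW.
rewrite (opt_weight2 qt) (opt_weight2 qs) ler_wpM2l//; first by rewrite mulr_ge0 ?ltW.
have [v qv [sv ev]] := sq_ge qs.
have v0 : 0 < v by apply: lt_le_trans qv.
by rewrite lef_pV2 ?posrE ?ev ?ew// -ev -ew ler_sqrt// tw exprn_ge0 ?ltW.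
Qed.

Lemma opt_weight_le t : opt_weight t <= c.
Proof.
have [tq|/ltW qt] := leP t (q ^+ 2); first by rewrite opt_weight1.
by rewrite -(@opt_weight1 (q ^+ 2))// opt_weight_nonincreasing.
Qed.

(* Expanding in [w = sqrt t], the left-hand side is [c ^+ 2] times a manifestly
   nonnegative polynomial on each pair of pieces of the curve. *)
Lemma opt_curve_excursion s t : 0 <= s -> s <= t ->
  0 <= (opt_curve t - opt_curve s) ^+ 2 + (opt_action t - opt_action s) * (t - s).
Proof.
move=> s0 st; have [ta|/ltW ta] := leP t (q ^+ 2 / 2).
  have sa := le_trans st ta.
  rewrite !opt_curve1// !opt_action1//.
  have -> : (c * (3 - 2 * q) * t - c * (3 - 2 * q) * s) ^+ 2 +
      (- (4 * c ^+ 2 * (1 - q) * (2 - q)) * t -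
       - (4 * c ^+ 2 * (1 - q) * (2 - q)) * s) * (t - s) = (c * (t - s)) ^+ 2.
    by ring.
  exact: sqr_ge0.
have [tb|/ltW tb] := leP t (q ^+ 2).
  have [sa|/ltW sa] := leP s (q ^+ 2 / 2).
    rewrite (opt_curve1 sa) (opt_curve2 ta tb) (opt_action1 sa) (opt_action2 ta tb).
    set X := (X in 0 <= X).
    have -> : X = (c * (s + t - q ^+ 2)) ^+ 2 by rewrite /X; ring.
    exact: sqr_ge0.
  have sb := le_trans st tb.
  rewrite !opt_curve2// !opt_action2//.
  set X := (X in 0 <= X).
  have -> : X = (c * (t - s)) ^+ 2 by rewrite /X; ring.
  exact: sqr_ge0.
have [w qw [tw ew]] := sq_ge tb.
have w0 : 0 <= w by apply: le_trans qw; exact: ltW.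
have [sa|/ltW sa] := leP s (q ^+ 2 / 2).
  rewrite (opt_curve1 sa) (opt_curve3 tb) (opt_action1 sa) (opt_action3 tb).
  rewrite ew tw.
  set X := (X in 0 <= X).
  have -> : X = c ^+ 2 * (s ^+ 2 + 4 * s * (w * (w - q)) + 4 * s * (w - q) ^+ 2).
    by rewrite /X; ring.
  rewrite mulr_ge0 ?sqr_ge0// !addr_ge0 ?sqr_ge0// !mulr_ge0 ?sqr_ge0 ?subr_ge0//.
have [sb|/ltW sb] := leP s (q ^+ 2).
  rewrite (opt_curve2 sa sb) (opt_curve3 tb) (opt_action2 sa sb) (opt_action3 tb).
  rewrite ew tw.
  set X := (X in 0 <= X).
  have -> : X = c ^+ 2 * ((q ^+ 2 - s) ^+ 2 + 4 * w * ((q ^+ 2 - s) * (w - q)) +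
      4 * s * (w - q) ^+ 2) by rewrite /X; ring.
  rewrite mulr_ge0 ?sqr_ge0// !addr_ge0 ?sqr_ge0// !mulr_ge0 ?sqr_ge0 ?subr_ge0//.
have [v qv [sv ev]] := sq_ge sb.
rewrite (opt_curve3 sb) (opt_curve3 tb) (opt_action3 sb) (opt_action3 tb) ew ev tw sv.
set X := (X in 0 <= X).
have -> : X = (2 * c * q * (w - v)) ^+ 2 by rewrite /X; ring.
exact: sqr_ge0.
Qed.

(** The slope of F jumps at [q ^+ 2 / 2], so an estimate with quadratic error cannot hold across
    that time. *)
Definition same_piece s t :=
  [\/ t <= q ^+ 2 / 2, q ^+ 2 / 2 <= s /\ t <= q ^+ 2 | q ^+ 2 <= s].

(** The left-hand side bounds what a curve meeting F at [s] and [t] can collect at the optimal rate,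
    since the weight is largest at [s]. It exceeds the action of F only to second order. *)
Lemma opt_local_action s t : 0 <= s -> s < t -> same_piece s t ->
  opt_weight s ^+ 2 * (t - s) - (opt_curve t - opt_curve s) ^+ 2 / (t - s) <=
  opt_action t - opt_action s + c ^+ 2 / (2 * q ^+ 3) * (t - s) ^+ 2.
Proof.
move=> s0 st h.
have ts0 : 0 < t - s by rewrite subr_gt0.
rewrite -(ler_pM2r ts0) mulrBl divfK ?gt_eqF//.
have [K K0 KE] : exists2 K, 0 <= K & c ^+ 2 / (2 * q ^+ 3) = K.
  by eexists; last reflexivity; rewrite divr_ge0 ?sqr_ge0// mulr_ge0 ?exprn_ge0 ?ltW.
rewrite KE; have D0 : 0 <= K * (t - s) ^+ 3 by rewrite mulr_ge0// exprn_ge0// ltW.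
rewrite mulrDl -subr_ge0.
case: h => [ta|[sa tb]|sb].
- have sa := ltW (lt_le_trans st ta).
  have sb := le_trans sa q22.
  rewrite !opt_curve1// !opt_action1// opt_weight1//.
  by set X := (X in 0 <= X); have -> : X = K * (t - s) ^+ 3 by rewrite /X; ring.
- have ta := le_trans sa (ltW st).
  have sb := le_trans (ltW st) tb.
  rewrite !opt_curve2// !opt_action2// opt_weight1//.
  by set X := (X in 0 <= X); have -> : X = K * (t - s) ^+ 3 by rewrite /X; ring.
have tb := le_trans sb (ltW st).
have [w qw [tw ew]] := sq_ge tb.
have [v qv [sv ev]] := sq_ge sb.
have v0 : 0 < v by apply: lt_le_trans qv.
have vw : v <= w by rewrite -ev -ew ler_sqrt ?(le_trans s0) ?ltW.
rewrite (opt_curve3 sb) (opt_curve3 tb) (opt_action3 sb) (opt_action3 tb).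
rewrite opt_weight2// ew ev tw sv -KE.
set X := (X in 0 <= X).
(* In square roots of time the deficit factors; the constant [c ^+ 2 / (2 * q ^+ 3)] makes the last
   factor nonnegative, given [q <= v <= w] and [q < 1]. *)
have -> : X = c ^+ 2 * (w - v) ^+ 3 *
   ((w + v) ^+ 3 / (2 * q) - q ^+ 4 * (w + 3 * v) / v ^+ 2) / q ^+ 2.
  by rewrite /X; field; rewrite !gt_eqF.
have vw0 : 0 <= w - v by rewrite subr_ge0.
have q0' := q0; have q1' := q1.
apply: divr_ge0; last exact: sqr_ge0.
apply: mulr_ge0; first by rewrite mulr_ge0 ?sqr_ge0// exprn_ge0.
rewrite subr_ge0 ler_pdivrMr ?exprn_gt0// [leRHS]mulrAC ler_pdivlMr ?mulr_gt0//.
have h1 : 4 * q ^+ 2 <= (w + v) ^+ 2.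
  have -> : 4 * q ^+ 2 = (2 * q) ^+ 2 by ring.
  by rewrite ler_pXn2r ?nnegrE//; lra.
have h2 : q ^+ 2 <= v ^+ 2 by rewrite ler_pXn2r ?nnegrE//; lra.
have h3 : 4 * q ^+ 2 * q ^+ 2 <= (w + v) ^+ 2 * v ^+ 2.
  by apply: ler_pM => //; [rewrite mulr_ge0// sqr_ge0|exact: sqr_ge0].
have -> : (w + v) ^+ 3 * v ^+ 2 = (w + v) ^+ 2 * v ^+ 2 * (w + v) by ring.
apply: le_trans (_ : 4 * q ^+ 2 * q ^+ 2 * (w + v) <= _); last first.
  by rewrite ler_wpM2r//; lra.
rewrite -subr_ge0.
have -> : 4 * q ^+ 2 * q ^+ 2 * (w + v) - q ^+ 4 * (w + 3 * v) * (2 * q) =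
  2 * q ^+ 4 * ((w - v) + (1 - q) * (w + 3 * v)) by ring.
apply: mulr_ge0; first by rewrite mulr_ge0// exprn_ge0// ltW.
by apply: addr_ge0 => //; apply: mulr_ge0; lra.
Qed.

End Candidate.

(** * The weighted variational inequality *)

Section Variational.
Context {R : realType}.
Variables c q : R.
Hypotheses (c0 : 0 < c) (q0 : 0 < q) (q1 : q < 1).

(* A primitive of [1 / (opt_weight t * t ^+ 2)]. *)
Definition weight_primitive (t : R) : R :=
  if t <= q ^+ 2 then - (c * t)^-1
  else - (2 / (c * q * Num.sqrt t)) + (c * q ^+ 2)^-1.

Let sqrtq2 : Num.sqrt (q ^+ 2) = q.
Proof. by rewrite sqrtr_sqr ger0_norm// ltW. Qed.

Lemma weight_primitive1 t : t <= q ^+ 2 -> weight_primitive t = - (c * t)^-1.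
Proof. by rewrite /weight_primitive => ->. Qed.

Lemma weight_primitive2 t : q ^+ 2 <= t ->
  weight_primitive t = - (2 / (c * q * Num.sqrt t)) + (c * q ^+ 2)^-1.
Proof.
move=> qt; rewrite /weight_primitive; case: ifPn => // tq.
have -> : t = q ^+ 2 by apply/eqP; rewrite eq_le qt tq.
by rewrite sqrtq2; field; rewrite !gt_eqF.
Qed.

Variables path len act wact : R -> R.
Hypotheses (path0 : path 0 = 0) (patha : path (q ^+ 2 / 2) = 1) (path1 : path 1 = 0).
Hypothesis (len0 : len 0 = 0).
Hypothesis len_ge : forall s : R, 0 < s -> s <= 1 -> - (path s ^+ 2 / s) <= len s.
Hypothesis len_le : forall s t : R, 0 <= s -> s < t -> t <= 1 ->
  len t - len s <= act t - act s - (path t - path s) ^+ 2 / (t - s).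
Hypothesis act_wact : forall s t : R, 0 <= s -> s <= t -> t <= 1 ->
  opt_weight c q t * (act t - act s) <= wact t - wact s.

Let phi t := path t / t.
(** The length gained over the straight line from the origin. In terms of [k] and the slope [phi],
    the cost of a step becomes a single square. *)
Let k t := len t + path t ^+ 2 / t.

Let k_ge0 (t : R) : 0 < t -> t <= 1 -> 0 <= k t.
Proof. by move=> t0 t1; rewrite /k -lerBlDr sub0r len_ge. Qed.

(* [(path t - path s)^2 / (t - s) - path t^2 / t + path s^2 / s
    = s t (phi t - phi s)^2 / (t - s)], and a square is at least its tangents. *)
Let k_step (th s t : R) : 0 < s -> s < t -> t <= 1 ->
  k t - k s <= act t - act s + 2 * th * (phi t - phi s) + th ^+ 2 * (s^-1 - t^-1).
Proof.
move=> s0 st t1; have := len_le (ltW s0) st t1; rewrite /k -subr_ge0 => h.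
have t0 : 0 < t by apply: lt_trans st.
have ts0 : 0 < t - s by rewrite subr_gt0.
rewrite -subr_ge0; apply: le_trans (addr_ge0 h (_ : 0 <= s * t / (t - s) *
   ((phi t - phi s) + th * (t - s) / (s * t)) ^+ 2)) _.
  by rewrite mulr_ge0 ?sqr_ge0// divr_ge0 ?mulr_ge0 ?ltW.
rewrite le_eqVlt; apply/orP; left; apply/eqP; rewrite /phi; field.
by rewrite !gt_eqF.
Qed.

(** Abel summation: since the weight decreases and [k] is nonnegative, the increment of the product
    is at most the weight at [t] times the increment of [k]. The tangent parameter
    [C / opt_weight c q t] cancels the weight in front of [phi], so that term telescopes. *)
Let weighted_step (C s t : R) : 0 < s -> s < t -> t <= 1 ->
  opt_weight c q t * k t - opt_weight c q s * k s <=
  wact t - wact s + 2 * C * (phi t - phi s) +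
  C ^+ 2 / opt_weight c q t * (s^-1 - t^-1).
Proof.
move=> s0 st t1; have t0 : 0 < t by apply: lt_trans st.
have lt0 := opt_weight_gt0 c0 q0 t.
have h1 := k_step (C / opt_weight c q t) s0 st t1.
have h2 := act_wact (ltW s0) (ltW st) t1.
have h3 : (opt_weight c q t - opt_weight c q s) * k s <= 0.
  by rewrite mulr_le0_ge0 ?subr_le0 ?opt_weight_nonincreasing// ?k_ge0 ?(ltW (lt_le_trans st t1))// ltW.
have := ler_wpM2l (ltW lt0) h1.
set w := opt_weight c q t in lt0 h1 h2 h3 *.
have -> : w * (act t - act s + 2 * (C / w) * (phi t - phi s) +
  (C / w) ^+ 2 * (s^-1 - t^-1)) = w * (act t - act s) + 2 * C * (phi t - phi s)
  + C ^+ 2 / w * (s^-1 - t^-1).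
  by field; rewrite !gt_eqF.
move=> h4; rewrite -subr_ge0 in h4; rewrite -subr_ge0 in h2; rewrite -subr_ge0 in h3.
by rewrite -subr_ge0; apply: le_trans (addr_ge0 (addr_ge0 h4 h2) h3) _; lra.
Qed.

Let a := q ^+ 2 / 2.

Let aq : a < q ^+ 2.
Proof. by rewrite /a ltr_pdivrMr// ltr_pMr ?exprn_gt0//; lra. Qed.

Let a0 : 0 < a. Proof. by rewrite /a divr_gt0// exprn_gt0. Qed.

Let q21 : q ^+ 2 < 1. Proof. by rewrite expr_lt1// ltW. Qed.

(** The subtracted terms are what the right-hand side of [weighted_step] telescopes to; [C] is a
    free multiplier for the slope. *)
Let gain C t := opt_weight c q t * k t - wact t - 2 * C * phi t - C ^+ 2 * weight_primitive t.

Let gain_early (C s t : R) : a <= s -> s <= t -> t <= q ^+ 2 -> gain C t <= gain C s.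
Proof.
rewrite le_eqVlt => as_; rewrite le_eqVlt => /predU1P[->//|st] tq.
have s0 : 0 < s by case/predU1P: as_ => [<-//|]; exact: lt_trans.
have t0 : 0 < t by apply: lt_trans st.
have := weighted_step C s0 st (le_trans tq (ltW q21)).
rewrite /gain (opt_weight1 c tq) (opt_weight1 c (le_trans (ltW st) tq)).
rewrite (weight_primitive1 tq) (weight_primitive1 (le_trans (ltW st) tq)) => h.
rewrite -subr_ge0 in h; rewrite -subr_ge0; apply: le_trans h _.
by rewrite le_eqVlt; apply/orP; left; apply/eqP; field; rewrite !gt_eqF.
Qed.

(** The weight now varies, and the last term of [weighted_step] exceeds the increment of
    [C ^+ 2 * weight_primitive] by a second-order amount, which [quad_nonincreasing] absorbs. *)
Let gain_late (C s t : R) : q ^+ 2 <= s -> s <= t -> t <= 1 -> gain C t <= gain C s.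
Proof.
move=> qs0 st0 t10.
apply: (@quad_nonincreasing _ (gain C) (C ^+ 2 / (4 * c * q ^+ 6))) => //.
have q0' := q0.
move=> x y sx xy yt; have qx := le_trans qs0 sx.
have x0 : 0 < x := lt_le_trans (exprn_gt0 2 q0) qx.
have qy := le_trans qx (ltW xy).
have := weighted_step C x0 xy (le_trans yt t10).
rewrite /gain (weight_primitive2 qx) (weight_primitive2 qy).
rewrite (opt_weight2 c q0 qy).
set lx := opt_weight c q x.
set w := Num.sqrt y; set v := Num.sqrt x.
have vq : q <= v by rewrite -[leLHS]sqrtq2 ler_sqrt// ltW.
have v0 : 0 < v by apply: lt_le_trans vq.
have vw : v <= w by rewrite ler_sqrt ?(ltW xy)// ltW// (lt_trans x0).
have w0 : 0 < w by apply: lt_le_trans vw.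
have xv : x = v ^+ 2 by rewrite sqr_sqrtr// ltW.
have yw : y = w ^+ 2 by rewrite sqr_sqrtr// (le_trans _ (ltW xy))// ltW.
rewrite -subr_ge0 => h; rewrite -subr_ge0; apply: le_trans (addr_ge0 h (_ : 0 <=
  C ^+ 2 / (c * q) * (w - v) ^+ 2 * ((w + v) ^+ 2 / (4 * q ^+ 5) - (v ^+ 2 * w)^-1))) _.
  apply: mulr_ge0; first by rewrite mulr_ge0 ?sqr_ge0// divr_ge0 ?sqr_ge0// mulr_ge0 ?ltW.
  rewrite subr_ge0 ler_pdivlMr ?mulr_gt0 ?exprn_gt0// mulrC ler_pdivrMr ?mulr_gt0 ?exprn_gt0//.
  have h1 : 4 * q ^+ 2 <= (w + v) ^+ 2.
    have -> : 4 * q ^+ 2 = (2 * q) ^+ 2 by ring.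
    by rewrite ler_pXn2r ?nnegrE//; lra.
  have h2 : q ^+ 2 <= v ^+ 2 by rewrite ler_pXn2r ?nnegrE//; lra.
  have h3 : q ^+ 2 * q <= v ^+ 2 * w.
    by apply: ler_pM => //; rewrite ?sqr_ge0//; lra.
  have -> : 4 * q ^+ 5 = 4 * q ^+ 2 * (q ^+ 2 * q) by ring.
  by apply: ler_pM => //; rewrite mulr_ge0 ?sqr_ge0//; lra.
rewrite le_eqVlt; apply/orP; left; apply/eqP; rewrite -/w -/v yw xv; field.
by rewrite !gt_eqF.
Qed.

Let gain_nonincreasing (C s t : R) : a <= s -> s <= t -> t <= 1 -> gain C t <= gain C s.
Proof.
move=> as_ st t1; have [tq|/ltW qt] := leP t (q ^+ 2); first exact: gain_early.
have [sq|/ltW qs] := leP s (q ^+ 2); last exact: gain_late.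
by apply: (@le_trans _ _ (gain C (q ^+ 2))); [exact: gain_late|exact: gain_early].
Qed.

(** The slope from the origin is singular at time 0, so the stretch before [a] is treated by
    [len_le] on the two intervals cut at [s]. What remains is the squared distance of the path from
    the segment to [(1, a)]. *)
Let gain_a (C s : R) : 0 < s -> s < a ->
  gain C a <= - wact 0 - 2 * C / a - C ^+ 2 * weight_primitive a -
    c * ((a * path s - s) ^+ 2 / (a * s * (a - s))).
Proof.
move=> s0 sa; rewrite /gain /phi patha (opt_weight1 c (ltW aq)).
have a1 : a <= 1 by rewrite ltW// (lt_trans aq).
have h1 := len_le (lexx 0) s0 (ltW (lt_le_trans sa a1)).
have h2 := len_le (ltW s0) sa a1.
have := act_wact (lexx 0) (ltW a0) a1; rewrite (opt_weight1 c (ltW aq)) => h3.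
have h4 : k a <= act a - act 0 - (a * path s - s) ^+ 2 / (a * s * (a - s)).
  rewrite /k patha.
  move: h1 h2; rewrite path0 !subr0 patha len0 -subr_ge0 => h1.
  rewrite -subr_ge0 => h2; rewrite -subr_ge0; apply: le_trans (addr_ge0 h1 h2) _.
  rewrite le_eqVlt; apply/orP; left; apply/eqP; field.
  by rewrite !gt_eqF// subr_gt0.
have := ler_wpM2l (ltW c0) h4; rewrite mulrBr; lra.
Qed.

(** One multiplier serves before [t] and another after it. Equal multipliers bound the weighted mass
    from below, varying the first one determines the slope at [t], and the left-hand side controls
    the path before [a]. *)
Lemma variational_inequality (C1 C2 s t : R) : 0 < s -> s < a -> a <= t -> t <= 1 ->
  c * ((a * path s - s) ^+ 2 / (a * s * (a - s))) <=
  wact 1 - wact 0 + 2 * C1 * (path t / t - a^-1) - 2 * C2 * (path t / t) +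
  C1 ^+ 2 * (weight_primitive t - weight_primitive a) +
  C2 ^+ 2 * (weight_primitive 1 - weight_primitive t).
Proof.
move=> s0 sa at_ t1.
have h1 := gain_a C1 s0 sa.
have h2 := gain_nonincreasing C1 (lexx a) at_ t1.
have h3 := gain_nonincreasing C2 at_ t1 (lexx 1).
have h4 : 0 <= opt_weight c q 1 * k 1.
  by rewrite mulr_ge0 ?k_ge0// ltW// opt_weight_gt0.
move: h1 h2 h3 h4; rewrite /gain /phi path1 patha mul0r; lra.
Qed.

End Variational.

(** * Absolutely continuous curves *)

Section AbsoluteContinuity.
Context {R : realType}.
Implicit Types (f g : R -> R) (a b x y u v : R) (L : seq (R * R)).

(** Composition with it extends a function on [[a, b]] by constants, which keeps its modulus of
    continuity on the whole line. *)
Definition clamp a b x : R := Num.max a (Num.min x b).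

Lemma clamp_ge a b x : a <= clamp a b x.
Proof. by rewrite /clamp le_max lexx. Qed.

Lemma clamp_le a b x : a <= b -> clamp a b x <= b.
Proof. by move=> ab; rewrite /clamp ge_max ab/= ge_min lexx orbT. Qed.

Lemma clamp_id a b x : a <= x -> x <= b -> clamp a b x = x.
Proof. by move=> ax xb; rewrite /clamp min_l// max_r. Qed.

Lemma clamp_nondecreasing a b x y : x <= y -> clamp a b x <= clamp a b y.
Proof.
move=> xy; rewrite /clamp ge_max !le_max lexx/=; apply/orP; right.
by rewrite le_min !ge_min xy lexx !orbT.
Qed.

Lemma clamp_dist a b x y : x <= y -> clamp a b y - clamp a b x <= y - x.
Proof.
move=> xy; rewrite /clamp.
have [h1|h1] := leP x b; have [h2|h2] := leP y b;
  have [h3|h3] := leP a x; have [h4|h4] := leP a y;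
  have [h5|h5] := leP a b; lra.
Qed.

Lemma lipschitz_continuous f (k : R) :
  (forall x y, x <= y -> `|f y - f x| <= k * (y - x)) -> continuous f.
Proof.
move=> h x; apply/cvgrPdist_le => e e0.
have k0 : 0 < `|k| + 1 by rewrite ltr_wpDl.
have {}h u v : `|f u - f v| <= (`|k| + 1) * `|u - v|.
  wlog: u v / v <= u.
    by move=> H; have [|/ltW vu] := leP v u; [exact: H|rewrite distrC (distrC u) H].
  move=> vu; have uv0 : 0 <= u - v by rewrite subr_ge0.
  rewrite (le_trans (h _ _ vu))// (ger0_norm uv0).
  by rewrite ler_wpM2r// (le_trans (ler_norm _))// lerDl.
exists (e / (`|k| + 1)) => /=; first by rewrite divr_gt0.
move=> y; rewrite /ball_/= => xy; apply: le_trans (h _ _) _.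
by rewrite mulrC -ler_pdivlMr// ltW.
Qed.

Lemma lipschitz_abs_cont_on f a b (k : R) :
  (forall x y, x <= y -> `|f y - f x| <= k * (y - x)) -> abs_cont_on f a b.
Proof.
move=> h e e0; have k0 : 0 < `|k| + 1 by rewrite ltr_wpDl.
exists (e / (`|k| + 1)); first by rewrite divr_gt0.
move=> n u v uv _; rewrite ltr_pdivlMr// => hs; apply: le_lt_trans hs.
rewrite mulr_suml; apply: ler_sum => i _.
have [_ [uvi _]] := uv i (ltn_ord i); rewrite (le_trans (h _ _ uvi))// mulrC.
by rewrite ler_wpM2l ?subr_ge0// (le_trans (ler_norm _))// lerDl.
Qed.

Lemma clamp_continuous a b : continuous (clamp a b).
Proof.
apply: (@lipschitz_continuous _ 1) => x y xy.
by rewrite mul1r ger0_norm ?clamp_dist// subr_ge0 clamp_nondecreasing.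
Qed.

(** Lists replace the indexed families of [abs_cont_on] so that partitions of consecutive intervals
    can be concatenated. *)
Definition ordered_itvs L :=
  pairwise (fun p r : R * R => p.2 <= r.1) L && all (fun p => p.1 <= p.2) L.
Definition mass L : R := \sum_(p <- L) (p.2 - p.1).
Definition oscillation f L : R := \sum_(p <- L) `|f p.2 - f p.1|.

Definition abs_cont f := forall e : R, 0 < e -> exists2 d : R, 0 < d &
  forall L, ordered_itvs L -> mass L < d -> oscillation f L < e.

Lemma abs_cont_clamp g a b : a <= b -> abs_cont_on g a b ->
  abs_cont (g \o clamp a b).
Proof.
move=> ab gac e e0; have [d d0 h] := gac e e0; exists d => // L /andP[oL aL] mL.
pose p i := nth (a, a) L i.
have := h (size L) (fun i => clamp a b (p i).1) (fun i => clamp a b (p i).2).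
rewrite /oscillation (big_nth (a, a)) big_mkord; apply.
- move=> i iL; rewrite clamp_ge clamp_le// clamp_nondecreasing//.
  by have /allP := aL; apply; rewrite mem_nth.
- move=> i j ij jL; apply: clamp_nondecreasing.
  have /(pairwiseP (a, a)) := oL; apply => //; rewrite inE//.
  exact: ltn_trans jL.
- apply: le_lt_trans mL; rewrite /mass (big_nth (a, a)) big_mkord.
  apply: ler_sum => i _; apply: clamp_dist.
  by have /allP := aL; apply; rewrite mem_nth.
Qed.

Lemma ordered_itvs_cons p L : ordered_itvs (p :: L) =
  [&& all (fun r => p.2 <= r.1) L, p.1 <= p.2 & ordered_itvs L].
Proof. by rewrite /ordered_itvs /= -!andbA; do !bool_congr. Qed.

Lemma ordered_itvs_cat L1 L2 m : ordered_itvs L1 -> ordered_itvs L2 ->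
  all (fun p => p.2 <= m) L1 -> all (fun p => m <= p.1) L2 ->
  ordered_itvs (L1 ++ L2).
Proof.
elim: L1 => //= p L1 IH; rewrite !ordered_itvs_cons => /and3P[h1 h2 h3] oL2.
move=> /andP[pm a1] a2; rewrite h2 IH// all_cat h1 /= andbT.
by apply: sub_all a2 => r /=; exact: le_trans.
Qed.

Lemma ordered_itvs_partition u v l f : itv_partition u v l ->
  let L := pairmap pair u l in
  [/\ ordered_itvs L, all (fun p => (u <= p.1) && (p.2 <= v)) L,
    mass L = v - u & oscillation f L = variation u v f l].
Proof.
elim: l u => [|x l IH] u uv.
  rewrite /= /mass /oscillation !big_nil variation_nil (itv_partition_nil uv) subrr.
  by split.
have xv := itv_partition_cons uv; have [h1 a1 m1 v1] := IH x xv.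
have ux : u < x by case: uv => /= /andP[].
split => /=.
- rewrite ordered_itvs_cons h1 (ltW ux) !andbT.
  by apply: sub_all a1 => p /= /andP[].
- rewrite lexx (itv_partition_le xv)/=.
  by apply: sub_all a1 => p /= /andP[xp ->]; rewrite (le_trans (ltW ux)).
- by move: m1; rewrite /mass big_cons => ->/=; rewrite addrC addrA subrK.
- move: v1; rewrite /oscillation big_cons => ->/=.
  by rewrite {2}/variation /= big_nat_recl.
Qed.

Let TV := @total_variation R.

Lemma TV_fin_num_sub a b u v f : a <= u -> u <= v -> v <= b ->
  TV a b f \is a fin_num -> TV u v f \is a fin_num.
Proof.
move=> au uv vb h; have ab := le_trans au (le_trans uv vb).
apply/bounded_variationP => //; apply: (bounded_variationr au uv).
apply: (bounded_variationl (le_trans au uv) vb).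
exact/bounded_variationP.
Qed.

Lemma TV_oscillation u v f (e : R) : u <= v -> 0 < e -> TV u v f \is a fin_num ->
  exists L, [/\ ordered_itvs L, all (fun p => (u <= p.1) && (p.2 <= v)) L,
    mass L = v - u & fine (TV u v f) <= oscillation f L + e].
Proof.
move=> uv e0 fin.
have [_ [/= _ [l ll <-] <-] h] := ub_ereal_sup_adherent e0 fin.
have [h1 a1 m1 v1] := ordered_itvs_partition f ll.
exists (pairmap pair u l); split => //; rewrite v1 -lerBlDr ltW//.
by move: h; rewrite -[X in (X + _ < _)%E]fineK// -EFinD lte_fin.
Qed.

Lemma oscillation_cat f L1 L2 :
  oscillation f (L1 ++ L2) = oscillation f L1 + oscillation f L2.
Proof. by rewrite /oscillation big_cat. Qed.

Lemma mass_cat L1 L2 : mass (L1 ++ L2) = mass L1 + mass L2.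
Proof. by rewrite /mass big_cat. Qed.

(** Each interval is partitioned with half of the remaining error. The clause on lower bounds [m] is
    what keeps the concatenation ordered in the induction. *)
Lemma TV_oscillation_seq f (e : R) L : 0 < e -> ordered_itvs L ->
  (forall p, p \in L -> TV p.1 p.2 f \is a fin_num) ->
  exists L', [/\ ordered_itvs L',
    forall m, all (fun p => m <= p.1) L -> all (fun p => m <= p.1) L',
    mass L' = mass L &
    \sum_(p <- L) fine (TV p.1 p.2 f) <= oscillation f L' + e].
Proof.
elim: L e => [|p L IH] e e0 oL fin.
  by exists [::]; split => //; rewrite /oscillation !big_nil add0r ltW.
move: oL; rewrite ordered_itvs_cons => /and3P[pL pp oL].
have e20 : 0 < e / 2 by rewrite divr_gt0.
have finL r : r \in L -> TV r.1 r.2 f \is a fin_num.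
  by move=> rL; apply: fin; rewrite inE rL orbT.
have [L' [h' a' m' v']] := IH _ e20 oL finL.
have [L1 [h1 a1 m1 v1]] := TV_oscillation pp e20 (fin p (mem_head _ _)).
exists (L1 ++ L'); split.
- apply: (@ordered_itvs_cat _ _ p.2) => //; last exact: a'.
  by apply: sub_all a1 => r /andP[].
- move=> m /= /andP[mp mL]; rewrite all_cat a'// andbT.
  by apply: sub_all a1 => r /andP[pr _]; exact: le_trans pr.
- by rewrite mass_cat m' m1 /mass big_cons.
- by rewrite big_cons oscillation_cat (splitr e) addrACA lerD.
Qed.

(** Over an interval of length [d / 2] the variation is at most 1, and finitely many such intervals
    cover [[a, b]]. *)
Lemma abs_cont_TV_fin f a b : a <= b -> abs_cont f -> TV a b f \is a fin_num.
Proof.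
move=> ab fac; have [d d0 hd] := fac 1 ltr01.
have small u v : u <= v -> v - u < d -> TV u v f \is a fin_num.
  move=> uv uvd; apply/bounded_variationP => //; exists 1 => _ [l ll <-].
  have [h1 _ m1 <-] := ordered_itvs_partition f ll.
  by apply/ltW/hd => //; rewrite m1.
have key (n : nat) u : TV u (u + d / 2 *+ n) f \is a fin_num.
  elim: n u => [|n IH] u; first by rewrite mulr0n addr0 /TV total_variationxx.
  have h0 : 0 <= d / 2 *+ n by rewrite mulrn_wge0// divr_ge0// ltW.
  have d20 : 0 < d / 2 by rewrite divr_gt0.
  have h1 : u <= u + d / 2 by rewrite lerDl ltW.
  have h2 : u + d / 2 <= u + d / 2 *+ n.+1 by rewrite (mulrS _ n) addrA lerDl.
  rewrite /TV (total_variationD f h1 h2).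
  rewrite fin_numD (mulrS _ n) addrA IH andbT; apply: small => //.
  by rewrite addrAC subrr add0r ltr_pdivrMr// ltr_pMr//; lra.
pose n := Num.bound ((b - a) / (d / 2)).
apply: (@TV_fin_num_sub a (a + d / 2 *+ n)) => //.
rewrite -lerBlDl -mulr_natr mulrC -ler_pdivrMr ?divr_gt0// ltW//.
by apply: archi_boundP; rewrite divr_ge0 ?subr_ge0// ltW// divr_gt0.
Qed.

Definition var_fun f a b x : R := fine (TV a (clamp a b x) f).

Lemma var_fun_incr f a b x y : a <= b -> abs_cont f -> x <= y ->
  var_fun f a b y - var_fun f a b x = fine (TV (clamp a b x) (clamp a b y) f).
Proof.
move=> ab fac xy; rewrite /var_fun.
have h1 := clamp_ge a b x; have h2 := clamp_nondecreasing a b xy.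
rewrite /TV (total_variationD f h1 h2) fineD ?abs_cont_TV_fin//.
by rewrite addrAC subrr add0r.
Qed.

(** Partitioning the given intervals preserves their total length, so the modulus of [f] for [e / 2]
    serves for its variation and [e]. *)
Lemma var_fun_abs_cont f a b : a <= b -> abs_cont f -> abs_cont (var_fun f a b).
Proof.
move=> ab fac e e0; have e20 : 0 < e / 2 by rewrite divr_gt0.
have [d d0 hd] := fac _ e20; exists d => // L oL mL.
pose c := clamp a b; pose cL := [seq (c p.1, c p.2) | p <- L].
have oc : ordered_itvs cL.
  move/andP : oL => [pL aL]; apply/andP; split.
    rewrite pairwise_map; apply: sub_pairwise pL => p r /=.
    exact: clamp_nondecreasing.
  by rewrite all_map; apply: sub_all aL => p /=; exact: clamp_nondecreasing.
have oap p : p \in L -> p.1 <= p.2 by move/andP : oL => [_ /allP]; apply.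
have fin p : p \in cL -> TV p.1 p.2 f \is a fin_num.
  move=> /mapP[r rL ->]; apply: abs_cont_TV_fin => //=.
  exact/clamp_nondecreasing/oap.
have [L' [h' _ m' v']] := TV_oscillation_seq e20 oc fin.
have mc : mass cL <= mass L.
  rewrite /mass big_map big_seq [leRHS]big_seq; apply: ler_sum => p pL.
  exact/clamp_dist/oap.
have -> : oscillation (var_fun f a b) L = \sum_(p <- cL) fine (TV p.1 p.2 f).
  rewrite /oscillation big_map big_seq [RHS]big_seq; apply: eq_bigr => p pL.
  rewrite var_fun_incr ?oap// ger0_norm// fine_ge0// total_variation_ge0//.
  exact/clamp_nondecreasing/oap.
apply: le_lt_trans v' _; rewrite [ltRHS]splitr ltrD2r; apply: hd => //.
by rewrite m'; exact: le_lt_trans mL.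
Qed.

Lemma abs_contD f g : abs_cont f -> abs_cont g -> abs_cont (f \+ g).
Proof.
move=> fac gac e e0; have e20 : 0 < e / 2 by rewrite divr_gt0.
have [d d0 hd] := fac _ e20; have [d' d'0 hd'] := gac _ e20.
exists (Num.min d d'); first by rewrite lt_min d0.
move=> L oL; rewrite lt_min => /andP[m1 m2].
rewrite (splitr e); apply: le_lt_trans (ltrD (hd _ oL m1) (hd' _ oL m2)).
rewrite /oscillation -big_split/=; apply: ler_sum => p _.
by rewrite opprD addrACA ler_normD.
Qed.

Lemma abs_cont_continuous f : abs_cont f -> continuous f.
Proof.
move=> fac x; apply/cvgrPdist_lt => e e0; have [d d0 hd] := fac _ e0.
exists d => // y; rewrite /ball_/= => xy.
wlog: x y xy / x <= y.
  move=> h; have [|/ltW yx] := leP x y; first exact: h.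
  by rewrite distrC; apply: h => //; rewrite distrC.
move=> le_xy; have := hd [:: (x, y)]; rewrite /ordered_itvs /= le_xy => /(_ isT).
rewrite /mass /oscillation !big_seq1/= distrC; apply.
by apply: le_lt_trans xy; rewrite distrC ler_norm.
Qed.

End AbsoluteContinuity.

(** * Densities of monotone absolutely continuous functions *)

Section StieltjesDensity.
Context {R : realType}.
Notation mu := (@lebesgue_measure R).
Variables (G : R -> R) (a b : R).
Hypotheses (ndG : {homo G : x y / x <= y}) (acG : abs_cont G) (ab : a < b).

Let rcG : right_continuous G.
Proof. exact/right_continuousW/abs_cont_continuous. Qed.

Let Gc : cumulative R R := HB.pack G (isCumulative.Build R _ R G ndG rcG).

Let nu : {measure set (measurableTypeR R) -> \bar R} := lebesgue_stieltjes_measure Gc.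

Let nu_itv x y : x <= y -> nu `]x, y]%classic = (G y - G x)%:E.
Proof.
move=> xy; rewrite /nu/= /lebesgue_stieltjes_measure /measure_extension.
rewrite measurable_mu_extE/=; last exact: is_ocitv.
by rewrite wlength_itv_bnd.
Qed.

Let p (n i : nat) : R := a + (b - a) * (i%:R / 2 ^+ n).
(** Half-open dyadic cells are disjoint, tile []a, b]], and have the increment of [G] as their
    Stieltjes measure. *)
Let cell n i : set R := `]p n i, p n i.+1]%classic.

Let p_le n i j : (i <= j)%N -> p n i <= p n j.
Proof.
move=> ij; rewrite lerD2l; apply: ler_wpM2l; first by rewrite subr_ge0 ltW.
by rewrite ler_wpM2r ?invr_ge0 ?exprn_ge0// ler_nat.
Qed.

Let p0 n : p n 0 = a. Proof. by rewrite /p mul0r mulr0 addr0. Qed.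

Let p1 n : p n (2 ^ n) = b.
Proof.
rewrite /p natrX divff ?expf_neq0// mulr1; ring.
Qed.

Let p_double n i : p n.+1 (i.*2) = p n i.
Proof.
by rewrite /p -muln2 natrM exprS [X in _ + _ * X = _](_ : _ = i%:R / 2 ^+ n)//;
  field; rewrite expf_neq0.
Qed.

Let cell_halves n i x : cell n i x ->
  exists2 j, (j < 2 ^ n.+1)%N || ~~ (i < 2 ^ n)%N & cell n.+1 j x /\ cell n.+1 j `<=` cell n i.
Proof.
rewrite /cell /= in_itv/= => /andP[xl xr].
have e1 : p n.+1 i.*2 = p n i by exact: p_double.
have e2 : p n.+1 i.*2.+2 = p n i.+1 by rewrite -doubleS p_double.
have lt2 : (i < 2 ^ n)%N -> (i.*2.+1 < 2 ^ n.+1)%N.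
  by rewrite expnS mul2n -doubleS leq_double.
have [xm|xm] := leP x (p n.+1 i.*2.+1).
- exists i.*2.
    by case: (ltnP i (2 ^ n)) => h; [rewrite ltnW ?lt2|rewrite orbT].
  split; first by rewrite in_itv/= e1 xl xm.
  move=> y /=; rewrite !in_itv/= e1 => /andP[->/=].
  by move/le_trans; apply; rewrite -e2 p_le.
- exists i.*2.+1.
    by case: (ltnP i (2 ^ n)) => h; [rewrite lt2|rewrite orbT].
  split; first by rewrite in_itv/= e2 xm xr.
  move=> y /=; rewrite !in_itv/= e2 => /andP[h ->].
  by rewrite andbT (le_lt_trans _ h)// -e1 p_le.
Qed.

Let cell_exists n x : a < x -> x <= b -> exists2 i, (i < 2 ^ n)%N & cell n i x.
Proof.
move=> ax xb; elim: n => [|n [i h1 /cell_halves[j]]].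
  exists 0%N => //; rewrite /cell /= in_itv/= p0 ax/=.
  by have := p1 0; rewrite expn0 => ->.
by rewrite h1 orbF => h2 [h3 _]; exists j.
Qed.

(** Approximation of an open set from inside by finitely many cells, the only sets to which the
    definition of absolute continuity applies directly. *)
Let inner (U : set R) n : set R :=
  \big[setU/set0]_(i < 2 ^ n | `[< cell n i `<=` U >]) cell n i.

Let inner_measurable U n : measurable (inner U n).
Proof. by apply: bigsetU_measurable => i _; exact: measurable_itv. Qed.

Let cell_triv n : trivIset setT (fun i : 'I_(2 ^ n) => cell n i).
Proof.
apply/trivIsetP => /= i j _ _ ij; apply/seteqP; split => // x []; rewrite /cell /=.
rewrite !in_itv/= => /andP[h1 h2] /andP[h3 h4].
have /orP[ij'|ij'] : (i < j)%N || (j < i)%N by rewrite -neq_ltn.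
- by have := p_le n ij'; rewrite leNgt (lt_le_trans h3 h2).
- by have := p_le n ij'; rewrite leNgt (lt_le_trans h1 h4).
Qed.

Let L (U : set R) n := [seq (p n i, p n i.+1) | i <- index_iota 0 (2 ^ n) & `[< cell n i `<=` U >]].

Let L_ordered U n : ordered_itvs (L U n).
Proof.
apply/andP; split; last first.
  by rewrite all_map; apply/allP => i _ /=; exact: p_le.
rewrite pairwise_map; apply: pairwise_filter.
have := iota_ltn_sorted 0 (2 ^ n - 0); rewrite sorted_pairwise; last exact: ltn_trans.
by apply: sub_pairwise => i j /=; exact: p_le.
Qed.

Let big_L U n (H : R * R -> R) : \sum_(r <- L U n) H r =
  \sum_(i < 2 ^ n | `[< cell n i `<=` U >]) H (p n i, p n i.+1).
Proof. by rewrite big_map big_filter big_mkord. Qed.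

Let p_lt n i : p n i < p n i.+1.
Proof.
rewrite ltrD2l ltr_pM2l ?subr_gt0// ltr_pM2r ?invr_gt0 ?exprn_gt0//.
by rewrite ltr_nat.
Qed.

Let mu_inner U n : mu (inner U n) = (mass (L U n))%:E.
Proof.
rewrite /inner measure_bigsetU_ord//; last by move=> i; exact: measurable_itv.
rewrite /mass big_L -sumEFin; apply: eq_bigr => i _ /=.
by rewrite lebesgue_measure_itv/= lte_fin p_lt.
Qed.

Let innerP U n x : inner U n x <->
  exists i, [/\ (i < 2 ^ n)%N, cell n i `<=` U & cell n i x].
Proof.
rewrite /inner big_mkcond/=.
rewrite -(bigcup_mkord _ (fun i => if `[< cell n i `<=` U >] then cell n i else set0)).
split=> [[i /= iN]|[i [iN iU xi]]].
  by case: asboolP => // iU xi; exists i.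
by exists i => //; case: asboolP.
Qed.

Let inner_nondecreasing U : nondecreasing_seq (inner U).
Proof.
apply/nondecreasing_seqP => n; apply/subsetPset => x /innerP[i [iN iU xi]].
have [j + [xj ji]] := cell_halves xi; rewrite iN orbF => jN.
by apply/innerP; exists j; split => //; exact: subset_trans ji iU.
Qed.

Let bigcup_inner U : open U -> U `&` `]a, b] `<=` \bigcup_n inner U n.
Proof.
move=> oU x [Ux]; rewrite /= in_itv/= => /andP[ax xb].
have /nbhs_ballP[e /= e0 xeU] : nbhs x U by exact: open_nbhs_nbhs.
have [n hn] : exists n : nat, (b - a) / 2 ^+ n < e.
  have [n hn] : exists n : nat, (b - a) / e < n%:R.
    exists (Num.bound ((b - a) / e)); apply: archi_boundP.
    by rewrite divr_ge0 ?subr_ge0 ?ltW.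
  exists n; rewrite ltr_pdivrMr ?exprn_gt0// mulrC -ltr_pdivrMr//.
  by apply: lt_trans hn _; rewrite -natrX ltr_nat ltn_expl.
have [i iN xi] := cell_exists n ax xb.
exists n => //; apply/innerP; exists i; split => // y yi; apply: xeU; rewrite /ball/=.
have pi : p n i.+1 - p n i = (b - a) / 2 ^+ n.
  by rewrite /p -natr1; field; rewrite expf_neq0.
move: xi yi; rewrite /cell /= !in_itv/= => /andP[x1 x2] /andP[y1 y2].
rewrite ltr_distl; apply/andP; split; lra.
Qed.

Let nu_inner U n : nu (inner U n) = (oscillation G (L U n))%:E.
Proof.
rewrite /inner measure_bigsetU_ord//; last by move=> i; exact: measurable_itv.
rewrite /oscillation big_L -sumEFin; apply: eq_bigr => i _ /=.
by rewrite nu_itv ?p_le// ger0_norm// subr_ge0 ndG ?p_le.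
Qed.

Let inner_sub U n : inner U n `<=` U.
Proof. by move=> x /innerP[i [_ iU]]; exact: iU. Qed.

(** A null set lies in an open set of Lebesgue measure below [d]. Its inner cell unions have total
    length below [d], hence Stieltjes measure below [e], and they increase to the open set within
    []a, b]]. *)
Let nu_null A : measurable A -> mu A = 0%E -> nu (A `&` `]a, b]) = 0%E.
Proof.
move=> mA A0; apply/eqP; rewrite eq_le measure_ge0 andbT.
apply/lee_addgt0Pr => e e0; rewrite add0e.
have [d d0 hd] := acG e0.
have Afin : (mu A < +oo)%E by rewrite A0.
have [U [oU AU UA]] := lebesgue_regularity_outer mA Afin d0.
have mU : measurable U by exact: open_measurable.
have mI n : measurable (inner U n) by exact: inner_measurable.
have mbI : measurable (\bigcup_n inner U n) by exact: bigcup_measurable.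
have Ud : (mu U < d%:E)%E.
  have mUA : measurable (U `\` A) by exact: measurableD.
  have h : (mu U <= mu A + mu (U `\` A))%E by rewrite -{1}(setDUK AU) measureU2.
  by apply: le_lt_trans h _; rewrite A0 add0e.
have cvgU := nondecreasing_cvg_mu mI mbI (@inner_nondecreasing U) (mu := nu).
apply: (@le_trans _ _ (nu (\bigcup_n inner U n))).
  apply: le_measure; rewrite ?inE//; first exact: measurableI.
  by apply: subset_trans (bigcup_inner oU); exact: setSI.
rewrite -(cvg_lim _ cvgU)//; apply: lime_le; first by apply/cvg_ex; eexists; exact: cvgU.
apply: nearW => n /=; rewrite nu_inner lee_fin ltW// hd//.
rewrite -lte_fin -mu_inner; apply: le_lt_trans Ud.
by apply: le_measure; [rewrite inE; exact: mI|rewrite inE; exact: mU|exact: inner_sub].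
Qed.

(** The Stieltjes measure on []a, b]] is dominated by Lebesgue measure, so Radon-Nikodym applies. *)
Lemma stieltjes_density : exists f : R -> R,
  mu.-integrable setT (EFin \o f) /\
  forall x y, a <= x -> x <= y -> y <= b ->
    (\int[mu]_(t in `]x, y]) (f t)%:E = (G y - G x)%:E)%E.
Proof.
have mD : @measurable _ (measurableTypeR R) (`]a, b]%classic : set R) by exact: measurable_itv.
have nuD : (nu `]a, b]%classic < +oo)%E by rewrite nu_itv ?ltry// ltW.
have dom : mfrestr mD nuD `<< mu.
  apply/null_content_dominatesP => A mA A0; exact: nu_null.
have [f [f0 ffin intf fE]] := @radon_nikodym_sigma_finite _ (measurableTypeR R) R mu (mfrestr mD nuD) dom.
exists (fine \o f); split.
  by apply: eq_integrable intf => // x _ /=; rewrite fineK.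
move=> x y ax xy yb; under eq_integral do rewrite fineK//.
rewrite -fE//; transitivity (nu (`]x, y]%classic `&` `]a, b]%classic)); first by [].
by rewrite setIidl ?nu_itv//; apply: subset_itv; rewrite bnd_simp.
Qed.

End StieltjesDensity.

(** * Integrals of nonnegative functions not assumed measurable *)

Section NonmeasurableIntegral.
Context d (T : measurableType d) {R : realType}.
Variable mu : {measure set T -> \bar R}.
Local Open Scope ereal_scope.

(* The integral of a nonnegative function is a supremum over simple functions
   below it, so it is monotone without any measurability assumption. *)
Lemma ge0_le_integral_all (D : set T) (f g : T -> \bar R) :
  (forall x, D x -> 0 <= f x) -> (forall x, D x -> f x <= g x) ->
  \int[mu]_(x in D) f x <= \int[mu]_(x in D) g x.
Proof.
move=> f0 fg; have g0 x : D x -> 0 <= g x.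
  by move=> Dx; exact: le_trans (f0 _ Dx) (fg _ Dx).
rewrite !ge0_integralE//; apply: ge_ereal_sup => _ [h /= hf <-].
apply: ereal_sup_ubound; exists h => //= x.
by apply: le_trans (hf x) _; exact: lee_restrict.
Qed.

(** Here [f] will be the square of a derivative, with no measurability assumed. It is squeezed
    between two measurable modifications of [g], equal to 0 and to [+oo] on the exceptional null
    set. *)
Lemma ge0_ae_eq_integral_all (D : set T) (f g : T -> \bar R) : measurable D ->
  measurable_fun D g -> (forall x, D x -> 0 <= f x) -> (forall x, D x -> 0 <= g x) ->
  {ae mu, forall x, D x -> f x = g x} ->
  \int[mu]_(x in D) f x = \int[mu]_(x in D) g x.
Proof.
move=> mD mg f0 g0 [N [mN N0 hN]].
have hN' x : D x -> ~ N x -> f x = g x.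
  by move=> Dx Nx; apply: contrapT => fg; apply: Nx; apply: hN => /(_ Dx).
pose gl x := if x \in N then 0 else g x.
pose gu x := if x \in N then +oo else g x.
have mif (c : \bar R) : measurable_fun D (fun x => if x \in N then c else g x).
  apply: measurable_fun_if => //.
  - apply: (@measurable_fun_bool _ _ _ _ true) => //.
    rewrite (_ : _ @^-1` _ = N); first exact: measurableI.
    by apply/seteqP; split => x /= => [/set_mem|/mem_set].
  - by apply: measurable_funS mg => // x [].
have gl0 x : D x -> 0 <= gl x by move=> Dx; rewrite /gl; case: ifPn => // _; exact: g0.
have gu0 x : D x -> 0 <= gu x.
  by move=> Dx; rewrite /gu; case: ifPn => // _; exact: g0.
have El : \int[mu]_(x in D) gl x = \int[mu]_(x in D) g x.
  apply: ge0_ae_eq_integral => //; first exact: mif.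
  exists N; split => // x /= /not_implyP[Dx] h; apply: contrapT => Nx; apply: h.
  by rewrite /gl memNset.
have Eu : \int[mu]_(x in D) gu x = \int[mu]_(x in D) g x.
  apply: ge0_ae_eq_integral => //; first exact: mif.
  exists N; split => // x /= /not_implyP[Dx] h; apply: contrapT => Nx; apply: h.
  by rewrite /gu memNset.
apply/eqP; rewrite eq_le; apply/andP; split.
- rewrite -Eu; apply: ge0_le_integral_all => // x Dx; rewrite /gu.
  by case: ifPn => [_|/negP]; [exact: leey|rewrite in_setE => Nx; rewrite hN'].
- rewrite -El; apply: ge0_le_integral_all => // x Dx; rewrite /gl.
  by case: ifPn => [_|/negP]; [exact: f0|rewrite in_setE => Nx; rewrite hN'].
Qed.

End NonmeasurableIntegral.

(** * Derivative and energy of absolutely continuous curves *)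

Section AbsContDensity.
Context {R : realType}.
Notation mu := (@lebesgue_measure R).
Implicit Types (f g : R -> R) (a b x y : R).

Lemma abs_cont_onS g a b x y : a <= x -> y <= b ->
  abs_cont_on g a b -> abs_cont_on g x y.
Proof.
move=> ax yb h e e0; have [d d0 hd] := h e e0; exists d => // n u v uv.
apply: hd => i iN; have [xu [uvi vy]] := uv i iN.
by split; [exact: le_trans xu|split => //; exact: le_trans yb].
Qed.

(** Jordan decomposition: with [V] the variation of [h], both [V] and [V + h] are nondecreasing and
    absolutely continuous, and the density is the difference of theirs. *)
Lemma abs_cont_density g a b : a < b -> abs_cont_on g a b ->
  exists f, mu.-integrable setT (EFin \o f) /\
    forall x y, a <= x -> x <= y -> y <= b ->
      \int[mu]_(t in `[x, y]) f t = g y - g x.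
Proof.
move=> ab gac; pose h := g \o clamp a b.
have hac : abs_cont h by apply: abs_cont_clamp => //; exact: ltW.
pose V := var_fun h a b.
have Vac : abs_cont V by apply: var_fun_abs_cont => //; exact: ltW.
have tvge x y : x <= y -> `|h y - h x| <= V y - V x.
  move=> xy; have cxy := clamp_nondecreasing a b xy.
  rewrite /V var_fun_incr//; last exact: ltW.
  rewrite -lee_fin fineK; last exact: abs_cont_TV_fin.
  apply: le_trans (total_variation_ge h cxy); rewrite /h /= lee_fin.
  by rewrite !(@clamp_id _ _ _ (clamp _ _ _)) ?clamp_ge ?clamp_le// ltW.
have Vnd : {homo V : x y / x <= y}.
  by move=> x y /tvge h1; rewrite -subr_ge0; apply: le_trans h1; exact: normr_ge0.
have Wnd : {homo V \+ h : x y / x <= y}.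
  move=> x y /tvge; rewrite ler_norml => /andP[h1 _] /=; lra.
have [f1 [if1 Ef1]] := stieltjes_density Vnd Vac ab.
have [f2 [if2 Ef2]] := stieltjes_density Wnd (abs_contD Vac hac) ab.
exists (fun t => f2 t - f1 t).
have iS (D : set R) f : measurable D -> mu.-integrable setT (EFin \o f) ->
    mu.-integrable D (EFin \o f).
  by move=> mD; apply: integrableS.
split.
  rewrite (_ : _ \o _ = (EFin \o f2) \- (EFin \o f1))%E; last by [].
  exact: integrableB.
move=> x y ax xy yb; rewrite RintegralB//; try exact: iS.
rewrite -!Rintegral_itv_obnd_cbnd; try exact: iS.
have ay := le_trans ax xy; have xb := le_trans xy yb.
by rewrite /Rintegral Ef1// Ef2//= /h/= !clamp_id//; ring.
Qed.

Lemma ae_neq (c : R) : {ae mu, forall t, t != c}.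
Proof.
exists [set c]; split => //; first exact: lebesgue_measure_set1.
by move=> t /= /negP; rewrite negbK => /eqP.
Qed.

Lemma abs_cont_ae_derive1 g f a b : a < b ->
  mu.-integrable setT (EFin \o f) ->
  (forall x, a <= x -> x <= b -> \int[mu]_(t in `[a, x]) f t = g x - g a) ->
  {ae mu, forall x, a < x -> x < b -> derive1 g x = f x}.
Proof.
move=> ab intf Ef.
have locf : locally_integrable setT f by apply: open_integrable_locally => //; exact: openT.
have intS y : mu.-integrable [set` Interval (BLeft a) (BRight y)] (EFin \o f).
  by apply: integrableS intf.
have := FTC1 intS locf; apply: filterS; first exact: (ae_filter_ringOfSetsType mu).
move=> x /= h ax xb.
have axE : (a%:E < x%:E)%E by rewrite lte_fin.
have [] := h axE; set F := fun x => _ => dF <-.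
have E : \near x, F x + cst (g a) x = g x.
  near=> z; rewrite /F /cst Ef ?subrK//.
  - by apply: ltW; near: z; exact: lt_nbhsr.
  - by apply: ltW; near: z; exact: lt_nbhsl.
rewrite !derive1E -(@near_eq_derive _ _ _ (F + cst (g a)) g x 1 E).
by rewrite deriveD ?derive_cst ?addr0//; exact: derivable_cst.
Unshelve. all: by end_near. Qed.

(** One measurable density [f] of [g] serves all subintervals; this gives additivity of the energy
    and the comparison with the Dirichlet cost. *)
Lemma energyE g a b : a < b -> abs_cont_on g a b ->
  exists f, [/\ measurable_fun setT f,
    forall x y, a <= x -> x <= y -> y <= b ->
      energy g x y = (\int[mu]_(t in `[x, y]) (f t ^+ 2)%:E)%E &
    forall x y, a <= x -> x < y -> y <= b ->
      (((g y - g x) ^+ 2 / (y - x))%:E <= energy g x y)%E].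
Proof.
move=> ab gac; have [f [intf Ef]] := abs_cont_density ab gac.
have mf : measurable_fun setT f.
  by apply/measurable_EFinP; exact: measurable_int intf.
have aef := abs_cont_ae_derive1 ab intf (fun x ax xb => Ef a x (lexx a) ax xb).
have EE x y : a <= x -> x <= y -> y <= b ->
    energy g x y = (\int[mu]_(t in `[x, y]) (f t ^+ 2)%:E)%E.
  move=> ax xy yb; rewrite /energy asboolT; last exact: abs_cont_onS gac.
  have mf2 (D : set R) : measurable_fun D (fun t => (f t ^+ 2)%:E).
    change (measurable_fun D (EFin \o (fun t => f t ^+ 2))).
    apply/measurable_EFinP; apply: measurable_funX; exact: measurable_funTS mf.
  apply: ge0_ae_eq_integral_all => //.
  - exact: mf2.
  - by move=> t _; rewrite lee_fin sqr_ge0.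
  - by move=> t _; rewrite lee_fin sqr_ge0.
  apply: filterS3 aef (ae_neq a) (ae_neq b).
    exact: (ae_filter_ringOfSetsType mu).
  move=> t /= h ta tb.
  rewrite in_itv/= => /andP[xt ty]; rewrite h//.
    by rewrite lt_neqAle eq_sym ta (le_trans ax).
  by rewrite lt_neqAle tb (le_trans ty).
exists f; split => // x y ax xy yb.
rewrite (EE _ _ ax (ltW xy) yb).
set I := (\int[mu]_(t in _) _)%E.
have [->|Ifin] := eqVneq I +oo%E; first exact: leey.
pose D := (`[x, y]%classic : set R).
have mD : measurable D by exact: measurable_itv.
have intD : mu.-integrable D (EFin \o f).
  by apply: integrableS intf => //; exact: mD.
have int2 : mu.-integrable D (EFin \o (fun t => f t ^+ 2)).
  apply/integrableP; split.
    apply/measurable_EFinP; apply: measurable_funX; exact: measurable_funTS mf.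
  under eq_integral => t _ do rewrite gee0_abs ?lee_fin ?sqr_ge0//.
  by rewrite ltey.
(* The mean slope: integrating [2 th f - th^2 <= f^2] gives Cauchy-Schwarz. *)
pose th := (g y - g x) / (y - x).
have intZ : mu.-integrable D (EFin \o (fun t => 2 * th * f t)).
  rewrite (_ : _ \o _ = (fun t => (2 * th)%:E * (EFin \o f) t)%E); last by [].
  exact: integrableZl.
have intc : mu.-integrable D (EFin \o cst (th ^+ 2)).
  apply: continuous_compact_integrable; first exact: segment_compact.
  by apply: continuous_subspaceT => z; exact: cst_continuous.
have intl : mu.-integrable D (EFin \o (fun t => 2 * th * f t - th ^+ 2)).
  rewrite (_ : _ \o _ = ((EFin \o (fun t => (2 * th * f t)%R)) \- (EFin \o cst (th ^+ 2)%R))%E); last by [].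
  exact: integrableB.
have h : \int[mu]_(t in D) (2 * th * f t - th ^+ 2) <= \int[mu]_(t in D) (f t ^+ 2).
  apply: le_Rintegral => // t _; rewrite -subr_ge0.
  have -> : f t ^+ 2 - (2 * th * f t - th ^+ 2) = (f t - th) ^+ 2 by ring.
  exact: sqr_ge0.
have Ifin' : I \is a fin_num.
  rewrite ge0_fin_numE ?ltey//; apply: integral_ge0 => t _.
  by rewrite lee_fin sqr_ge0.
rewrite -(fineK Ifin') lee_fin; apply: le_trans h.
rewrite RintegralB// RintegralZl// (Ef _ _ ax (ltW xy) yb).
rewrite Rintegral_cst//= /D lebesgue_measure_itv/= lte_fin xy/=.
have yx0 : 0 < y - x by rewrite subr_gt0.
rewrite le_eqVlt; apply/orP; left; apply/eqP; rewrite /th; field.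
by rewrite gt_eqF.
Qed.

End AbsContDensity.

(** * Directed metrics generated by chains *)

Section DirectedReal.
Context {R : realType}.
Implicit Types f : R -> R -> R -> R -> R.

Definition real_continuous4 f := forall x s y t, s < t -> forall e : R, 0 < e ->
  exists2 d : R, 0 < d & forall x' s' y' t',
    `|x' - x| < d -> `|s' - s| < d -> `|y' - y| < d -> `|t' - t| < d ->
    `|f x' s' y' t' - f x s y t| <= e.

Definition to_metric f : metric4 R := fun x s y t => (f x s y t)%:E.

Lemma directed_to_metric f : real_continuous4 f ->
  (forall x s y t z u : R, s < t -> t < u -> f x s y t + f y t z u <= f x s z u) ->
  directed_metric (to_metric f).
Proof.
move=> fc fs; split; last split.
- apply/subspace_continuousP => -[[[x s] y] t]; rewrite /domain4 /= => st.
  apply: cvg_within_filter; apply: cvg_EFin; first exact: nearW.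
  apply/cvgrPdist_le => e e0; have [d d0 hd] := fc x s y t st e e0.
  apply/nbhs_ballP; exists d => //= -[[[x' s'] y'] t'] [[[/= h1 h2] h3] h4].
  by rewrite distrC hd// distrC.
- by [].
- by move=> x s y t z u st tu; rewrite /to_metric -EFinD lee_fin fs.
Qed.

Lemma real_continuous4D f g : real_continuous4 f -> real_continuous4 g ->
  real_continuous4 (fun x s y t => f x s y t + g x s y t).
Proof.
move=> fc gc x s y t st e e0; have e20 : 0 < e / 2 by rewrite divr_gt0.
have [d d0 hd] := fc x s y t st _ e20; have [d' d'0 hd'] := gc x s y t st _ e20.
exists (Num.min d d'); first by rewrite lt_min d0.
move=> x' s' y' t'; rewrite !lt_min => /andP[a1 a2] /andP[b1 b2] /andP[c1 c2] /andP[d1 d2].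
rewrite opprD addrACA (splitr e) (le_trans (ler_normD _ _))// lerD//.
  exact: hd.
exact: hd'.
Qed.

Lemma real_continuous4_incr (h : R -> R) : continuous h ->
  real_continuous4 (fun _ s _ t => h t - h s).
Proof.
move=> hc x s y t st e e0; have e20 : 0 < e / 2 by rewrite divr_gt0.
have /cvgrPdist_le/(_ _ e20)/nbhs_ballP[d1 /= d10 h1] := hc t.
have /cvgrPdist_le/(_ _ e20)/nbhs_ballP[d2 /= d20 h2] := hc s.
exists (Num.min d1 d2); first by rewrite lt_min d10.
move=> x' s' y' t'; rewrite !lt_min => _ /andP[_ a2] _ /andP[a1 _].
have -> : h t' - h s' - (h t - h s) = (h s - h s') - (h t - h t') by ring.
rewrite (splitr e) (le_trans (ler_normB _ _))// lerD//.
  by apply: h2; rewrite /ball/= distrC.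
by apply: h1; rewrite /ball/= distrC.
Qed.

End DirectedReal.

(** Uniform continuity of [u^2 / h] where [h] stays away from 0. The distances are [2 d] because two
    perturbed endpoints are compared with each other, each at distance [d] from the original one. *)
Lemma dirichlet_unif {R : realType} (W k e : R) : 0 < W -> 0 < k -> 0 < e ->
  exists2 d : R, 0 < d & forall u' u'' h' h'' : R,
    `|u'| <= W -> `|u' - u''| <= 2 * d -> k <= h' -> k <= h'' -> `|h' - h''| <= 2 * d ->
    u'' ^+ 2 / h'' <= u' ^+ 2 / h' + e.
Proof.
move=> W0 k0 e0; pose K := 2 * (2 * W + 2) / k + 2 * W ^+ 2 / k ^+ 2.
have K0 : 0 < K.
  rewrite /K addr_gt0// ?divr_gt0 ?mulr_gt0 ?exprn_gt0//.
  by rewrite addr_gt0// mulr_gt0.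
exists (Num.min 1 (e / K)); first by rewrite lt_min ltr01 divr_gt0.
move=> u' u'' h' h'' uW uu kh' kh'' hh.
set d := Num.min _ _ in uu hh.
have d1 : d <= 1 by rewrite ge_min lexx.
have dK : K * d <= e by rewrite mulrC -ler_pdivlMr// ge_min lexx orbT.
have d0 : 0 <= d by rewrite le_min ler01 divr_ge0// ltW.
have h'0 : 0 < h' by apply: lt_le_trans kh'.
have h''0 : 0 < h'' by apply: lt_le_trans kh''.
have E : u'' ^+ 2 / h'' - u' ^+ 2 / h' =
  (u'' - u') * (u'' + u') / h'' + u' ^+ 2 * (h' - h'') / (h' * h'').
  by field; rewrite !gt_eqF.
rewrite -lerBlDl E; apply: le_trans dK.
have -> : K * d = 2 * d * (2 * W + 2) / k + W ^+ 2 * (2 * d) / (k * k).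
  by rewrite /K; field; rewrite gt_eqF.
have aux (p P h g : R) : 0 < g -> g <= h -> p <= P -> 0 <= P -> p / h <= P / g.
  move=> g0 gh pP P0; have h0 : 0 < h by apply: lt_le_trans gh.
  apply: (@le_trans _ _ (P / h)); first by rewrite ler_wpM2r// invr_ge0 ltW.
  by rewrite ler_wpM2l// lef_pV2.
apply: lerD; apply: aux => //.
- apply: le_trans (ler_norm _) _; rewrite normrM ler_pM// 1?distrC//.
  have -> : u'' + u' = (u'' - u') + 2 * u' by ring.
  apply: le_trans (ler_normD _ _) _; rewrite addrC lerD//.
    by rewrite normrM ger0_norm// ler_pM2l.
  by rewrite distrC (le_trans uu)//; lra.
- by apply: mulr_ge0; [apply: mulr_ge0|lra].
- by rewrite mulr_gt0.
- by apply: ler_pM => //; exact: ltW.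
- apply: le_trans (ler_norm _) _; rewrite normrM ler_pM// normrX ler_pXn2r ?nnegrE//.
  exact: ltW.
- by apply: mulr_ge0; [exact: sqr_ge0|apply: mulr_ge0].
Qed.

(** * Continuity of superadditive functions *)

Section MidpointContinuity.
Context {R : realType}.

(** To move the endpoints, the function is split near both ends at fixed times [s + k] and [t - k],
    the middle is kept, and the short end pieces are rerouted along straight lines. An end piece
    gains at most an increment of [act], small by continuity, and its Dirichlet cost changes little
    because its displacement is bounded. *)
Lemma midpoint_continuous (f : R -> R -> R -> R -> R) (act : R -> R) :
  continuous act -> {homo act : x y / x <= y} ->
  (forall x s y t : R, s < t -> - ((y - x) ^+ 2 / (t - s)) <= f x s y t) ->
  (forall x s y t : R, s < t -> f x s y t <= act t - act s - (y - x) ^+ 2 / (t - s)) ->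
  (forall x s y t z u : R, s < t -> t < u -> f x s y t + f y t z u <= f x s z u) ->
  (forall x s r y t e : R, s < r -> r < t -> 0 < e ->
    exists m, f x s y t <= f x s m r + f m r y t + e) ->
  real_continuous4 f.
Proof.
move=> act_cont act_nd f_dirichlet f_bound f_superadd f_split x s y t st e e0.
have [d d0 hd] : exists2 d : R, 0 < d & forall x' s' y' t' x'' s'' y'' t'',
    `|x' - x| < d -> `|s' - s| < d -> `|y' - y| < d -> `|t' - t| < d ->
    `|x'' - x| < d -> `|s'' - s| < d -> `|y'' - y| < d -> `|t'' - t| < d ->
    f x' s' y' t' <= f x'' s'' y'' t'' + e.
  have e80 : 0 < e / 8 by rewrite divr_gt0.
  have /cvgrPdist_le/(_ _ e80)/nbhs_ballP[d1 /= d10 h1] := @act_cont t.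
  have /cvgrPdist_le/(_ _ e80)/nbhs_ballP[d2 /= d20 h2] := @act_cont s.
  have [k [k0 kd1 kd2 kst]] : exists k : R, [/\ 0 < k, k < d1, k < d2 & 4 * k <= t - s].
    exists (Num.min (Num.min (d1 / 2) (d2 / 2)) ((t - s) / 4)); split.
    - by rewrite !lt_min !divr_gt0// subr_gt0.
    - by rewrite !gt_min ltr_pdivrMr// ltr_pMr// ltr1n.
    - by rewrite !gt_min (_ : d2 / 2 < d2) ?orbT// ltr_pdivrMr// ltr_pMr// ltr1n.
    - by rewrite mulrC -ler_pdivlMr// ge_min lexx orbT.
  (* [A] bounds all possible gain plus the splitting errors. As the whole is no worse than a
     straight line, [W2] bounds the Dirichlet cost of an end piece and [W] its displacement. *)
  pose A := act t - act (s - k) + 4 * (e / 8).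
  pose W2 := 2 * ((`|y - x| + 2) ^+ 2 / (t - s)) + A.
  pose W := `|W2 * (t - s)| + 1.
  have W0 : 0 < W by rewrite ltr_wpDl.
  have ts0 : 0 < t - s by rewrite subr_gt0.
  have k20 : 0 < k / 2 by rewrite divr_gt0.
  have [d0 d00 hd0] := dirichlet_unif W0 k20 e80.
  exists (Num.min 1 (Num.min d0 (k / 2))); first by rewrite !lt_min ltr01 d00.
  move=> x' s' y' t' x'' s'' y'' t''; rewrite !lt_min.
  move=> /and3P[a1 a2 a3] /and3P[b1 b2 b3] /and3P[p1 p2 p3] /and3P[q1 q2 q3].
  move=> /and3P[a1' a2' a3'] /and3P[b1' b2' b3'] /and3P[p1' p2' p3'] /and3P[q1' q2' q3'].
  move: (b3) (q3) (b3') (q3'); rewrite !ltr_norml.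
  move=> /andP[sl sr] /andP[tl tr] /andP[sl' sr'] /andP[tl' tr'].
  have [T1 T2 T3] : [/\ s' < s + k, s + k < t - k & t - k < t'].
    by clear -k0 kst sl sr tl tr; split; lra.
  have [T4 T5] : s'' < s + k /\ t - k < t''.
    by clear -k0 kst sl' sr' tl' tr'; split; lra.
  have [T6 T7] : `|s' - s| < d2 /\ `|t' - t| < d1.
    by clear -b3 q3 kd1 kd2 k0; split; lra.
  have [T8 T9] : t - s <= 2 * (t' - s') /\ t' - (t - k) <= t - s /\ s + k - s' <= t - s.
    by clear -k0 kst sl sr tl tr; split; [lra|split; lra].
  have T10 : s - k <= s' by clear -sl k0; lra.
  have [T11 T12] : k / 2 <= s + k - s' /\ k / 2 <= s + k - s''.
    by clear -sr sr' k0; split; lra.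
  have [T13 T14] : k / 2 <= t' - (t - k) /\ k / 2 <= t'' - (t - k).
    by clear -tl tl' k0; split; lra.
  pose si := s + k; pose ta := t - k.
  have s'si : s' < si by [].
  have sita : si < ta by [].
  have tat' : ta < t' by [].
  have s''si : s'' < si by [].
  have tat'' : ta < t'' by [].
  have [n hn] := f_split x' _ _ y' _ _ (lt_trans s'si sita) tat' e80.
  have [m hm] := f_split x' _ _ n _ _ s'si sita e80.
  have g1 := f_superadd x'' _ m _ y'' _ s''si (lt_trans sita tat'').
  have g2 := f_superadd m _ n _ y'' _ sita tat''.
  have g3 := f_dirichlet x'' _ m _ s''si.
  have g4 := f_dirichlet n _ y'' _ tat''.
  have b1s := f_bound x' _ m _ s'si.
  have b2s := f_bound n _ y' _ tat'.
  have b3s := f_bound m _ n _ sita.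
  have b4s := f_dirichlet x' _ y' _ (lt_trans s'si (lt_trans sita tat')).
  have osc0 : `|act s - act s'| <= e / 8 by apply: h2; rewrite /ball/= distrC.
  have osc0' : `|act t - act t'| <= e / 8 by apply: h1; rewrite /ball/= distrC.
  have osc1 : act si - act s' <= 2 * (e / 8).
    have : `|act s - act si| <= e / 8.
      by apply: h2; rewrite /ball/= /si opprD addrA subrr sub0r normrN gtr0_norm.
    clear -osc0; move: osc0; rewrite !ler_norml => /andP[? ?] /andP[? ?]; lra.
  have osc2 : act t' - act ta <= 2 * (e / 8).
    have : `|act t - act ta| <= e / 8.
      by apply: h1; rewrite /ball/= /ta opprB addrC subrK gtr0_norm.
    clear -osc0'; move: osc0'; rewrite !ler_norml => /andP[? ?] /andP[? ?]; lra.
  have Dmn : 0 <= (n - m) ^+ 2 / (ta - si) by rewrite divr_ge0 ?sqr_ge0// subr_ge0 ltW.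
  have Dm : 0 <= (m - x') ^+ 2 / (si - s') by rewrite divr_ge0 ?sqr_ge0// subr_ge0 ltW.
  have Dn : 0 <= (y' - n) ^+ 2 / (t' - ta) by rewrite divr_ge0 ?sqr_ge0// subr_ge0 ltW.
  have actA : act t' - act s' + 2 * (e / 8) <= A.
    have h := act_nd _ _ T10; rewrite /A.
    clear -h osc0' e80; move: osc0'; rewrite ler_norml => /andP[? ?]; lra.
  have DB : (y' - x') ^+ 2 / (t' - s') <= 2 * ((`|y - x| + 2) ^+ 2 / (t - s)).
    have t's'0 : 0 < t' - s' by clear -T8 ts0; lra.
    have yx : (y' - x') ^+ 2 <= (`|y - x| + 2) ^+ 2.
      rewrite -[leLHS]real_normK ?num_real// ler_pXn2r ?nnegrE ?addr_ge0//.
      have -> : y' - x' = (y' - y) - (x' - x) + (y - x) by ring.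
      rewrite (le_trans (ler_normD _ _))// addrC lerD2l (le_trans (ler_normB _ _))//.
      by clear -p1 a1; lra.
    rewrite ler_pdivrMr//; apply: (le_trans yx).
    have -> : 2 * ((`|y - x| + 2) ^+ 2 / (t - s)) * (t' - s') =
       (`|y - x| + 2) ^+ 2 * (2 * (t' - s') / (t - s)) by field; rewrite gt_eqF.
    by rewrite ler_peMr ?sqr_ge0// ler_pdivlMr// mul1r.
  have sqW z h : z ^+ 2 / h <= W2 -> 0 < h -> h <= t - s -> `|z| <= W.
    move=> zh h0 hts; have W20 : 0 <= W2.
      by apply: le_trans zh; rewrite divr_ge0 ?sqr_ge0// ltW.
    have : z ^+ 2 <= W2 * (t - s).
      by move: zh; rewrite ler_pdivrMr// => /le_trans; apply; rewrite ler_wpM2l.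
    rewrite /W (ger0_norm (mulr_ge0 W20 (ltW ts0))) -[z ^+ 2]real_normK ?num_real// => zW.
    have [z1|z1] := leP `|z| 1; first by rewrite (le_trans z1)// lerDr mulr_ge0// ltW.
    have : `|z| <= `|z| ^+ 2 by rewrite expr2 ler_peMl ?ltW// (lt_trans ltr01).
    by clear -zW; lra.
  have Wn : `|y' - n| <= W.
    have h : (y' - n) ^+ 2 / (t' - ta) <= W2.
      by rewrite /W2; clear -hn hm b1s b2s b3s b4s Dmn Dm Dn actA DB e80; lra.
    by apply: (sqW _ _ h); [rewrite subr_gt0|case: T9].
  have Wm : `|m - x'| <= W.
    have h : (m - x') ^+ 2 / (si - s') <= W2.
      by rewrite /W2; clear -hn hm b1s b2s b3s b4s Dmn Dm Dn actA DB e80; lra.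
    by apply: (sqW _ _ h); [rewrite subr_gt0|case: T9].
  have f1 : (m - x'') ^+ 2 / (si - s'') <= (m - x') ^+ 2 / (si - s') + e / 8.
    apply: hd0 => //.
    - have -> : m - x' - (m - x'') = (x'' - x) - (x' - x) by ring.
      by rewrite (le_trans (ler_normB _ _))//; clear -a2 a2'; lra.
    - have -> : si - s' - (si - s'') = (s'' - s) - (s' - s) by ring.
      by rewrite (le_trans (ler_normB _ _))//; clear -b2 b2'; lra.
  have f2 : (y'' - n) ^+ 2 / (t'' - ta) <= (y' - n) ^+ 2 / (t' - ta) + e / 8.
    apply: hd0 => //.
    - have -> : y' - n - (y'' - n) = (y' - y) - (y'' - y) by ring.
      by rewrite (le_trans (ler_normB _ _))//; clear -p2 p2'; lra.
    - have -> : t' - ta - (t'' - ta) = (t' - t) - (t'' - t) by ring.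
      by rewrite (le_trans (ler_normB _ _))//; clear -q2 q2'; lra.
  clear -hn hm g1 g2 g3 g4 b1s b2s osc1 osc2 f1 f2 e80; lra.
exists d => // x' s' y' t' k1 k2 k3 k4.
have hh (z : R) : `|z - z| < d by rewrite subrr normr0.
have u1 := hd _ _ _ _ _ _ _ _ k1 k2 k3 k4 (hh x) (hh s) (hh y) (hh t).
have u2 := hd _ _ _ _ _ _ _ _ (hh x) (hh s) (hh y) (hh t) k1 k2 k3 k4.
by clear -u1 u2; rewrite ler_norml; apply/andP; split; lra.
Qed.

End MidpointContinuity.

(** * Suprema over chains of steps *)

Section Chains.
Context {R : realType}.
Variable St : R -> R -> R -> R -> R -> Prop.

(** The supremum over finite chains is superadditive by concatenation and is the least such function
    above the steps. The relation [St] is abstract: only the step bound, the straight steps and the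
    possibility of cutting a step are used for continuity. *)
Inductive chain : R -> R -> R -> R -> R -> Prop :=
| chain_step x s y t v : s < t -> St x s y t v -> chain x s y t v
| chain_cons x s m r y t v w : s < r -> St x s m r v -> chain m r y t w ->
    chain x s y t (v + w).

Definition chain_metric x s y t : R := sup [set v | chain x s y t v].

Variable act : R -> R.
Hypotheses (act_cont : continuous act) (act_nd : {homo act : x y / x <= y}).
Hypothesis St_dirichlet : forall x s y t, s < t -> St x s y t (- ((y - x) ^+ 2 / (t - s))).
Hypothesis St_le : forall x s y t v, s < t -> St x s y t v ->
  v <= act t - act s - (y - x) ^+ 2 / (t - s).
Hypothesis St_split : forall x s r y t v, s < r -> r < t -> St x s y t v ->
  exists m v1 v2, [/\ St x s m r v1, St m r y t v2 & v <= v1 + v2].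

Lemma chain_lt x s y t v : chain x s y t v -> s < t.
Proof. by elim=> // {}x {}s m r {}y {}t {}v w sr _ _ rt; exact: lt_trans rt. Qed.

Lemma chain_le x s y t v : chain x s y t v ->
  v <= act t - act s - (y - x) ^+ 2 / (t - s).
Proof.
elim=> [{}x {}s {}y {}t {}v|{}x {}s m r {}y {}t {}v w sr hv hc hw]; first exact: St_le.
have := dirichlet_superadd x m y sr (chain_lt hc).
have := St_le sr hv; lra.
Qed.

Lemma chain_cat x s m r y t v w : chain x s m r v -> chain m r y t w ->
  chain x s y t (v + w).
Proof.
elim=> [{}x {}s {}m {}r {}v sr hv|{}x {}s m' r' {}m {}r {}v w' sr hv hc IH] hw.
  exact: chain_cons hv hw.
by rewrite -addrA; apply: chain_cons hv _ => //; exact: IH.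
Qed.

(** Only the step that straddles the time [r] has to be cut, which is what [St_split] provides. *)
Lemma chain_split x s r y t v : chain x s y t v -> s < r -> r < t ->
  exists m v1 v2, [/\ chain x s m r v1, chain m r y t v2 & v <= v1 + v2].
Proof.
elim=> [{}x {}s {}y {}t {}v st hv|{}x {}s m r' {}y {}t {}v w sr' hv hc IH] sr rt.
  have [m [v1 [v2 [h1 h2 h3]]]] := St_split sr rt hv.
  by exists m, v1, v2; split => //; exact: chain_step.
have [rr'|r'r|rr'] := ltgtP r r'.
- have [m' [v1 [v2 [h1 h2 h3]]]] := St_split sr rr' hv.
  exists m', v1, (v2 + w); split; first exact: chain_step.
    exact: chain_cons hc.
  by rewrite addrA lerD2r.
- have [m' [v1 [v2 [h1 h2 h3]]]] := IH r'r rt.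
  exists m', (v + v1), v2; split => //; first exact: chain_cons h1.
  by rewrite -addrA lerD2l.
- by rewrite rr'; exists m, v, w; split => //; exact: chain_step.
Qed.

Lemma chain_metric_ge x s y t v : chain x s y t v -> v <= chain_metric x s y t.
Proof.
move=> h; apply: ub_le_sup => //.
by exists (act t - act s - (y - x) ^+ 2 / (t - s)) => w /chain_le.
Qed.

Lemma chain_metric_le x s y t M : s < t -> (forall v, chain x s y t v -> v <= M) ->
  chain_metric x s y t <= M.
Proof.
move=> st h; apply: ge_sup => //.
by exists (- ((y - x) ^+ 2 / (t - s))); apply: chain_step => //; exact: St_dirichlet.
Qed.

Lemma chain_metric_bound x s y t : s < t ->
  chain_metric x s y t <= act t - act s - (y - x) ^+ 2 / (t - s).
Proof. by move=> st; apply: chain_metric_le => // v; exact: chain_le. Qed.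

Lemma chain_metric_dirichlet x s y t : s < t ->
  - ((y - x) ^+ 2 / (t - s)) <= chain_metric x s y t.
Proof.
by move=> st; apply: chain_metric_ge; apply: chain_step => //; exact: St_dirichlet.
Qed.

Lemma chain_metric_superadd x s y t z u : s < t -> t < u ->
  chain_metric x s y t + chain_metric y t z u <= chain_metric x s z u.
Proof.
move=> st tu; rewrite -lerBrDr; apply: chain_metric_le => // v hv.
rewrite lerBrDr addrC -lerBrDr; apply: chain_metric_le => // w hw.
by rewrite lerBrDr addrC; apply: chain_metric_ge; exact: chain_cat hw.
Qed.

Lemma chain_metric_split x s r y t (e : R) : s < r -> r < t -> 0 < e ->
  exists m, chain_metric x s y t <= chain_metric x s m r + chain_metric m r y t + e.
Proof.
move=> sr rt e0; have st := lt_trans sr rt.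
have [v hv hve] : exists2 v, chain x s y t v & chain_metric x s y t - e < v.
  apply: sup_adherent => //; split.
    by exists (- ((y - x) ^+ 2 / (t - s))); apply: chain_step => //; exact: St_dirichlet.
  by exists (act t - act s - (y - x) ^+ 2 / (t - s)) => w /chain_le.
have [m [v1 [v2 [h1 h2 h3]]]] := chain_split hv sr rt.
exists m; have := chain_metric_ge h1; have := chain_metric_ge h2; lra.
Qed.

Lemma chain_metric_continuous : real_continuous4 chain_metric.
Proof.
apply: (midpoint_continuous act_cont act_nd).
- exact: chain_metric_dirichlet.
- exact: chain_metric_bound.
- exact: chain_metric_superadd.
- exact: chain_metric_split.
Qed.

Lemma chain_metric_directed : directed_metric (to_metric chain_metric).
Proof.
exact: directed_to_metric chain_metric_continuous chain_metric_superadd.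
Qed.

End Chains.

(** * Integrals of densities as functions of time *)

Section IntervalIntegrals.
Context {R : realType}.
Notation mu := (@lebesgue_measure R).
Implicit Types (r : R -> \bar R) (s t u a b : R).
Local Open Scope ereal_scope.

Lemma measurable_itvS r a b s t : (a <= s)%R -> (t <= b)%R ->
  measurable_fun (`[a, b] : set R) r -> measurable_fun (`[s, t] : set R) r.
Proof.
move=> as_ tb; apply: measurable_funS => //.
by apply: subset_itv; rewrite bnd_simp.
Qed.

Lemma ge0_integral_itvD r s t u : (s <= t)%R -> (t <= u)%R ->
  measurable_fun (`[s, u] : set R) r -> (forall x, (s <= x <= u)%R -> 0 <= r x) ->
  \int[mu]_(x in `[s, u]) r x =
  \int[mu]_(x in `[s, t]) r x + \int[mu]_(x in `[t, u]) r x.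
Proof.
move=> st tu mr r0.
have -> : (`[s, u] = `[s, t] `|` `]t, u])%classic.
  by rewrite -itv_bndbnd_setU// bnd_simp.
have mtu : measurable_fun (`]t, u] : set R) r.
  apply: measurable_funS mr => //; apply: subset_itv; by rewrite bnd_simp.
rewrite ge0_integral_setU//=.
- by rewrite integral_itv_obnd_cbnd.
- rewrite -itv_bndbnd_setU// bnd_simp//.
- move=> x [] /=; rewrite in_itv/= => /andP[h1 h2]; apply: r0.
    by rewrite h1 (le_trans h2).
  by rewrite h2 (le_trans st)// ltW.
- apply/disj_setPS => x [] /=; rewrite !in_itv/= => /andP[_ h1] /andP[h2 _].
  by move: h1; rewrite leNgt h2.
Qed.

(** Clamping makes this a continuous nondecreasing function on the whole line, as
    [midpoint_continuous] demands of [act]. *)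
Definition cumul r t : R := fine (\int[mu]_(x in `[0%R, clamp 0 1 t]) r x).

Definition density r := [/\ measurable_fun (`[0%R, 1%R] : set R) r,
  forall x, (0 <= x <= 1)%R -> 0 <= r x & \int[mu]_(x in `[0%R, 1%R]) r x < +oo].

Lemma density_integral_ge0 r s t : density r -> (0 <= s)%R -> (t <= 1)%R ->
  0 <= \int[mu]_(x in `[s, t]) r x.
Proof.
move=> [_ r0 _] s0 t1; apply: integral_ge0 => x /=; rewrite in_itv/= => /andP[sx xt].
by apply: r0; rewrite (le_trans s0 sx) (le_trans xt t1).
Qed.

Lemma density_integral_fin r s t : density r -> (0 <= s)%R -> (t <= 1)%R ->
  \int[mu]_(x in `[s, t]) r x \is a fin_num.
Proof.
move=> dr s0 t1; have [mr r0 rfin] := dr.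
rewrite ge0_fin_numE ?density_integral_ge0//; apply: le_lt_trans rfin.
apply: ge0_subset_integral => //; first by apply: subset_itv; rewrite bnd_simp.
Qed.

Lemma cumulE r s t : density r -> (0 <= s)%R -> (s <= t)%R -> (t <= 1)%R ->
  \int[mu]_(x in `[s, t]) r x = (cumul r t - cumul r s)%:E.
Proof.
move=> dr s0 st t1; have [mr r0 rfin] := dr.
rewrite /cumul !clamp_id ?(le_trans s0)// ?(le_trans st)//.
rewrite (ge0_integral_itvD s0 st).
- rewrite fineD ?density_integral_fin// ?(le_trans st)//.
  by rewrite addrAC subrr add0r fineK// density_integral_fin.
- exact: measurable_itvS mr.
- by move=> x /andP[x0 xt]; apply: r0; rewrite x0 (le_trans xt).
Qed.

Lemma cumul_clamp r t : cumul r t = cumul r (clamp 0 1 t).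
Proof. by rewrite /cumul (@clamp_id _ _ _ (clamp 0 1 t))// ?clamp_ge ?clamp_le. Qed.

Lemma cumul_nondecreasing r : density r -> {homo cumul r : x y / (x <= y)%R}.
Proof.
move=> dr x y xy; rewrite cumul_clamp (cumul_clamp r y).
have h := @clamp_nondecreasing _ 0%R 1%R _ _ xy.
have c1 : (clamp 0 1 y <= 1 :> R)%R by exact: clamp_le.
have c0 : (0 <= clamp 0 1 x :> R)%R by exact: clamp_ge.
by rewrite -subr_ge0 -lee_fin -cumulE// density_integral_ge0.
Qed.

Lemma cumul0 r : cumul r 0%R = 0%R.
Proof. by rewrite /cumul clamp_id// set_itv1 integral_set1. Qed.

Lemma density_integrable r : density r -> mu.-integrable `[0%R, 1%R] r.
Proof.
move=> [mr r0 rfin]; apply/integrableP; split => //.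
apply: le_lt_trans rfin; apply: ge0_le_integral_all => // x.
by rewrite /= in_itv/= => x01; rewrite gee0_abs// r0.
Qed.

(** The density may be [+oo] on a null set, so it is first replaced by its finite part, with which
    it agrees almost everywhere. *)
Lemma cumul_continuous r : density r -> continuous (cumul r).
Proof.
move=> dr; have ir := density_integrable dr.
have [mr r0 rfin] := dr.
pose f := fine \o r.
have rf : ae_eq mu (`[0%R, 1%R]%classic : set R) r (EFin \o f).
  have : {ae mu, forall x, `[0%R, 1%R]%classic x -> r x \is a fin_num}.
    by apply: integrable_ae; [exact: measurable_itv|exact: ir].
  apply: filterS; first exact: (ae_filter_ringOfSetsType mu).
  by move=> x /= h /h xfin; rewrite /f/= fineK.
have mf : measurable_fun (`[0%R, 1%R] : set R) (EFin \o f).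
  by apply/measurable_EFinP; exact: measurableT_comp.
have intf : mu.-integrable `[0%R, 1%R] (EFin \o f).
  apply/integrableP; split => //; apply: le_lt_trans rfin.
  rewrite le_eqVlt; apply/orP; left; apply/eqP; apply: ge0_ae_eq_integral_all => //.
  - move: rf; apply: filterS => x /= h x01.
    transitivity `|r x|; first by rewrite h.
    by apply: gee0_abs; apply: r0; move: x01; rewrite in_itv.
have cF := parameterized_integral_continuous ler01 intf.
have EF x : (0 <= x)%R -> (x <= 1)%R -> cumul r x = parameterized_integral mu 0%R x f.
  move=> x0 x1; rewrite /cumul clamp_id// /parameterized_integral /Rintegral.
  congr fine; apply: ae_eq_integral => //.
  - exact: measurable_itvS mr.
  - exact: (@measurable_itvS _ 0%R 1%R).
  - move: rf; apply: filterS => y /= h; rewrite in_itv/= => /andP[y0 yx]; apply: h.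
    by rewrite in_itv/= y0 (le_trans yx).
move=> x; move/subspace_continuousP : cF => /(_ (clamp 0 1 x)).
have cx : clamp 0 1 x \in `[0%R, 1%R] by rewrite in_itv/= clamp_ge clamp_le.
move=> /(_ cx) cF.
have -> : cumul r = (fun y => parameterized_integral mu 0%R y f) \o clamp 0 1.
  by apply/funext => y /=; rewrite cumul_clamp EF// ?clamp_ge ?clamp_le.
apply: cvg_comp cF => A; rewrite /within /= => nA.
have H := @clamp_continuous _ 0%R 1%R x _ nA.
apply: (@filterS _ (nbhs x) _ _ _ _ H) => y /=; apply.
by rewrite in_itv/= clamp_ge clamp_le.
Qed.

End IntervalIntegrals.

(** * The metric planted by a countable family of curves *)

Section PlantedFamily.
Context {R : realType}.
Notation mu := (@lebesgue_measure R).
Implicit Types (g : R -> R).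

Lemma energy_ge0 g (s t : R) : (0 <= energy g s t)%E.
Proof.
rewrite /energy; case: asboolP => // _; apply: integral_ge0 => x _.
by rewrite lee_fin sqr_ge0.
Qed.

Lemma energy_fin_abs_cont g (s t : R) : energy g s t \is a fin_num -> abs_cont_on g s t.
Proof. by rewrite /energy; case: asboolP. Qed.

Lemma energy_split g (s r t : R) : s <= r -> r <= t -> s < t -> abs_cont_on g s t ->
  energy g s t = (energy g s r + energy g r t)%E.
Proof.
move=> sr rt st gac; have [f [mf Ef _]] := energyE st gac.
rewrite !Ef ?(ltW st)//; apply: ge0_integral_itvD => //; last first.
  by move=> x _; rewrite lee_fin sqr_ge0.
by apply/measurable_EFinP; apply: measurable_funX; exact: measurable_funTS mf.
Qed.

Lemma energy_cauchy_schwarz g (s t : R) : s < t -> energy g s t \is a fin_num ->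
  (g t - g s) ^+ 2 / (t - s) <= fine (energy g s t).
Proof.
move=> st fin; have [f [_ _ h]] := energyE st (energy_fin_abs_cont fin).
by rewrite -lee_fin fineK// h.
Qed.

Lemma energy_fin_split g (s r t : R) : s < r -> r < t -> energy g s t \is a fin_num ->
  [/\ energy g s r \is a fin_num, energy g r t \is a fin_num &
    fine (energy g s t) = fine (energy g s r) + fine (energy g r t)].
Proof.
move=> sr rt fin; have st := lt_trans sr rt.
have E := energy_split (ltW sr) (ltW rt) st (energy_fin_abs_cont fin).
have [f1 f2] : energy g s r \is a fin_num /\ energy g r t \is a fin_num.
  by move: fin; rewrite E fin_numD => /andP[].
by rewrite E fineD.
Qed.

Lemma rate_density g rho (r : R -> \bar R) : admissible g rho -> density r ->
  (forall t, 0 <= t <= 1 -> ((rho t)%:E <= r t)%E) -> density (EFin \o rho).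
Proof.
move=> [_ [mrho rho0]] [mr r0 rfin] rhor; split.
- exact/measurable_EFinP.
- by move=> x x01; rewrite lee_fin rho0.
- apply: le_lt_trans rfin; apply: ge0_le_integral_all => x; rewrite /= in_itv/= => x01.
    by rewrite lee_fin rho0.
  exact: rhor.
Qed.

Lemma curve_metricE g rho (s t : R) : density (EFin \o rho) ->
  0 <= s -> s < t -> t <= 1 -> energy g s t \is a fin_num ->
  curve_metric g rho (g s) s (g t) t =
  (cumul (EFin \o rho) t - cumul (EFin \o rho) s - fine (energy g s t))%:E.
Proof.
move=> drho s0 st t1 fin; rewrite /curve_metric asboolT//.
by rewrite (cumulE drho s0 (ltW st) t1) -{1}(fineK fin) -EFinB.
Qed.

Lemma curve_metric_ge g rho (x s y t v : R) : density (EFin \o rho) ->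
  (v%:E <= curve_metric g rho x s y t)%E ->
  [/\ 0 <= s, s < t, t <= 1, x = g s & y = g t] /\
  [/\ energy g s t \is a fin_num &
   v <= cumul (EFin \o rho) t - cumul (EFin \o rho) s - fine (energy g s t)].
Proof.
move=> drho; rewrite /curve_metric; case: asboolP => [|_]; last by rewrite leeNy_eq.
move=> [s0 [st [t1 [-> ->]]]]; rewrite (cumulE drho s0 (ltW st) t1) => h.
have fin : energy g s t \is a fin_num.
  rewrite ge0_fin_numE ?energy_ge0// ltey; apply/eqP => E.
  by move: h; rewrite E.
by split => //; split => //; move: h; rewrite -{1}(fineK fin) -EFinB lee_fin.
Qed.

Lemma curve_metric_le g rho (x s y t : R) (e : \bar R) : density (EFin \o rho) ->
  (0 <= s -> s < t -> t <= 1 -> x = g s -> y = g t -> energy g s t \is a fin_num ->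
   ((cumul (EFin \o rho) t - cumul (EFin \o rho) s - fine (energy g s t))%:E <= e)%E) ->
  (curve_metric g rho x s y t <= e)%E.
Proof.
move=> drho h; rewrite /curve_metric; case: asboolP => [|_]; last exact: leNye.
move=> [s0 [st [t1 [xs yt]]]].
have [fin|] := boolP (energy g s t \is a fin_num).
  by rewrite (cumulE drho s0 (ltW st) t1) -{1}(fineK fin) -EFinB h.
rewrite ge0_fin_numE ?energy_ge0// -leNgt leye_eq => /eqP ->.
by rewrite (cumulE drho s0 (ltW st) t1) leNye.
Qed.

Lemma le_cumulB (r1 r2 : R -> \bar R) (s t : R) : density r1 -> density r2 ->
  0 <= s -> s <= t -> t <= 1 ->
  (forall x, 0 <= x <= 1 -> (r1 x <= r2 x)%E) ->
  cumul r1 t - cumul r1 s <= cumul r2 t - cumul r2 s.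
Proof.
move=> d1 d2 s0 st t1 h; rewrite -lee_fin -!cumulE//.
apply: ge0_le_integral_all => x; rewrite /= in_itv/= => /andP[sx xt].
  by case: d1 => _ r0 _; apply: r0; rewrite (le_trans s0) ?(le_trans xt).
by apply: h; rewrite (le_trans s0) ?(le_trans xt).
Qed.

(** An inequality, because the curve metric takes the value [-oo] while steps have real values. *)
Definition planted_step (gam rho : nat -> R -> R) (x s y t v : R) : Prop :=
  v <= - ((y - x) ^+ 2 / (t - s)) \/
  exists i, (v%:E <= curve_metric (gam i) (rho i) x s y t)%E.

Definition planted_metric gam rho := to_metric (chain_metric (planted_step gam rho)).

Variables (gam rho : nat -> R -> R) (r : R -> \bar R).
Hypotheses (adm : forall i, admissible (gam i) (rho i)) (dr : density r).
Hypothesis rho_le : forall i t, 0 <= t <= 1 -> ((rho i t)%:E <= r t)%E.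

Let drho i : density (EFin \o rho i).
Proof. exact: rate_density (adm i) dr (@rho_le i). Qed.

Lemma planted_step_dirichlet (x s y t : R) : s < t ->
  planted_step gam rho x s y t (- ((y - x) ^+ 2 / (t - s))).
Proof. by left. Qed.

(** The energy of a curve dominates the Dirichlet cost between its endpoints, so one density above
    every rate bounds steps along any of the curves. *)
Lemma planted_step_le (x s y t v : R) : s < t -> planted_step gam rho x s y t v ->
  v <= cumul r t - cumul r s - (y - x) ^+ 2 / (t - s).
Proof.
move=> st [h|[i h]].
  have := cumul_nondecreasing dr (ltW st); lra.
have [[s0 _ t1 -> ->] [fin hv]] := curve_metric_ge (drho i) h.
have := energy_cauchy_schwarz st fin.
have := le_cumulB (drho i) dr s0 (ltW st) t1 (@rho_le i); lra.
Qed.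

(** A straight step is cut on its segment, a step along a curve on that curve. *)
Lemma planted_step_split (x s u y t v : R) : s < u -> u < t ->
  planted_step gam rho x s y t v ->
  exists m v1 v2, [/\ planted_step gam rho x s m u v1,
    planted_step gam rho m u y t v2 & v <= v1 + v2].
Proof.
move=> su ut [h|[i h]].
  pose m := x + (y - x) * ((u - s) / (t - s)).
  exists m, (- ((m - x) ^+ 2 / (u - s))), (- ((y - m) ^+ 2 / (t - u))).
  split; try by left.
  apply: le_trans h _; rewrite le_eqVlt; apply/orP; left; apply/eqP.
  have us0 : 0 < u - s by rewrite subr_gt0.
  have tu0 : 0 < t - u by rewrite subr_gt0.
  have ts0 : 0 < t - s by rewrite subr_gt0 (lt_trans su).
  by rewrite /m; field; rewrite !gt_eqF.
have [[s0 _ t1 -> ->] [fin hv]] := curve_metric_ge (drho i) h.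
have [f1 f2 fE] := energy_fin_split su ut fin.
have u0 : 0 <= u by rewrite (le_trans s0)// ltW.
have u1 : u <= 1 by rewrite (le_trans _ t1)// ltW.
exists (gam i u).
exists (cumul (EFin \o rho i) u - cumul (EFin \o rho i) s - fine (energy (gam i) s u)).
exists (cumul (EFin \o rho i) t - cumul (EFin \o rho i) u - fine (energy (gam i) u t)).
split; last by move: hv; rewrite fE; lra.
  by right; exists i; rewrite curve_metricE.
by right; exists i; rewrite curve_metricE.
Qed.

Let act_cont := cumul_continuous dr.
Let act_nd := cumul_nondecreasing dr.

Lemma planted_metric_directed : directed_metric (planted_metric gam rho).
Proof.
exact: (chain_metric_directed act_cont act_nd planted_step_dirichlet
  planted_step_le planted_step_split).
Qed.

Lemma planted_metric_continuous :
  real_continuous4 (chain_metric (planted_step gam rho)).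
Proof.
exact: (chain_metric_continuous act_cont act_nd planted_step_dirichlet
  planted_step_le planted_step_split).
Qed.

Lemma chain_le_planted_metric (x s y t v : R) :
  chain (planted_step gam rho) x s y t v ->
  v <= chain_metric (planted_step gam rho) x s y t.
Proof. exact: (chain_metric_ge planted_step_le). Qed.

Lemma planted_metric_le (x s y t M : R) : s < t ->
  (forall v, chain (planted_step gam rho) x s y t v -> v <= M) ->
  chain_metric (planted_step gam rho) x s y t <= M.
Proof. exact: (chain_metric_le planted_step_dirichlet). Qed.

Lemma planted_metric_bound (x s y t : R) : s < t ->
  chain_metric (planted_step gam rho) x s y t <=
  cumul r t - cumul r s - (y - x) ^+ 2 / (t - s).
Proof. exact: (chain_metric_bound planted_step_dirichlet planted_step_le). Qed.

Lemma dirichlet_le_planted_metric : mle (@dirichlet R) (planted_metric gam rho).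
Proof.
move=> x s y t st; rewrite /dirichlet /planted_metric /to_metric lee_fin.
exact: (chain_metric_dirichlet planted_step_dirichlet planted_step_le).
Qed.

Lemma curve_le_planted_metric i : mle (curve_metric (gam i) (rho i)) (planted_metric gam rho).
Proof.
move=> x s y t st; apply: curve_metric_le => // s0 _ t1 -> -> fin.
rewrite lee_fin; apply: chain_le_planted_metric; apply: chain_step => //.
by right; exists i; rewrite curve_metricE.
Qed.

Lemma planted_metric_min (e : metric4 R) : directed_metric e -> mle (@dirichlet R) e ->
  (forall i, mle (curve_metric (gam i) (rho i)) e) -> mle (planted_metric gam rho) e.
Proof.
move=> [_ [efin esup]] ed ec.
have stepe x s y t v : s < t -> planted_step gam rho x s y t v -> (v%:E <= e x s y t)%E.
  move=> st [h|[i h]]; last exact: le_trans h (ec i _ _ _ _ st).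
  by apply: le_trans (ed _ _ _ _ st); rewrite lee_fin.
have chaine x s y t v : chain (planted_step gam rho) x s y t v -> (v%:E <= e x s y t)%E.
  elim=> [{}x {}s {}y {}t {}v st hv|{}x {}s m u {}y {}t {}v w su hv hc IH].
    exact: stepe.
  rewrite EFinD; apply: le_trans (esup _ _ m _ _ _ su (chain_lt hc)).
  by apply: leeD => //; exact: stepe.
move=> x s y t st; rewrite /planted_metric /to_metric.
case: (e x s y t) (efin x s y t st) (chaine x s y t) => [z||] // _ h.
  by rewrite lee_fin; apply: planted_metric_le => // v /h; rewrite lee_fin.
have /h := chain_step st (@planted_step_dirichlet x s y t st).
by rewrite leeNy_eq.
Qed.

Lemma planted_metricP : planted gam rho (planted_metric gam rho).
Proof.
split => //; split; first exact: planted_metric_directed.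
split; first exact: dirichlet_le_planted_metric.
split; first exact: curve_le_planted_metric.
exact: planted_metric_min.
Qed.

End PlantedFamily.

(** A two-sided slope bound, such as concavity gives, differentiates F across [q ^+ 2] without
    comparing one-sided formulas. *)
Lemma squeeze_is_derive {R : realType} (H l : R -> R) (p b : R) : b < p ->
  (forall u v : R, b <= u -> u <= v ->
    l v * (v - u) <= H v - H u <= l u * (v - u)) ->
  {for p, continuous l} -> is_derive p 1 H (l p).
Proof.
move=> bp h cl.
have C : (fun k => k^-1 *: ((H \o shift p) (k *: 1) - H p)) @ 0^' --> l p.
  apply/cvgrPdist_le => e e0.
  have /cvgrPdist_le/(_ e e0)/nbhs_ballP[d /= d0 hd] := cl.
  have m0 : 0 < Num.min d (p - b) by rewrite lt_min d0 subr_gt0.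
  exists (Num.min d (p - b)) => //= k; rewrite /ball_/=.
  rewrite sub0r normrN lt_min => /andP[kd kb] k0.
  rewrite /shift/= !scaler1 -/(_ *: _) [_ *: _]mulrC.
  have {}hd : `|l p - l (k + p)| <= e.
    by apply: hd; rewrite /ball/= opprD addrCA subrr addr0 normrN.
  have [kp|kn] : 0 < k \/ k < 0 by case: (ltgtP k 0) k0 => // ? _; [right|left].
  - have pk : p <= k + p by rewrite lerDr ltW.
    have /andP[] := h p (k + p) (ltW bp) pk; rewrite addrK => h1 h2.
    rewrite -ler_pdivlMr// in h1; rewrite -ler_pdivrMr// in h2.
    apply: le_trans hd; rewrite ger0_norm ?subr_ge0// ger0_norm ?subr_ge0 ?(le_trans h1)//.
    by rewrite lerD2l lerN2.
  - have bk : b <= k + p.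
      by move: kb; rewrite ltr0_norm// => ?; lra.
    have kp : k + p <= p by rewrite gerDr ltW.
    have /andP[] := h (k + p) p bk kp.
    have -> : p - (k + p) = - k by ring.
    have nk : 0 < - k by rewrite oppr_gt0.
    move=> h1 h2; rewrite -ler_pdivlMr// in h1; rewrite -ler_pdivrMr// in h2.
    have E : (H p - H (k + p)) / - k = (H (k + p) - H p) / k.
      by field; rewrite lt_eqF.
    rewrite E in h1 h2; apply: le_trans hd.
    rewrite ler0_norm ?subr_le0// ler0_norm ?subr_le0 ?(le_trans h1)//.
    by rewrite lerN2 lerD2l lerN2.
split; first by apply/cvg_ex; exists (l p); exact: C.
exact: cvg_lim C.
Qed.

(** * Derivative of the optimal curve *)

Section CandidateCalculus.
Context {R : realType}.
Notation mu := (@lebesgue_measure R).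
Variables c q : R.
Hypotheses (c0 : 0 < c) (q0 : 0 < q) (q1 : q < 1).
Implicit Types (s t x : R).

Let F := opt_curve c q.
Let lam := opt_weight c q.

Let q20 : 0 < q ^+ 2. Proof. by rewrite exprn_gt0. Qed.
Let sqrtq2 : Num.sqrt (q ^+ 2) = q.
Proof. by rewrite sqrtr_sqr ger0_norm// ltW. Qed.

Lemma opt_weightE t : lam t = c * q / Num.sqrt (Num.max t (q ^+ 2)).
Proof.
rewrite /lam /opt_weight; case: leP => [tq|qt].
  by rewrite sqrtq2 mulfK// gt_eqF.
by [].
Qed.

Lemma opt_weight_continuous : continuous lam.
Proof.
have -> : lam = fun t => c * q / Num.sqrt (Num.max t (q ^+ 2)).
  by apply/funext => t; exact: opt_weightE.
move=> t; apply: cvgM; first exact: cvg_cst.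
have m0 : 0 < Num.max t (q ^+ 2) by rewrite lt_max q20 orbT.
apply: cvgV; first by rewrite gt_eqF// sqrtr_gt0.
have cm : {for t, continuous ((idfun : R -> R^o) \max (cst (q ^+ 2)))}.
  by apply: continuous_max; [exact: cvg_id|exact: cvg_cst].
exact: (continuous_comp cm (@sqrt_continuous R _)).
Qed.

(** From [q ^+ 2 / 2] on, F is concave with derivative [lam t - 2 * c * q], a single formula for the
    last two pieces. This is what makes [F'] continuous at [q ^+ 2]. *)
Lemma opt_curve_slope s t : q ^+ 2 / 2 <= s -> s <= t ->
  (lam t - 2 * c * q) * (t - s) <= F t - F s <= (lam s - 2 * c * q) * (t - s).
Proof.
have step1 u v : q ^+ 2 / 2 <= u -> u <= v -> v <= q ^+ 2 ->
    F v - F u = (c - 2 * c * q) * (v - u).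
  move=> ua uv vb; rewrite /F (opt_curve2 c ua (le_trans uv vb)).
  by rewrite (opt_curve2 c (le_trans ua uv) vb); ring.
have step2 u v : q ^+ 2 <= u -> u <= v ->
    (lam v - 2 * c * q) * (v - u) <= F v - F u <= (lam u - 2 * c * q) * (v - u).
  move=> ub uv; have vb := le_trans ub uv.
  have u0 : 0 <= u by rewrite (le_trans _ ub)// ltW.
  have v0 : 0 <= v by rewrite (le_trans _ vb)// ltW.
  rewrite /F (opt_curve3 c q0 ub) (opt_curve3 c q0 vb) /lam.
  rewrite (opt_weight2 c q0 ub) (opt_weight2 c q0 vb).
  have : 0 < Num.sqrt u by rewrite sqrtr_gt0 (lt_le_trans q20).
  have : 0 < Num.sqrt v by rewrite sqrtr_gt0 (lt_le_trans q20).
  move: (sqr_sqrtr u0) (sqr_sqrtr v0).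
  move: (Num.sqrt u) (Num.sqrt v) => x y <- <- y0 x0.
  have cq : 0 <= c * q by rewrite mulr_ge0// ltW.
  apply/andP; split; rewrite -subr_ge0.
  - set X := (X in 0 <= X).
    have -> : X = c * q * (y - x) ^+ 2 / y by rewrite /X; field; rewrite gt_eqF.
    by rewrite divr_ge0 ?(ltW y0)// mulr_ge0// sqr_ge0.
  - set X := (X in 0 <= X).
    have -> : X = c * q * (y - x) ^+ 2 / x by rewrite /X; field; rewrite gt_eqF.
    by rewrite divr_ge0 ?(ltW x0)// mulr_ge0// sqr_ge0.
move=> sa st; have [tb|/ltW tb] := leP t (q ^+ 2).
  by rewrite (step1 _ _ sa st tb) /lam (opt_weight1 c tb) (opt_weight1 c (le_trans st tb)) lexx.
have [sb|/ltW sb] := leP s (q ^+ 2); last exact: step2.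
have := step1 _ _ sa sb (lexx _); have /andP[] := step2 _ _ (lexx _) tb.
have l1 : lam t <= c by rewrite /lam opt_weight_le.
have ts : 0 <= q ^+ 2 - s by rewrite subr_ge0.
have := ler_wpM2r ts l1.
by rewrite /lam (opt_weight1 c sb) (opt_weight1 c (lexx _)) => ? ? ? ?; apply/andP; split; lra.
Qed.

Lemma opt_curve_lipschitz s t : s <= t -> `|F t - F s| <= 3 * c * (t - s).
Proof.
have c0' := c0; have q0' := q0; have q1' := q1.
have late u v : q ^+ 2 / 2 <= u -> u <= v -> `|F v - F u| <= 3 * c * (v - u).
  move=> au uv; have /andP[h1 h2] := opt_curve_slope au uv.
  have vu0 : 0 <= v - u by rewrite subr_ge0.
  have l0 : 0 < lam v by exact: opt_weight_gt0.
  have l1 : lam u <= c by exact: opt_weight_le.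
  have cq : c * q <= c by rewrite ler_piMr// ltW.
  have cq0 : 0 < c * q by rewrite mulr_gt0.
  have := ler_wpM2r vu0 (_ : - (3 * c) <= lam v - 2 * c * q).
  have := ler_wpM2r vu0 (_ : lam u - 2 * c * q <= 3 * c).
  move=> /(_ ltac:(lra)) k1 /(_ ltac:(lra)) k2.
  by rewrite ler_norml; apply/andP; split; lra.
have early u v : u <= v -> v <= q ^+ 2 / 2 -> `|F v - F u| <= 3 * c * (v - u).
  move=> uv va; rewrite /F (opt_curve1 c va) (opt_curve1 c (le_trans uv va)) -mulrBr normrM.
  rewrite [`|v - u|]ger0_norm ?subr_ge0// ler_wpM2r ?subr_ge0// ger0_norm.
    by rewrite mulrC ler_wpM2r//; lra.
  by rewrite mulr_ge0//; lra.
move=> st; have [ta|/ltW ta] := leP t (q ^+ 2 / 2); first exact: early.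
have [sa|/ltW sa] := leP s (q ^+ 2 / 2); last exact: late.
have h1 := early _ _ sa (lexx _); have h2 := late _ _ (lexx _) ta.
have -> : F t - F s = (F t - F (q ^+ 2 / 2)) + (F (q ^+ 2 / 2) - F s) by ring.
by rewrite (le_trans (ler_normD _ _))//; lra.
Qed.

Lemma opt_curve_continuous : continuous F.
Proof. exact: lipschitz_continuous opt_curve_lipschitz. Qed.

Lemma opt_curve_abs_cont s t : abs_cont_on F s t.
Proof. exact: lipschitz_abs_cont_on opt_curve_lipschitz. Qed.

Lemma opt_curve_is_derive t : q ^+ 2 / 2 < t ->
  is_derive t 1 F (lam t - 2 * c * q).
Proof.
move=> at_; apply: (squeeze_is_derive at_ opt_curve_slope).
apply: continuousB; first exact: opt_weight_continuous.
exact: cst_continuous.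
Qed.

Lemma opt_curve_derive1_late t : q ^+ 2 / 2 < t -> derive1 F t = lam t - 2 * c * q.
Proof.
by move=> at_; have h := opt_curve_is_derive at_; rewrite derive1E derive_val.
Qed.

Lemma opt_curve_derive1_early t : t < q ^+ 2 / 2 -> derive1 F t = c * (3 - 2 * q).
Proof.
move=> ta; rewrite derive1E -(@near_eq_derive _ _ _ (fun t => c * (3 - 2 * q) * t) F t 1).
  rewrite (_ : (fun t => _) = c * (3 - 2 * q) \*: (@id R)); last by apply/funext.
  by rewrite deriveZ// derive_id /GRing.scale/= mulr1.
near=> s; rewrite /F opt_curve1//; apply: ltW; near: s; exact: lt_nbhsl.
Unshelve. all: by end_near. Qed.

(** Since [lam ^+ 2 - (lam - 2 c q)^2 = 4 c q F' + 4 c^2 q^2], the action is affine in F and [t]. *)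
Lemma opt_action_late t : q ^+ 2 / 2 <= t ->
  opt_action c q t = 4 * c * q * F t + 4 * c ^+ 2 * q ^+ 2 * (t - 1).
Proof.
move=> ta; have [tb|/ltW tb] := leP t (q ^+ 2).
  by rewrite /F (opt_curve2 c ta tb) (opt_action2 c ta tb); ring.
rewrite /F (opt_curve3 c q0 tb) (opt_action3 c q0 tb).
have t0 : 0 <= t by rewrite (le_trans _ tb)// ltW.
by move: (sqr_sqrtr t0); move: (Num.sqrt t) => w <-; ring.
Qed.

End CandidateCalculus.

(** * Action along the optimal curve *)

Section CandidateAction.
Context {R : realType}.
Notation mu := (@lebesgue_measure R).
Variables c q : R.
Hypotheses (c0 : 0 < c) (q0 : 0 < q) (q1 : q < 1).
Implicit Types (s t x : R).

Let F := opt_curve c q.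
Let lam := opt_weight c q.

Definition opt_rate t : R := opt_weight c q t ^+ 2.

Let lam_continuous : continuous lam.
Proof. exact: opt_weight_continuous. Qed.

Lemma continuous_itv_integrable (f : R -> R) s t : continuous f ->
  mu.-integrable `[s, t] (EFin \o f).
Proof.
move=> cf; apply: continuous_compact_integrable; first exact: segment_compact.
exact: continuous_subspaceT.
Qed.

Lemma continuousX (f : R -> R) n : continuous f -> continuous (fun x => f x ^+ n).
Proof.
move=> cf x; apply: (@continuous_comp _ _ _ f (fun y => y ^+ n)); first exact: cf.
exact: exprn_continuous.
Qed.

Lemma continuous_scale (k : R) (f : R -> R) : continuous f ->
  continuous (k \*: f).
Proof. by move=> cf x; apply: cvgM; [exact: cvg_cst|exact: cf]. Qed.

Lemma continuous_density (f : R -> R) : continuous f ->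
  (forall x, 0 <= x <= 1 -> 0 <= f x) -> density (EFin \o f).
Proof.
move=> cf f0; have := continuous_itv_integrable 0 1 cf.
move=> /integrableP[mf fin]; split => //.
apply: le_lt_trans fin; apply: ge0_le_integral_all => x; rewrite /= in_itv/= => x01.
  by rewrite lee_fin f0.
by rewrite lee_fin ler_norm.
Qed.

Lemma opt_rate_continuous : continuous opt_rate.
Proof. exact: continuousX. Qed.

Lemma opt_rate_density : density (EFin \o opt_rate).
Proof.
apply: continuous_density; first exact: opt_rate_continuous.
by move=> x _; exact: sqr_ge0.
Qed.

Lemma opt_curve_admissible : admissible F opt_rate.
Proof.
split; first by apply: continuous_subspaceT; exact: opt_curve_continuous.
split; last by move=> t _; exact: sqr_ge0.
by case: opt_rate_density => /measurable_EFinP.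
Qed.

Let curve_action s t : R :=
  cumul (EFin \o opt_rate) t - cumul (EFin \o opt_rate) s - fine (energy F s t).

(** The continuous [h] stands for the derivative of F inside the interval; the endpoints, where F
    may have a kink, form a null set. *)
Let action_piece s t (h Phi : R -> R) : 0 <= s -> s < t -> t <= 1 ->
  continuous h -> (forall x, s < x -> x < t -> derive1 F x = h x) ->
  continuous Phi ->
  (forall x, s < x -> x < t -> is_derive x 1 Phi (lam x ^+ 2 - h x ^+ 2)) ->
  energy F s t \is a fin_num /\ curve_action s t = Phi t - Phi s.
Proof.
move=> s0 st t1 ch Fh cPhi dPhi.
have Fac : abs_cont_on F s t by exact: opt_curve_abs_cont.
have ch2 : continuous (fun x => h x ^+ 2) by exact: continuousX.
have ih := continuous_itv_integrable s t ch2.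
have EF : energy F s t = (\int[mu]_(x in `[s, t]) (h x ^+ 2)%:E)%E.
  rewrite /energy asboolT//; apply: ge0_ae_eq_integral_all => //.
  - by case/integrableP: ih.
  - by move=> x _; rewrite lee_fin sqr_ge0.
  - by move=> x _; rewrite lee_fin sqr_ge0.
  apply: filterS2 (ae_neq s) (ae_neq t); first exact: (ae_filter_ringOfSetsType mu).
  move=> x xs xt; rewrite /= in_itv/= => /andP[sx tx]; rewrite Fh//.
    by rewrite lt_neqAle eq_sym xs.
  by rewrite lt_neqAle xt.
have fin : energy F s t \is a fin_num.
  by rewrite EF; apply: integrable_fin_num => //; exact: measurable_itv.
split => //; apply/EFin_inj; rewrite /curve_action EFinB fineK//.
rewrite -cumulE//; [|exact: opt_rate_density|exact: ltW].
have ir := continuous_itv_integrable s t opt_rate_continuous.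
rewrite EF -integralB_EFin//.
rewrite (@continuous_FTC2 _ _ Phi) //.
- apply: continuous_subspaceT => x; apply: continuousB.
    exact: opt_rate_continuous.
  exact: ch2.
- split.
  + by move=> x; rewrite in_itv/= => /andP[sx xt]; have [] := dPhi x sx xt.
  + by apply: cvg_at_right_filter; exact: cPhi.
  + by apply: cvg_at_left_filter; exact: cPhi.
- move=> x; rewrite in_itv/= => /andP[sx xt]; have hd := dPhi x sx xt.
  by rewrite derive1E derive_val.
Qed.

Let action_split s u t : 0 <= s -> s < u -> u < t -> t <= 1 ->
  energy F s u \is a fin_num -> energy F u t \is a fin_num ->
  energy F s t \is a fin_num /\ curve_action s t = curve_action s u + curve_action u t.
Proof.
move=> s0 su ut t1 f1 f2.
have E := energy_split (ltW su) (ltW ut) (lt_trans su ut) (opt_curve_abs_cont c0 q0 q1 s t).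
split; first by rewrite E fin_numD f1.
by rewrite /curve_action E fineD//; ring.
Qed.

Let q22 : q ^+ 2 / 2 <= q ^+ 2.
Proof. by rewrite ler_pdivrMr// ler_pMr ?exprn_gt0//; lra. Qed.

Lemma opt_curve_action s t : 0 <= s -> s < t -> t <= 1 ->
  energy F s t \is a fin_num /\
  cumul (EFin \o opt_rate) t - cumul (EFin \o opt_rate) s - fine (energy F s t) =
  opt_action c q t - opt_action c q s.
Proof.
have early u v : 0 <= u -> u < v -> v <= q ^+ 2 / 2 -> v <= 1 ->
    energy F u v \is a fin_num /\ curve_action u v = opt_action c q v - opt_action c q u.
  move=> u0 uv va v1; pose Phi := (c ^+ 2 - (c * (3 - 2 * q)) ^+ 2) \*: (@id R).
  have [] := @action_piece u v (cst (c * (3 - 2 * q))) Phi u0 uv v1.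
  - by move=> x; exact: cst_continuous.
  - by move=> x _ xv; rewrite opt_curve_derive1_early// (lt_le_trans xv).
  - by apply: continuous_scale => x; exact: cvg_id.
  - move=> x _ xv; rewrite /lam (opt_weight1 c); last by rewrite (le_trans (ltW xv))// (le_trans va).
    by apply: is_derive_eq; rewrite /GRing.scale/= mulr1.
  move=> fin ->; split => //.
  rewrite (opt_action1 c va) (opt_action1 c (le_trans (ltW uv) va)) /Phi /GRing.scale/=.
  rewrite /GRing.scale_fun /GRing.scale/=; ring.
have late u v : q ^+ 2 / 2 <= u -> u < v -> v <= 1 ->
    energy F u v \is a fin_num /\ curve_action u v = opt_action c q v - opt_action c q u.
  move=> ua uv v1.
  have u0 : 0 <= u by rewrite (le_trans _ ua)// divr_ge0// sqr_ge0.
  pose Phi := ((4 * c * q) \*: F) + ((4 * c ^+ 2 * q ^+ 2) \*: (@id R)).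
  have [] := @action_piece u v (fun x => lam x - 2 * c * q) Phi u0 uv v1.
  - by move=> x; apply: continuousB; [exact: lam_continuous|exact: cst_continuous].
  - by move=> x ux _; rewrite opt_curve_derive1_late// (le_lt_trans ua).
  - move=> x; apply: continuousD; apply: continuous_scale.
      exact: opt_curve_continuous.
    by move=> y; exact: cvg_id.
  - move=> x ux _; have h := opt_curve_is_derive c0 q0 (le_lt_trans ua ux).
    by apply: is_derive_eq; rewrite /GRing.scale/= -/lam; ring.
  move=> fin ->; split => //.
  rewrite !opt_action_late// ?(le_trans ua (ltW uv))// /Phi.
  rewrite fctE /GRing.scale_fun /GRing.scale/= -/F; ring.
move=> s0 st t1; rewrite -/(curve_action s t).
have [ta|ta] := leP t (q ^+ 2 / 2); first exact: early.
have [sa|sa] := ltP s (q ^+ 2 / 2); last exact: late.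
have a1 : q ^+ 2 / 2 <= 1 by rewrite (le_trans (ltW ta)).
have [f1 E1] := early _ _ s0 sa (lexx _) a1.
have [f2 E2] := late _ _ (lexx _) ta t1.
have [f3 E3] := action_split s0 sa ta t1 f1 f2.
by split => //; rewrite E3 E1 E2; ring.
Qed.

End CandidateAction.

(** * Weighted lower bound for dominating densities *)

Section WeightedBound.
Context {R : realType}.
Notation mu := (@lebesgue_measure R).
Variables c q : R.
Hypotheses (c0 : 0 < c) (q0 : 0 < q) (q1 : q < 1).
Hypothesis hcq : c * (3 - 2 * q) * q ^+ 2 = 2.
Implicit Types (s t x : R).

Let lam := opt_weight c q.

Let lam_continuous : continuous lam.
Proof. exact: opt_weight_continuous. Qed.

Let q20 : 0 < q ^+ 2. Proof. by rewrite exprn_gt0. Qed.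
Let q21 : q ^+ 2 < 1. Proof. by rewrite expr_lt1// ltW. Qed.
Let sqrtq2 : Num.sqrt (q ^+ 2) = q.
Proof. by rewrite sqrtr_sqr ger0_norm// ltW. Qed.

(** The two pieces contribute [c^3 q^2] and [2 c^3 q^2 (1 - q)]. Their sum is [c^2] times the
    left-hand side of [hcq], the condition that F passes through [(1, a)]. *)
Lemma opt_weight_cube_integral :
  (\int[mu]_(x in `[0%R, 1%R]) (lam x ^+ 3)%:E = (2 * c ^+ 2)%:E)%E.
Proof.
have c3 : continuous (fun x => lam x ^+ 3) by exact: continuousX.
have ic s t := continuous_itv_integrable s t c3.
rewrite (@ge0_integral_itvD _ _ 0 (q ^+ 2) 1); [|exact: ltW|exact: ltW| |]; last 2 first.
- by case/integrableP: (ic 0 1).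
- by move=> x _; rewrite lee_fin exprn_ge0// ltW// opt_weight_gt0.
have -> : (\int[mu]_(x in `[0%R, (q ^+ 2)%R]) (lam x ^+ 3)%:E = (c ^+ 3 * q ^+ 2)%:E)%E.
  rewrite (eq_integral (fun=> (c ^+ 3)%:E)).
    rewrite integral_cst//= lebesgue_measure_itv/= lte_fin q20 -EFinB -EFinM.
    by rewrite subr0.
  by move=> x; rewrite inE/= in_itv/= => /andP[_ xq]; rewrite /lam opt_weight1.
pose Phi x := - (2 * (c ^+ 3 * q ^+ 3)) *: (Num.sqrt x)^-1.
have dPhi x : q ^+ 2 < x -> is_derive x 1 Phi (lam x ^+ 3).
  move=> qx; have x0 : 0 < x by exact: lt_trans qx.
  have s0 : 0 < Num.sqrt x by rewrite sqrtr_gt0.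
  have h1 := is_derive1_sqrt x0.
  have sn : Num.sqrt x != 0 by rewrite gt_eqF.
  have h2 := is_deriveV sn h1.
  apply: is_derive_eq; rewrite /GRing.scale/= /lam (opt_weight2 c q0 (ltW qx)).
  by rewrite -exprVn; field; rewrite gt_eqF.
rewrite (@continuous_FTC2 _ _ Phi) //.
- rewrite -EFinB -EFinD /Phi sqrtq2 sqrtr1 /GRing.scale/=; congr (_%:E).
  have -> : 2 * c ^+ 2 = (c * (3 - 2 * q) * q ^+ 2) * c ^+ 2 by rewrite hcq.
  by field; rewrite gt_eqF.
- exact: continuous_subspaceT.
- have cPhi x : 0 < x -> {for x, continuous Phi}.
    move=> x0; apply: cvgZr; apply: cvgV; first by rewrite gt_eqF// sqrtr_gt0.
    exact: sqrt_continuous.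
  split.
  + by move=> x; rewrite in_itv/= => /andP[qx _]; have [] := dPhi x qx.
  + by apply: cvg_at_right_filter; exact: cPhi.
  + by apply: cvg_at_left_filter; exact: cPhi.
- move=> x; rewrite in_itv/= => /andP[qx _]; have hd := dPhi x qx.
  by rewrite derive1E derive_val.
Qed.

Definition weighted (r : R -> \bar R) x : \bar R := ((opt_weight c q x)%:E * r x)%E.

Let mlam (D : set R) : measurable_fun D (EFin \o lam).
Proof.
by apply/measurable_EFinP; apply: measurable_funTS; exact: continuous_measurable_fun.
Qed.

Lemma weighted_density r : density r -> density (weighted r).
Proof.
move=> dr; have [mr r0 rfin] := dr; split.
- by apply: emeasurable_funM => //; exact: mlam.
- by move=> x x01; rewrite mule_ge0 ?r0// lee_fin ltW// opt_weight_gt0.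
- apply: (@le_lt_trans _ _ (\int[mu]_(x in `[0%R, 1%R]) (c%:E * r x))%E).
    apply: ge0_le_integral_all => x; rewrite /= in_itv/= => x01.
      by rewrite mule_ge0 ?r0// lee_fin ltW// opt_weight_gt0.
    by rewrite lee_wpmul2r ?r0// lee_fin opt_weight_le.
  rewrite ge0_integralZl//.
  + by rewrite lte_mul_pinfty// lee_fin ltW.
  + by rewrite lee_fin ltW.
Qed.

(** On [[s, t]] the weight is smallest at [t]. *)
Lemma cumul_weighted r s t : density r -> 0 <= s -> s <= t -> t <= 1 ->
  lam t * (cumul r t - cumul r s) <= cumul (weighted r) t - cumul (weighted r) s.
Proof.
move=> dr s0 st t1; have dw := weighted_density dr.
have [mr r0 rfin] := dr.
rewrite -lee_fin EFinM -!cumulE//.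
rewrite -ge0_integralZl//.
- apply: ge0_le_integral_all => x; rewrite /= in_itv/= => /andP[sx xt].
    by rewrite mule_ge0 ?r0 ?(le_trans s0)// ?(le_trans xt)// lee_fin ltW// opt_weight_gt0.
  rewrite lee_wpmul2r ?r0 ?(le_trans s0)// ?(le_trans xt)//.
  by rewrite lee_fin opt_weight_nonincreasing.
- exact: measurable_itvS mr.
- move=> x; rewrite /= in_itv/= => /andP[sx xt].
  by rewrite r0// (le_trans s0)// (le_trans xt).
- by rewrite lee_fin ltW// opt_weight_gt0.
Qed.

Let a := q ^+ 2 / 2.

Definition admissible_path (path len : R -> R) :=
  [/\ path 0 = 0, path a = 1, path 1 = 0, len 0 = 0 &
   forall s, 0 < s -> s <= 1 -> - (path s ^+ 2 / s) <= len s].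

(** The upper bound of the metric by Dirichlet plus integrated density, read along the path. *)
Definition dominated_by (r : R -> \bar R) (path len : R -> R) :=
  forall s t, 0 <= s -> s < t -> t <= 1 ->
    len t - len s <= cumul r t - cumul r s - (path t - path s) ^+ 2 / (t - s).

Lemma weighted_variational path len r C1 C2 s t : admissible_path path len -> density r ->
  dominated_by r path len -> 0 < s -> s < a -> a <= t -> t <= 1 ->
  c * ((a * path s - s) ^+ 2 / (a * s * (a - s))) <=
  cumul (weighted r) 1 + 2 * C1 * (path t / t - a^-1) - 2 * C2 * (path t / t) +
  C1 ^+ 2 * (weight_primitive c q t - weight_primitive c q a) +
  C2 ^+ 2 * (weight_primitive c q 1 - weight_primitive c q t).
Proof.
move=> [p0 pa p1 l0 lge] dr dom s0 sa at_ t1.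
have aw s' t' : 0 <= s' -> s' <= t' -> t' <= 1 ->
    opt_weight c q t' * (cumul r t' - cumul r s') <=
    cumul (weighted r) t' - cumul (weighted r) s'.
  exact: cumul_weighted.
have := variational_inequality c0 q0 q1 p0 pa p1 l0 lge dom aw C1 C2 s0 sa at_ t1.
by rewrite cumul0 subr0.
Qed.

Let a0 : 0 < a. Proof. by rewrite /a divr_gt0. Qed.
Let aq : a < q ^+ 2.
Proof. by rewrite /a ltr_pdivrMr// ltr_pMr//; lra. Qed.

Lemma weight_primitive_total :
  weight_primitive c q 1 - weight_primitive c q a = 2 / (q ^+ 4 * c ^+ 2).
Proof.
rewrite (weight_primitive1 c (ltW aq)) (weight_primitive2 c0 q0 (ltW q21)) sqrtr1 mulr1.
have -> : 2 / (q ^+ 4 * c ^+ 2) = (c * (3 - 2 * q) * q ^+ 2) / (q ^+ 4 * c ^+ 2).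
  by rewrite hcq.
by rewrite /a; field; rewrite !gt_eqF.
Qed.

Lemma weighted_lower_bound path len r : admissible_path path len -> density r ->
  dominated_by r path len -> 2 * c ^+ 2 <= cumul (weighted r) 1.
Proof.
move=> hp dr dom; have a20 : 0 < a / 2 by rewrite divr_gt0.
have a2 : a / 2 < a by rewrite ltr_pdivrMr// ltr_pMr//; lra.
have a1 : a <= 1 by rewrite ltW// (lt_trans aq).
(* At [t = a] the bound is quadratic in the multiplier, [C^2 (J 1 - J a) - 2 C / a] with [J] the
   weight primitive; its minimiser is [C = q^2 c^2] and its minimum [- 2 c^2]. *)
have := weighted_variational (q ^+ 2 * c ^+ 2) (q ^+ 2 * c ^+ 2) hp dr dom a20 a2 (lexx a) a1.
have hpa : path a = 1 by case: hp.
rewrite hpa mul1r !subrr !mulr0 !addr0 weight_primitive_total.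
set X := (X in X <= _); have X0 : 0 <= X.
  rewrite /X mulr_ge0 ?(ltW c0)// divr_ge0 ?sqr_ge0//.
  by rewrite !mulr_ge0 ?subr_ge0 ?ltW.
have -> : (q ^+ 2 * c ^+ 2) ^+ 2 * (2 / (q ^+ 4 * c ^+ 2)) = 2 * c ^+ 2.
  by field; rewrite !gt_eqF.
have -> : 2 * (q ^+ 2 * c ^+ 2) * a^-1 = 4 * c ^+ 2.
  by rewrite /a; field; rewrite gt_eqF.
lra.
Qed.

End WeightedBound.

(** * Length along a geodesic *)

Section GeodesicLength.
Context {R : realType}.
Implicit Types (e : metric4 R) (pi len : R -> R) (s t : R).

Definition length_along e pi len :=
  forall s t, 0 <= s -> s < t -> t <= 1 -> e (pi s) s (pi t) t = (len t - len s)%:E.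

Lemma directed_fin_num e x s y t : directed_metric e -> mle (@dirichlet R) e ->
  s < t -> e x s y t \is a fin_num.
Proof.
move=> [_ [efin _]] ed st; rewrite fin_numE efin// andbT.
by apply/eqP => E; have := ed x s y t st; rewrite E leeNy_eq.
Qed.

Lemma le_partition_sum3 e pi s t : 0 < s -> s < t -> t < 1 ->
  (path_length e pi 0 1 <= e (pi 0%R) 0%R (pi s) s + e (pi s) s (pi t) t +
    e (pi t) t (pi 1%R) 1%R)%E.
Proof.
move=> s0 st t1; apply: ereal_inf_lbound.
exists 3%N, (nth 1 [:: 0; s; t; 1]); split => //; split => //; split => //; split.
  by case=> [|[|[|]]].
by rewrite !big_ord_recl big_ord0 /= adde0 addeA.
Qed.

Lemma le_partition_sum2 e pi s : 0 < s -> s < 1 ->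
  (path_length e pi 0 1 <= e (pi 0%R) 0%R (pi s) s + e (pi s) s (pi 1%R) 1%R)%E.
Proof.
move=> s0 s1; apply: ereal_inf_lbound.
exists 2%N, (nth 1 [:: 0; s; 1]); split => //; split => //; split => //; split.
  by case=> [|[|]].
by rewrite !big_ord_recl big_ord0 /= adde0.
Qed.

(** Superadditivity says that refining a partition cannot increase its sum, the geodesic property
    that no sum drops below the total. Partitions into at most three steps already force additivity,
    hence a potential [len]. *)
Lemma geodesic_length e pi : directed_metric e -> mle (@dirichlet R) e ->
  geodesic e pi 0 0 0 1 ->
  exists len, [/\ len 0 = 0, length_along e pi len &
    forall s, 0 < s -> s <= 1 -> - (pi s ^+ 2 / s) <= len s].
Proof.
move=> edir ed [_ [pi0 [pi1 piL]]]; have [_ [_ esup]] := edir.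
pose E s t := fine (e (pi s) s (pi t) t).
have EE s t : s < t -> e (pi s) s (pi t) t = (E s t)%:E.
  by move=> st; rewrite /E fineK// directed_fin_num.
have tri s t u : s < t -> t < u -> E s t + E t u <= E s u.
  move=> st tu; have := esup (pi s) s (pi t) t (pi u) u st tu.
  by rewrite !EE// ?(lt_trans st tu)// -EFinD lee_fin.
have piL' : path_length e pi 0 1 = (E 0 1)%:E by rewrite piL -EE// pi0 pi1.
have p2 s : 0 < s -> s < 1 -> E 0 1 <= E 0 s + E s 1.
  by move=> s0 s1; have := le_partition_sum2 e pi s0 s1; rewrite piL' !EE// -EFinD lee_fin.
have p3 s t : 0 < s -> s < t -> t < 1 -> E 0 1 <= E 0 s + E s t + E t 1.
  move=> s0 st t1; have := le_partition_sum3 e pi s0 st t1.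
  by rewrite piL' !EE// -!EFinD lee_fin.
(* [E 0 0] is a value outside the domain of the metric, so the potential is set to 0 there by
   hand. *)
pose len t := if t <= 0 then 0 else E 0 t.
have len0 : len 0 = 0 by rewrite /len lexx.
have lenE t : 0 < t -> len t = E 0 t by move=> t0; rewrite /len leNgt t0.
have d01 : 0 <= E 0 1.
  by have := ed (pi 0) 0 (pi 1) 1 ltr01; rewrite EE// /dirichlet lee_fin pi0 pi1 subrr expr0n/= mul0r oppr0.
have add s t : 0 <= s -> s < t -> t <= 1 -> E s t = len t - len s.
  rewrite le_eqVlt => /predU1P[<- t0 _|s0 st]; first by rewrite len0 subr0 lenE.
  rewrite !lenE//; last exact: lt_trans st.
  rewrite le_eqVlt => /predU1P[t1|t1].
    move: st; rewrite t1 => s1; have := p2 s s0 s1; have := tri 0 s 1 s0 s1; lra.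
  have := p3 s t s0 st t1; have := tri 0 s t s0 st.
  have := tri 0 t 1 (lt_trans s0 st) t1; lra.
exists len; split => //.
  by move=> s t s0 st t1; rewrite EE// add.
move=> s s0; rewrite le_eqVlt => /predU1P[->|s1].
  by rewrite pi1 expr0n/= mul0r oppr0 lenE.
have h1 := add s 1 (ltW s0) s1 (lexx _); have h2 := lenE 1 ltr01.
have h3 := ed (pi 0) 0 (pi s) s s0; rewrite EE// /dirichlet lee_fin pi0 !subr0 in h3.
by have h4 := tri 0 s 1 s0 s1; have h5 := lenE s s0; lra.
Qed.

Lemma planted_le_metric gam rho r e : planted gam rho e -> density r ->
  (forall i t, 0 <= t <= 1 -> ((rho i t)%:E <= r t)%E) ->
  mle e (planted_metric gam rho).
Proof.
move=> [adm [_ [_ [_ emin]]]] dr rr; apply: emin.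
- exact: planted_metric_directed dr rr.
- exact: dirichlet_le_planted_metric dr rr.
- exact: curve_le_planted_metric dr rr.
Qed.

Lemma planted_dominated gam rho r e pi len : planted gam rho e -> density r ->
  (forall i t, 0 <= t <= 1 -> ((rho i t)%:E <= r t)%E) ->
  length_along e pi len -> dominated_by r pi len.
Proof.
move=> pl dr rr hl s t s0 st t1; have := planted_le_metric pl dr rr (pi s) (pi t) st.
rewrite hl// /planted_metric /to_metric lee_fin => /le_trans; apply.
by apply: planted_metric_bound => //; case: pl.
Qed.

End GeodesicLength.

(** * Mass of planted families *)

Section DensityAlgebra.
Context {R : realType}.
Notation mu := (@lebesgue_measure R).
Implicit Types (r : R -> \bar R) (m w : R -> R) (t x k : R).

Lemma density_le r r' : measurable_fun (`[0%R, 1%R] : set R) r ->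
  (forall x, 0 <= x <= 1 -> (0 <= r x)%E) -> (forall x, 0 <= x <= 1 -> (r x <= r' x)%E) ->
  density r' -> density r.
Proof.
move=> mr r0 rr' [_ _ fin]; split => //; apply: le_lt_trans fin.
apply: ge0_le_integral_all => x; rewrite /= in_itv/= => x01; first exact: r0.
exact: rr'.
Qed.

Lemma le_cumul r r' t : density r -> density r' ->
  (forall x, 0 <= x <= 1 -> (r x <= r' x)%E) -> cumul r t <= cumul r' t.
Proof.
move=> dr dr' h; rewrite cumul_clamp (cumul_clamp r').
have := @le_cumulB _ r r' 0 (clamp 0 1 t) dr dr' (lexx _) (clamp_ge 0 1 t)
  (clamp_le t ler01) h.
by rewrite !cumul0 !subr0.
Qed.

Let mS (r : R -> \bar R) t : measurable_fun (`[0%R, 1%R] : set R) r ->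
  measurable_fun (`[0%R, clamp 0 1 t] : set R) r.
Proof. by apply: measurable_itvS => //; exact: clamp_le. Qed.

Let p01 t x : (`[0%R, clamp 0 1 t]%classic : set R) x -> 0 <= x <= 1.
Proof. by rewrite /= in_itv/= => /andP[-> xt]; rewrite (le_trans xt)// clamp_le. Qed.

Lemma densityD r r' : density r -> density r' -> density (r \+ r')%E.
Proof.
move=> [m1 h1 f1] [m2 h2 f2]; split.
- exact: emeasurable_funD.
- by move=> x x01; rewrite adde_ge0 ?h1 ?h2.
- have H1 x : (`[0%R, 1%R]%classic : set R) x -> (0 <= r x)%E by rewrite /= in_itv/=; exact: h1.
  have H2 x : (`[0%R, 1%R]%classic : set R) x -> (0 <= r' x)%E by rewrite /= in_itv/=; exact: h2.
  by rewrite ge0_integralD//= lte_add_pinfty.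
Qed.

Lemma cumulD r r' t : density r -> density r' -> cumul (r \+ r')%E t = cumul r t + cumul r' t.
Proof.
move=> dr dr'; have [m1 h1 f1] := dr; have [m2 h2 f2] := dr'.
rewrite /cumul ge0_integralD//=.
- by rewrite fineD// density_integral_fin// clamp_le.
- by move=> x /p01; exact: h1.
- exact: mS.
- by move=> x /p01; exact: h2.
- exact: mS.
Qed.

Lemma densityZ k r : 0 <= k -> density r -> density (fun x => (k%:E * r x)%E).
Proof.
move=> k0 [m1 h1 f1]; split.
- exact: measurable_funeM.
- by move=> x x01; rewrite mule_ge0 ?h1 ?lee_fin.
- have H1 x : (`[0%R, 1%R]%classic : set R) x -> (0 <= r x)%E by rewrite /= in_itv/=; exact: h1.
  by rewrite ge0_integralZl//= lte_mul_pinfty// lee_fin.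
Qed.

Lemma cumulZ k r t : 0 <= k -> density r -> cumul (fun x => (k%:E * r x)%E) t = k * cumul r t.
Proof.
move=> k0 dr; have [m1 h1 f1] := dr.
have H1 x : (`[0%R, clamp 0 1 t]%classic : set R) x -> (0 <= r x)%E by move=> /p01; exact: h1.
rewrite /cumul ge0_integralZl//=; last exact: mS.
by rewrite fineM// density_integral_fin// clamp_le.
Qed.

Lemma density_cst k : 0 <= k -> density (fun=> k%:E).
Proof. by move=> k0; apply: (@continuous_density _ (cst k)) => // x; exact: cvg_cst. Qed.

Lemma cumul_cst k : cumul (fun=> k%:E) 1 = k.
Proof.
rewrite /cumul clamp_id// integral_cst//= lebesgue_measure_itv/= lte_fin ltr01.
by rewrite sube0 mule1.
Qed.

Lemma density_weight w k r : continuous w -> (forall x, 0 <= x <= 1 -> 0 <= w x <= k) ->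
  density r -> density (fun x => ((w x)%:E * r x)%E).
Proof.
move=> cw wk dr; have [m1 h1 f1] := dr.
have k0 : 0 <= k.
  have /wk/andP[w0 wk0] : 0 <= (0 : R) <= 1 by rewrite lexx ler01.
  exact: le_trans w0 wk0.
apply: (@density_le _ (fun x => (k%:E * r x)%E)); last exact: densityZ.
- apply: emeasurable_funM => //; apply/measurable_EFinP; apply: measurable_funTS.
  exact: continuous_measurable_fun.
- by move=> x x01; rewrite mule_ge0 ?h1// lee_fin; case/andP: (wk x x01).
- by move=> x x01; rewrite lee_wpmul2r ?h1// lee_fin; case/andP: (wk x x01).
Qed.

(* The tangent of the concave map [p^(3/2) |-> p] at [m^3]. *)
Definition young_bound m r x : \bar R := ((2 / (3 * m x))%:E * (r x + (m x ^+ 3 / 2)%:E))%E.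

(** With [u] the square root of [p] and [M = m x], the gap is [(u - M)^2 (2 u + M) / (3 M)], with a
    double zero at the point of tangency. *)
Lemma young_bound_ge m r x p : 0 <= p -> 0 < m x -> ((p `^ (3 / 2))%:E <= r x)%E ->
  (p%:E <= young_bound m r x)%E.
Proof.
move=> p0 m0 pr; rewrite /young_bound.
apply: (@le_trans _ _ ((2 / (3 * m x))%:E * ((p `^ (3 / 2))%:E + (m x ^+ 3 / 2)%:E))%E); last first.
  rewrite lee_wpmul2l//; first by rewrite lee_fin divr_ge0// mulr_ge0// ltW.
  exact: leeD2r.
rewrite -EFinD -EFinM lee_fin.
have -> : p `^ (3 / 2) = Num.sqrt p ^+ 3.
  rewrite -powR12_sqrt// -powR_mulrn ?powR_ge0// -powRrM; congr (_ `^ _); lra.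
have u0 := sqrtr_ge0 p; have uE := sqr_sqrtr p0.
set u := Num.sqrt p in u0 uE *; rewrite -uE.
set M := m x in m0 *; rewrite -subr_ge0.
have -> : 2 / (3 * M) * (u ^+ 3 + M ^+ 3 / 2) - u ^+ 2 = (u - M) ^+ 2 * (2 * u + M) / (3 * M).
  by field; rewrite gt_eqF.
have M0 := ltW m0.
by rewrite divr_ge0// mulr_ge0// ?sqr_ge0// addr_ge0// mulr_ge0.
Qed.

Lemma young_bound_density m r k : continuous m -> (forall x, 0 < m x) -> 0 < k ->
  (forall x, 0 <= x <= 1 -> k <= m x) -> density r -> density (young_bound m r).
Proof.
move=> cm m0 k0 km dr.
apply: (@density_weight (fun x => 2 / (3 * m x)) (2 / (3 * k)) (fun x => r x + (m x ^+ 3 / 2)%:E)%E).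
- move=> x; apply: cvgM; first exact: cvg_cst.
  apply: cvgV; first by rewrite gt_eqF// mulr_gt0.
  by apply: cvgM; [exact: cvg_cst|exact: cm].
- move=> x x01; rewrite divr_ge0 ?mulr_ge0 ?(ltW (m0 x))//=.
  by rewrite ler_pM2l// lef_pV2 ?posrE ?mulr_gt0// ler_pM2l// km.
- apply: densityD => //; apply: (@continuous_density _ (fun x => m x ^+ 3 / 2)).
    by move=> x; apply: cvgM; [exact: continuousX|exact: cvg_cst].
  by move=> x _; rewrite divr_ge0// exprn_ge0// ltW.
Qed.

End DensityAlgebra.

(** * Sums of the powers [rho_i ^ (3/2)] *)

Section PowerSum.
Context {R : realType}.
Notation mu := (@lebesgue_measure R).
Variable rho : nat -> R -> R.
Implicit Types (B : nat -> R -> bool) (x : R).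

(** The mask [B] selects at each time which curves are counted: all of them, those in a tube around
    F, or those off F. *)
Definition power_term B i x : \bar R :=
  if B i x then ((rho i x) `^ (3 / 2))%:E else 0%E.

Definition power_sum B x : \bar R := (\sum_(0 <= i <oo) power_term B i x)%E.

Definition everywhere (_ : nat) (_ : R) := true.

Lemma power_term_ge0 B i x : (0 <= power_term B i x)%E.
Proof. by rewrite /power_term; case: ifP => // _; rewrite lee_fin powR_ge0. Qed.

Lemma power_sum_ge0 B x : (0 <= power_sum B x)%E.
Proof. by apply: nneseries_ge0 => i _ _; exact: power_term_ge0. Qed.

Lemma power_sum_partial B N x :
  (\sum_(0 <= i < N) power_term B i x <= power_sum B x)%E.
Proof. by apply: nneseries_lim_ge => i _ _; exact: power_term_ge0. Qed.

Lemma power_sum_ge B i x : B i x -> (((rho i x) `^ (3 / 2))%:E <= power_sum B x)%E.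
Proof.
move=> Bix; apply: le_trans (power_sum_partial B i.+1 x).
rewrite big_nat_recr//= {2}/power_term Bix leeDr// sume_ge0// => j _.
exact: power_term_ge0.
Qed.

Lemma le_power_sum B B' x : (forall i, B i x -> B' i x) ->
  (power_sum B x <= power_sum B' x)%E.
Proof.
move=> BB'; apply: lee_nneseries => i _; first by move=> _; exact: power_term_ge0.
rewrite /power_term; case: ifP => [/BB' ->//|_]; exact: power_term_ge0.
Qed.

Lemma power_sum_predC B x :
  (power_sum B x + power_sum (fun i => predC (B i)) x)%E = power_sum everywhere x.
Proof.
rewrite -nneseriesD; last 2 first.
- by move=> i _ _; exact: power_term_ge0.
- by move=> i _ _; exact: power_term_ge0.
by apply: eq_eseriesr => i _; rewrite /power_term/=; case: (B i x); rewrite /= ?adde0 ?add0e.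
Qed.

Hypothesis mrho : forall i, measurable_fun (`[0%R, 1%R] : set R) (rho i).

Lemma power_term_measurable B i : measurable_fun (`[0%R, 1%R] : set R) (B i) ->
  measurable_fun (`[0%R, 1%R] : set R) (power_term B i).
Proof.
move=> mB; apply: (@measurable_fun_if _ _ _ _ _ _ _ _ _ mB) => //.
apply/measurable_EFinP; apply: (@measurable_funS _ _ _ _ (`[0%R, 1%R]%classic : set R)) => //.
exact: (measurableT_comp (@measurable_powR R (3 / 2))).
Qed.

Lemma power_sum_measurable B : (forall i, measurable_fun (`[0%R, 1%R] : set R) (B i)) ->
  measurable_fun (`[0%R, 1%R] : set R) (power_sum B).
Proof.
move=> mB; apply: (@ge0_emeasurable_sum _ _ R _ (power_term B) predT) => i.
  by move=> x _ _; exact: power_term_ge0.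
by move=> _; exact: power_term_measurable.
Qed.

Lemma family_rateE :
  family_rate rho = ((4 / 3)%:E * \int[mu]_(x in `[0%R, 1%R]) power_sum everywhere x)%E.
Proof.
rewrite integral_nneseries//; last 2 first.
- by move=> i; apply: power_term_measurable; exact: measurable_cst.
- by move=> i x _; exact: power_term_ge0.
rewrite -nneseriesZl//; by move=> i _; apply: integral_ge0 => x _; exact: power_term_ge0.
Qed.

Hypothesis rate_fin : (family_rate rho < +oo)%E.

Lemma power_sum_density B : (forall i, measurable_fun (`[0%R, 1%R] : set R) (B i)) ->
  density (power_sum B).
Proof.
move=> mB; apply: (@density_le _ _ (power_sum everywhere)).
- exact: power_sum_measurable.
- by move=> x _; exact: power_sum_ge0.
- by move=> x _; exact: le_power_sum.
split; [|by move=> x _; exact: power_sum_ge0|].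
  by apply: power_sum_measurable => i; exact: measurable_cst.
move: rate_fin; rewrite family_rateE ltNge => /negP h; rewrite ltNge; apply/negP.
by rewrite leye_eq => /eqP E; apply: h; rewrite E gt0_muley// lte_fin; lra.
Qed.

Lemma everywhere_density : density (power_sum everywhere).
Proof. by apply: power_sum_density => i; exact: measurable_cst. Qed.

Lemma family_rate_cumul : family_rate rho = (4 / 3 * cumul (power_sum everywhere) 1)%:E.
Proof.
by rewrite family_rateE (cumulE everywhere_density)// cumul0 subr0 -EFinM.
Qed.

Lemma cumul_power_sum_predC B t : (forall i, measurable_fun (`[0%R, 1%R] : set R) (B i)) ->
  cumul (power_sum B) t + cumul (power_sum (fun i => predC (B i))) t =
  cumul (power_sum everywhere) t.
Proof.
move=> mB; rewrite -cumulD; last 2 first.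
- exact: power_sum_density.
- apply: power_sum_density => i; apply: measurable_neg; exact: mB.
by congr (cumul _ t); apply/funext => x /=; rewrite power_sum_predC.
Qed.

End PowerSum.

(** * Excess of mass over the cube of the optimal weight *)

Section Excess.
Context {R : realType}.
Notation mu := (@lebesgue_measure R).
Variables c q : R.
Hypotheses (c0 : 0 < c) (q0 : 0 < q) (q1 : q < 1).
Hypothesis hcq : c * (3 - 2 * q) * q ^+ 2 = 2.
Implicit Types (s t x k eta eps : R) (U : R -> \bar R).

Let lam := opt_weight c q.

Let lam_continuous : continuous lam.
Proof. exact: opt_weight_continuous. Qed.

Let lam0 x : 0 < lam x.
Proof. exact: opt_weight_gt0. Qed.

Let lam3_density : density (fun x => (lam x ^+ 3)%:E).
Proof.
apply: (@continuous_density _ (fun x => lam x ^+ 3)); first exact: continuousX.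
by move=> x _; rewrite exprn_ge0// ltW.
Qed.

Lemma cumul_opt_weight_cube : cumul (fun x => (lam x ^+ 3)%:E) 1 = 2 * c ^+ 2.
Proof. by rewrite /cumul clamp_id// (opt_weight_cube_integral c0 q0 q1 hcq). Qed.

Lemma opt_weight_ge x : x <= 1 -> c * q <= lam x.
Proof.
move=> x1; apply: le_trans (opt_weight_nonincreasing c0 q0 x1).
by rewrite opt_weight2 ?sqrtr1 ?divr1// ltW// expr_lt1// ltW.
Qed.

Definition scaled_young k := young_bound (fun x => k * lam x).

Lemma scaled_young_density k U : 0 < k -> density U -> density (scaled_young k U).
Proof.
move=> k0; apply: (@young_bound_density _ _ _ (k * (c * q))).
- by move=> x; apply: cvgM; [exact: cvg_cst|exact: lam_continuous].
- by move=> x; rewrite mulr_gt0.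
- by rewrite !mulr_gt0.
- by move=> x /andP[_ x1]; rewrite ler_pM2l// opt_weight_ge.
Qed.

(** The weight cancels the slope of the tangent at [k * lam], leaving [U] with a constant
    coefficient. At [k = 1] this is [(2 U + lam^3) / 3], so a bound on weighted mass becomes a bound
    on the mass of [U]. *)
Lemma weighted_scaled_young k U x : 0 < k -> (0 <= U x)%E ->
  weighted c q (scaled_young k U) x =
  ((2 / (3 * k))%:E * U x + (k ^+ 2 / 3)%:E * (lam x ^+ 3)%:E)%E.
Proof.
move=> k0 U0; rewrite /weighted /scaled_young /young_bound.
have kl : 0 < k * lam x by rewrite mulr_gt0.
have g0 : 0 <= 2 / (3 * (k * lam x)) by rewrite divr_ge0// mulr_ge0// ltW.
have h0 : 0 <= (k * lam x) ^+ 3 / 2 by rewrite divr_ge0// exprn_ge0// ltW.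
rewrite ge0_muleDr// ge0_muleDr//; last 2 first.
- by rewrite mule_ge0.
- by rewrite -EFinM lee_fin mulr_ge0.
have ln : lam x != 0 by rewrite gt_eqF.
have kn : k != 0 by rewrite gt_eqF.
rewrite muleA -!EFinM -/lam; congr (_%:E * _ + _%:E)%E; first by field; rewrite ln kn.
by field; rewrite ln kn.
Qed.

Lemma cumul_weighted_scaled_young k U : 0 < k -> density U ->
  cumul (weighted c q (scaled_young k U)) 1 =
  2 / (3 * k) * cumul U 1 + k ^+ 2 / 3 * (2 * c ^+ 2).
Proof.
move=> k0 dU; have [_ U0 _] := dU.
have k1 : 0 <= 2 / (3 * k) by rewrite divr_ge0// mulr_ge0// ltW.
have k2 : 0 <= k ^+ 2 / 3 by rewrite divr_ge0// sqr_ge0.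
rewrite -cumul_opt_weight_cube -!cumulZ// -cumulD; [|exact: densityZ|exact: densityZ].
rewrite /cumul clamp_id//; congr fine; apply: eq_integral => x; rewrite inE/= in_itv/= => x01.
by rewrite weighted_scaled_young//= U0.
Qed.

Lemma mass_lower_bound path len U : admissible_path q path len -> density U ->
  dominated_by (scaled_young 1 U) path len -> 2 * c ^+ 2 <= cumul U 1.
Proof.
move=> hp dU dom; have dy := scaled_young_density ltr01 dU.
have := weighted_lower_bound c0 q0 q1 hcq hp dy dom.
rewrite cumul_weighted_scaled_young//; lra.
Qed.

Definition excess U x : \bar R := (maxe (U x - (lam x ^+ 3)%:E) 0)%E.

Lemma excess_ge0 U x : (0 <= excess U x)%E.
Proof. by rewrite /excess le_max lexx orbT. Qed.

Lemma excess_density U : density U -> density (excess U).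
Proof.
move=> dU; have [mU U0 _] := dU; apply: (@density_le _ _ U) => //.
- apply: measurable_maxe; last exact: measurable_cst.
  by apply: emeasurable_funB => //; case: lam3_density.
- by move=> x _; exact: excess_ge0.
- move=> x x01; rewrite /excess ge_max U0// andbT leeBlDr// leeDl//.
  by rewrite lee_fin exprn_ge0// ltW.
Qed.

Lemma le_excess U x : (U x <= (lam x ^+ 3)%:E + excess U x)%E.
Proof. by rewrite -leeBlDl// /excess le_max lexx. Qed.

(** The second tangent, taken slightly further out, is the smaller one where [U] is well above
    [lam ^+ 3]; that strict improvement is what controls the excess. *)
Definition double_young eta U x := mine (scaled_young 1 U x) (scaled_young (1 + eta) U x).

Lemma double_young_density eta U : 0 < eta -> density U -> density (double_young eta U).
Proof.
move=> e0 dU; have [m1 h1 _] := scaled_young_density ltr01 dU.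
have e1 : 0 < 1 + eta by rewrite addr_gt0.
have [m2 h2 _] := scaled_young_density e1 dU.
apply: density_le (scaled_young_density ltr01 dU).
- exact: measurable_mine.
- by move=> x x01; rewrite /double_young le_min h1// h2.
- by move=> x x01; rewrite /double_young ge_min lexx.
Qed.

(** The coefficient of the excess is the difference [2 / 3 - 2 / (3 (1 + eta))] of the two weighted
    slopes. The price is only [eta ^+ 2] in the coefficient of [lam ^+ 3]. *)
Let weighted_double_young eta U x : 0 < eta -> (0 <= U x)%E ->
  (weighted c q (double_young eta U) x +
    (2 * eta / (3 * (1 + eta)))%:E * excess U x <=
   (2 / 3)%:E * U x + (1 / 3 + eta ^+ 2)%:E * (lam x ^+ 3)%:E)%E.
Proof.
move=> e0 U0; have e1 : 0 < 1 + eta by rewrite addr_gt0.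
have l3 : 0 <= lam x ^+ 3 by rewrite exprn_ge0// ltW.
have wle k : k = 1 \/ k = 1 + eta ->
    (weighted c q (double_young eta U) x <= weighted c q (scaled_young k U) x)%E.
  move=> hk; rewrite /weighted lee_wpmul2l ?lee_fin ?(ltW (lam0 x))//.
  by rewrite /double_young ge_min; case: hk => ->; rewrite lexx ?orbT.
rewrite /excess; case: (leP (U x - (lam x ^+ 3)%:E)%E 0%E) => h.
  rewrite mule0 adde0; apply: le_trans (wle 1 (or_introl erefl)) _.
  rewrite weighted_scaled_young//; apply: leeD.
    by rewrite mulr1.
  by rewrite lee_wpmul2r// lee_fin expr1n lerDl sqr_ge0.
apply: le_trans (leeD2r _ (wle _ (or_intror erefl))) _.
rewrite weighted_scaled_young//.
case: (U x) U0 h => [u||]// u0 _; last first.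
  have z : (0 < (2 / 3 : R)%:E)%E by rewrite lte_fin; lra.
  by rewrite [X in (_ <= X + _)%E](gt0_muley z) -EFinM addye// leey.
rewrite -EFinB -!EFinM -!EFinD lee_fin.
have -> : 2 / (3 * (1 + eta)) * u + (1 + eta) ^+ 2 / 3 * lam x ^+ 3 +
   2 * eta / (3 * (1 + eta)) * (u - lam x ^+ 3) =
   2 / 3 * u + ((1 + eta) ^+ 2 / 3 - 2 * eta / (3 * (1 + eta))) * lam x ^+ 3.
  by field; rewrite gt_eqF.
rewrite lerD2l ler_wpM2r// -subr_ge0.
have -> : 1 / 3 + eta ^+ 2 - ((1 + eta) ^+ 2 / 3 - 2 * eta / (3 * (1 + eta))) =
  2 * eta ^+ 3 / (3 * (1 + eta)) by field; rewrite gt_eqF.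
by rewrite divr_ge0 ?mulr_ge0 ?exprn_ge0// ltW.
Qed.

(** The weighted lower bound still holds for the improved density. The improvement, of order [eta]
    times the excess, is therefore at most of order [eps + eta ^+ 2]; division by [eta] gives the
    claim. *)
Lemma excess_mass path len eta eps U : admissible_path q path len -> density U ->
  dominated_by (double_young eta U) path len -> 0 < eta -> eta <= 1 -> 0 <= eps ->
  cumul U 1 <= 2 * c ^+ 2 + eps ->
  cumul (excess U) 1 <= 2 * eps / eta + 6 * c ^+ 2 * eta.
Proof.
move=> hp dU dom e0 e1 eps0 hU; have [_ U0 _] := dU.
have dd := double_young_density e0 dU.
have k0 : 0 < 2 * eta / (3 * (1 + eta)) by rewrite divr_gt0 ?mulr_gt0// addr_gt0.
have := weighted_lower_bound c0 q0 q1 hcq hp dd dom.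
have dx := excess_density dU.
have dw := weighted_density c0 q0 dd.
have : cumul (weighted c q (double_young eta U) \+
   (fun x => (2 * eta / (3 * (1 + eta)))%:E * excess U x))%E 1 <=
   cumul ((fun x => (2 / 3)%:E * U x) \+
     (fun x => (1 / 3 + eta ^+ 2)%:E * (lam x ^+ 3)%:E))%E 1.
  apply: le_cumul.
  - by apply: densityD => //; apply: densityZ => //; exact: ltW.
  - apply: densityD; first by apply: densityZ => //; lra.
    by apply: densityZ => //; rewrite addr_ge0 ?sqr_ge0//; lra.
  - by move=> x x01; apply: weighted_double_young => //; exact: U0.
have k1 : (0 : R) <= 2 / 3 by lra.
have k2 : 0 <= 1 / 3 + eta ^+ 2 by rewrite addr_ge0 ?sqr_ge0//; lra.
have k3 := ltW k0.
rewrite (cumulD _ dw (densityZ k3 dx)) (cumulD _ (densityZ k1 dU) (densityZ k2 lam3_density)).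
rewrite !cumulZ//.
rewrite cumul_opt_weight_cube.
set W := cumul _ 1; set X := cumul (excess U) 1; set Y := cumul U 1 in hU *.
move=> h1 h2; have h3 : 2 * eta / (3 * (1 + eta)) * X <= 2 / 3 * eps + eta ^+ 2 * (2 * c ^+ 2).
  by lra.
have h4 : X <= (2 / 3 * eps + eta ^+ 2 * (2 * c ^+ 2)) / (2 * eta / (3 * (1 + eta))).
  by rewrite ler_pdivlMr// mulrC.
apply: le_trans h4 _.
have -> : (2 / 3 * eps + eta ^+ 2 * (2 * c ^+ 2)) / (2 * eta / (3 * (1 + eta))) =
  (eps / eta + 3 * eta * c ^+ 2) * (1 + eta).
  by field; rewrite !gt_eqF// addr_gt0.
have -> : 2 * eps / eta + 6 * c ^+ 2 * eta = (eps / eta + 3 * eta * c ^+ 2) * 2 by ring.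
rewrite ler_wpM2l//; last by lra.
have e2 := ltW e0; rewrite addr_ge0//; first by rewrite divr_ge0.
by rewrite mulr_ge0 ?sqr_ge0// mulr_ge0.
Qed.

(** The tangent takes the value [lam ^+ 2] at [U = lam ^+ 3], and its slope [2 / (3 * lam)] is at
    most [2 / (3 * c * q)] on [[0, 1]]. *)
Lemma scaled_young_le_excess U x : 0 <= x <= 1 -> (0 <= U x)%E ->
  (scaled_young 1 U x <= (opt_rate c q x)%:E + (2 / (3 * c * q))%:E * excess U x)%E.
Proof.
move=> /andP[x0 x1] U0; have l0 := lam0 x; have ex0 := excess_ge0 U x.
have cq0 : 0 < c * q by rewrite mulr_gt0.
have l3 : 0 <= lam x ^+ 3 by rewrite exprn_ge0// ltW.
apply: (@le_trans _ _ ((2 / (3 * lam x))%:E * ((lam x ^+ 3)%:E + excess U x + (lam x ^+ 3 / 2)%:E))%E).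
  rewrite /scaled_young /young_bound mul1r lee_wpmul2l//.
    by rewrite lee_fin divr_ge0// mulr_ge0// ltW.
  by rewrite leeD2r// le_excess.
rewrite addeAC -EFinD ge0_muleDr//; last by rewrite lee_fin; lra.
apply: leeD.
  rewrite -EFinM lee_fin /opt_rate -/lam le_eqVlt; apply/orP; left; apply/eqP.
  by field; rewrite gt_eqF.
rewrite lee_wpmul2r// lee_fin ler_pM2l// lef_pV2 ?posrE ?mulr_gt0//.
by rewrite -mulrA ler_pM2l// opt_weight_ge.
Qed.

End Excess.

(** * Minimal rate and the geodesic *)

Section RateBound.
Context {R : realType}.
Notation mu := (@lebesgue_measure R).
Variables c q : R.
Hypotheses (c0 : 0 < c) (q0 : 0 < q) (q1 : q < 1).
Hypothesis hcq : c * (3 - 2 * q) * q ^+ 2 = 2.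
Implicit Types (s t x k eta eps : R) (U : R -> \bar R).
Implicit Types (gam rho : nat -> R -> R) (e : metric4 R) (path len : R -> R).

Let lam := opt_weight c q.
Let F := opt_curve c q.
Let J := weight_primitive c q.
Let a := q ^+ 2 / 2.

Let lam0 x : 0 < lam x.
Proof. exact: opt_weight_gt0. Qed.

Let a0 : 0 < a. Proof. by rewrite /a divr_gt0// exprn_gt0. Qed.
Let aq : a < q ^+ 2.
Proof. by rewrite /a ltr_pdivrMr// ltr_pMr ?exprn_gt0//; lra. Qed.
Let qq1 : q ^+ 2 < 1. Proof. by rewrite expr_lt1// ltW. Qed.

Lemma admissible_measurable gam rho i : admissible (gam i) (rho i) ->
  measurable_fun (`[0%R, 1%R] : set R) (rho i).
Proof. by case=> _ []. Qed.

Lemma rate_le_scaled_young gam rho U k i t : 0 < k -> admissible (gam i) (rho i) ->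
  0 <= t <= 1 -> (((rho i t) `^ (3 / 2))%:E <= U t)%E ->
  ((rho i t)%:E <= scaled_young c q k U t)%E.
Proof.
move=> k0 [_ [_ rho0]] t01; apply: young_bound_ge; first exact: rho0.
by rewrite mulr_gt0.
Qed.

Section Representation.
Variables (gam rho : nat -> R -> R) (e : metric4 R) (path len : R -> R).
Hypotheses (pl : planted gam rho e) (rfin : (family_rate rho < +oo)%E).
Hypotheses (pathP : admissible_path q path len) (lenP : length_along e path len).

Let S := power_sum rho everywhere.

Let mrho i : measurable_fun (`[0%R, 1%R] : set R) (rho i).
Proof. by apply: (@admissible_measurable gam); case: pl. Qed.

Let dS : density S. Proof. exact: everywhere_density. Qed.

Let rhoS k i t : 0 < k -> 0 <= t <= 1 -> ((rho i t)%:E <= scaled_young c q k S t)%E.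
Proof.
move=> k0 t01; apply: (@rate_le_scaled_young gam) => //; first by case: pl.
exact: power_sum_ge.
Qed.

Lemma family_mass_ge : 2 * c ^+ 2 <= cumul S 1.
Proof.
apply: (mass_lower_bound c0 q0 q1 hcq pathP dS).
apply: (planted_dominated pl) => //; first exact: scaled_young_density.
by move=> i t; exact: rhoS.
Qed.

Lemma family_rate_ge : ((4 / 3 * (2 * c ^+ 2))%:E <= family_rate rho)%E.
Proof. by rewrite family_rate_cumul// lee_fin ler_pM2l// family_mass_ge. Qed.

Lemma family_excess eta eps : 0 < eta -> eta <= 1 -> 0 <= eps ->
  cumul S 1 <= 2 * c ^+ 2 + eps ->
  cumul (excess c q S) 1 <= 2 * eps / eta + 6 * c ^+ 2 * eta.
Proof.
move=> e0 e1 eps0; apply: (excess_mass c0 q0 q1 hcq pathP dS) => //.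
apply: (planted_dominated pl) => //; first exact: double_young_density.
by move=> i t t01; rewrite /double_young le_min !rhoS// addr_gt0.
Qed.

Lemma family_variational eps C1 C2 s t : cumul S 1 <= 2 * c ^+ 2 + eps -> 0 <= eps ->
  0 < s -> s < a -> a <= t -> t <= 1 ->
  c * ((a * path s - s) ^+ 2 / (a * s * (a - s))) <=
  2 * c ^+ 2 + eps + 2 * C1 * (path t / t - a^-1) - 2 * C2 * (path t / t) +
  C1 ^+ 2 * (J t - J a) + C2 ^+ 2 * (J 1 - J t).
Proof.
move=> hS eps0 s0 sa at_ t1; have dy := scaled_young_density c0 q0 q1 ltr01 dS.
have dom : dominated_by (scaled_young c q 1 S) path len.
  by apply: (planted_dominated pl) => // i u; exact: rhoS.
have := weighted_variational c0 q0 q1 C1 C2 pathP dy dom s0 sa at_ t1.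
rewrite (cumul_weighted_scaled_young c0 q0 q1 hcq)// -/a -/J; lra.
Qed.

End Representation.

(** What equality with the minimal rate yields when the infimum over families may not be
    attained. *)
Definition near_optimal e := forall eps, 0 < eps -> exists gam rho,
  [/\ planted gam rho e, (family_rate rho < +oo)%E &
   cumul (power_sum rho everywhere) 1 <= 2 * c ^+ 2 + eps].

Lemma rate_ge e path len : admissible_path q path len -> length_along e path len ->
  ((4 / 3 * (2 * c ^+ 2))%:E <= rate e)%E.
Proof.
move=> hp hl; apply: le_ereal_inf_tmp => _ [rho [gam pl] <-].
have [fin|] := ltP (family_rate rho) +oo%E; first exact: family_rate_ge pl fin hp hl.
by rewrite leye_eq => /eqP ->; rewrite leey.
Qed.

Lemma rate_near_optimal e : rate e = (4 / 3 * (2 * c ^+ 2))%:E -> near_optimal e.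
Proof.
move=> re eps eps0; have fin : rate e \is a fin_num by rewrite re.
have [_ [rho [gam pl] <-]] := lb_ereal_inf_adherent eps0 fin.
rewrite -/(rate e) re -EFinD => h.
have rf : (family_rate rho < +oo)%E by rewrite (lt_trans h) ?ltry.
exists gam, rho; split => //.
have mrho i : measurable_fun (`[0%R, 1%R] : set R) (rho i).
  by apply: (@admissible_measurable gam); case: pl.
by move: h; rewrite family_rate_cumul// lte_fin; lra.
Qed.

Section PathIdentification.
Variables (e : metric4 R) (path len : R -> R).
Hypotheses (near : near_optimal e) (pathP : admissible_path q path len).
Hypothesis (lenP : length_along e path len).

Let key C1 C2 s t : 0 < s -> s < a -> a <= t -> t <= 1 ->
  c * ((a * path s - s) ^+ 2 / (a * s * (a - s))) <=
  2 * c ^+ 2 + 2 * C1 * (path t / t - a^-1) - 2 * C2 * (path t / t) +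
  C1 ^+ 2 * (J t - J a) + C2 ^+ 2 * (J 1 - J t).
Proof.
move=> s0 sa at_ t1; apply/ler_addgt0Pr => eps eps0.
have [gam [rho [pl fin hS]]] := near eps0.
have := family_variational pl fin pathP lenP C1 C2 hS (ltW eps0) s0 sa at_ t1; lra.
Qed.

Let C := q ^+ 2 * c ^+ 2.

Let J1a : C ^+ 2 * (J 1 - J a) = 2 * c ^+ 2.
Proof.
rewrite /J /a (weight_primitive_total c0 q0 q1 hcq) /C.
by field; rewrite !gt_eqF.
Qed.

Let Ca : 2 * C * a^-1 = 4 * c ^+ 2.
Proof. by rewrite /C /a; field; rewrite gt_eqF. Qed.

(** With both multipliers equal to [C] and [t = a] the right-hand side of [key] is 0, and so is the
    squared distance on the left. *)
Lemma path_early s : 0 < s -> s < a -> a * path s = s.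
Proof.
move=> s0 sa; have := key C C s0 sa (lexx a) (ltW (lt_trans aq qq1)).
have pa : path a = 1 by case: pathP.
rewrite pa mul1r !subrr !mulr0 !addr0 J1a Ca => h.
have {}h : (a * path s - s) ^+ 2 / (a * s * (a - s)) <= 0.
  by rewrite -(pmulr_rle0 _ c0); apply: le_trans h _; lra.
have d0 : 0 < a * s * (a - s) by rewrite !mulr_gt0// subr_gt0.
move: h; rewrite pmulr_lle0 ?invr_gt0// => h.
have : (a * path s - s) ^+ 2 == 0 by rewrite eq_le h sqr_ge0.
by rewrite sqrf_eq0 subr_eq0 => /eqP.
Qed.

Let linear_term (y z : R) : (forall eta, 0 <= 2 * eta * y + eta ^+ 2 * z) -> y = 0.
Proof.
move=> h; apply/eqP; rewrite -sqrf_eq0 eq_le sqr_ge0 andbT leNgt; apply/negP => y0.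
pose d := 1 + `|z|; have d0 : 0 < d by rewrite ltr_pwDl.
have := h (- (y / d)).
have -> : 2 * - (y / d) * y + (- (y / d)) ^+ 2 * z = y ^+ 2 / d * (z / d - 2).
  by field; rewrite gt_eqF.
rewrite pmulr_rge0 ?divr_gt0// subr_ge0 ler_pdivlMr// /d.
have := ler_norm z; have := normr_ge0 z; lra.
Qed.

(** The right-hand side of [key] vanishes at [C1 = C2 = C] and stays nonnegative when [C1] varies,
    so its linear coefficient is 0. This is the integrated Euler-Lagrange equation for the slope. *)
Lemma path_late t : a <= t -> t <= 1 -> path t / t - a^-1 = - C * (J t - J a).
Proof.
move=> at_ t1; apply/eqP; rewrite -subr_eq0; apply/eqP.
apply: (@linear_term _ (J t - J a)) => eta.
have a20 : 0 < a / 2 by rewrite divr_gt0.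
have a2 : a / 2 < a by rewrite ltr_pdivrMr// ltr_pMr//; lra.
have := key (C + eta) C a20 a2 at_ t1.
set X := (X in X <= _) => h; have : 0 <= X.
  rewrite /X mulr_ge0 ?(ltW c0)// divr_ge0 ?sqr_ge0// mulr_ge0 ?subr_ge0 ?(ltW a2)//.
  by rewrite mulr_ge0// ltW.
move=> /le_trans /(_ h); have hJ := J1a; have hC := Ca.
set p := path t / t; set b := a^-1 in hC *; set j := J t; set ja := J a in hJ *.
set j1 := J 1 in hJ *; rewrite -/j -/ja -/j1.
have -> : 2 * c ^+ 2 + 2 * (C + eta) * (p - b) - 2 * C * p + (C + eta) ^+ 2 * (j - ja) +
   C ^+ 2 * (j1 - j) = 2 * eta * (p - b - (- C * (j - ja))) + eta ^+ 2 * (j - ja) +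
   (2 * c ^+ 2 - 2 * C * b + C ^+ 2 * (j1 - ja)) by ring.
by rewrite hJ hC; lra.
Qed.

Let inva : a^-1 = c * (3 - 2 * q).
Proof.
apply: (@mulIf _ a); rewrite ?gt_eqF// mulVf ?gt_eqF// /a.
have := hcq; lra.
Qed.

Lemma path_eq_opt_curve t : 0 <= t -> t <= 1 -> path t = F t.
Proof.
rewrite le_eqVlt => /predU1P[<- _|t0 t1].
  have [-> _ _ _ _] := pathP; rewrite /F opt_curve1 ?mulr0//.
  by rewrite divr_ge0// sqr_ge0.
have [ta|ta] := ltP t a.
  rewrite /F opt_curve1 ?(ltW ta)// -inva -{2}(path_early t0 ta).
  by rewrite mulKf// gt_eqF.
have h := path_late ta t1.
have {h} -> : path t = t * (a^-1 - C * (J t - J a)).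
  have -> : a^-1 - C * (J t - J a) = path t / t by move: h; lra.
  by rewrite mulrCA divff ?mulr1// gt_eqF.
rewrite inva /J (weight_primitive1 c (ltW aq)); have [tq|tq] := leP t (q ^+ 2).
  rewrite (weight_primitive1 c tq) /F opt_curve2//.
  by rewrite /C /a; field; rewrite !gt_eqF.
have tq' := ltW tq; rewrite (weight_primitive2 c0 q0 tq') /F (opt_curve3 c q0 tq').
have w0 : 0 < Num.sqrt t by rewrite sqrtr_gt0.
have tE : t = Num.sqrt t ^+ 2 by rewrite sqr_sqrtr// ltW.
set w := Num.sqrt t in w0 tE *; rewrite tE.
by rewrite /C /a; field; rewrite !gt_eqF.
Qed.

End PathIdentification.

End RateBound.

(** * Length along the optimal curve in a near-optimal metric *)

Section LengthIdentification.
Context {R : realType}.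
Notation mu := (@lebesgue_measure R).
Variables c q : R.
Hypotheses (c0 : 0 < c) (q0 : 0 < q) (q1 : q < 1).
Hypothesis hcq : c * (3 - 2 * q) * q ^+ 2 = 2.
Implicit Types (s t x k : R).

Let lam := opt_weight c q.
Let F := opt_curve c q.
Let E0 := opt_action c q.
Let a := q ^+ 2 / 2.

Let a0 : 0 < a. Proof. by rewrite /a divr_gt0// exprn_gt0. Qed.
Let aq : a < q ^+ 2.
Proof. by rewrite /a ltr_pdivrMr// ltr_pMr ?exprn_gt0//; lra. Qed.
Let qq1 : q ^+ 2 < 1. Proof. by rewrite expr_lt1// ltW. Qed.

(** Quadratic estimates are available inside pieces only; monotonicity is then glued at [a] and
    [q ^+ 2]. *)
Lemma piecewise_nonincreasing (f : R -> R) C s t :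
  (forall u v, 0 <= u -> u < v -> v <= 1 -> same_piece q u v ->
     f v - f u <= C * (v - u) ^+ 2) ->
  0 <= s -> s <= t -> t <= 1 -> f t <= f s.
Proof.
move=> h s0 st t1.
have piece u v : 0 <= u -> u <= v -> v <= 1 -> same_piece q u v -> f v <= f u.
  move=> u0 uv v1 huv; apply: (@quad_nonincreasing _ f C) => // x y ux xy yv.
  apply: h => //; [exact: le_trans ux|exact: le_trans v1|].
  case: huv => [h1|[h1 h2]|h1].
  - by apply: Or31; exact: le_trans h1.
  - by apply: Or32; split; [exact: le_trans ux|exact: le_trans h2].
  - by apply: Or33; exact: le_trans ux.
have late u v : q ^+ 2 <= u -> u <= v -> v <= 1 -> f v <= f u.
  by move=> qu uv v1; apply: piece => //; [rewrite (le_trans _ qu)// sqr_ge0|apply: Or33].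
have mid u v : a <= u -> u <= v -> v <= 1 -> f v <= f u.
  move=> au uv v1; have u0 : 0 <= u by rewrite (le_trans _ au)// ltW.
  have [vq|qv] := leP v (q ^+ 2); first by apply: piece => //; apply: Or32.
  have [uq|qu] := leP u (q ^+ 2); last by apply: late => //; exact: ltW.
  apply: le_trans (piece u (q ^+ 2) u0 uq (ltW qq1) _); last by apply: Or32.
  by apply: late => //; exact: ltW.
have [ta|ta] := leP t a; first by apply: piece => //; apply: Or31.
have [sa|sa] := leP s a; last by apply: mid => //; exact: ltW.
have a1 : a <= 1 by rewrite (le_trans (ltW ta)).
apply: le_trans (piece s a s0 sa a1 _); last by apply: Or31.
by apply: mid => //; exact: ltW.
Qed.

Lemma cumul_opt_rate_le s t : 0 <= s -> s <= t -> t <= 1 ->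
  cumul (EFin \o opt_rate c q) t - cumul (EFin \o opt_rate c q) s <= lam s ^+ 2 * (t - s).
Proof.
move=> s0; rewrite le_eqVlt => /predU1P[->|st] t1; first by rewrite !subrr mulr0.
rewrite -lee_fin -(cumulE (opt_rate_density c q0))//; last exact: ltW.
apply: (@le_trans _ _ (\int[mu]_(x in `[s, t]) (lam s ^+ 2)%:E)%E).
  apply: ge0_le_integral_all => x; rewrite /= in_itv/= => /andP[sx xt].
    by rewrite lee_fin sqr_ge0.
  rewrite lee_fin /opt_rate -/lam.
  have h : lam x <= lam s by exact: opt_weight_nonincreasing.
  have h0 : 0 < lam x by exact: opt_weight_gt0.
  by rewrite lerXn2r// nnegrE ltW// (lt_le_trans h0).
rewrite integral_cst//= lebesgue_measure_itv/= lte_fin st.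
by rewrite -EFinB -EFinM.
Qed.

Variables (e : metric4 R) (path len : R -> R).
Hypotheses (near : near_optimal c e) (pathP : admissible_path q path len).
Hypothesis (lenP : length_along e path len).

(** In [2 eps / eta + 6 c^2 eta] the parameter [eta] is fixed first, to make the second term at most
    [k / 2], and [eps] afterwards. *)
Lemma small_excess k : 0 < k -> exists gam rho,
  [/\ planted gam rho e, (family_rate rho < +oo)%E,
   cumul (power_sum rho everywhere) 1 <= 2 * c ^+ 2 + k &
   cumul (excess c q (power_sum rho everywhere)) 1 <= k].
Proof.
move=> k0; have c20 : 0 < 12 * c ^+ 2 by rewrite mulr_gt0// exprn_gt0.
pose eta := Num.min 1 (k / (12 * c ^+ 2)).
have e0 : 0 < eta by rewrite lt_min ltr01 divr_gt0.
have e1 : eta <= 1 by rewrite ge_min lexx.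
have e2 : 6 * c ^+ 2 * eta <= k / 2.
  have h : eta <= k / (12 * c ^+ 2) by rewrite ge_min lexx orbT.
  by move: h; rewrite ler_pdivlMr//; lra.
pose eps := Num.min k (eta * k / 4).
have p0 : 0 < eps by rewrite lt_min k0 divr_gt0// mulr_gt0.
have p1 : eps <= k by rewrite ge_min lexx.
have p2 : 2 * eps / eta <= k / 2.
  have h : eps <= eta * k / 4 by rewrite ge_min lexx orbT.
  by rewrite ler_pdivrMr//; lra.
have [gam [rho [pl fin hS]]] := near p0.
exists gam, rho; split => //; first by apply: le_trans hS _; lra.
have := family_excess c0 q0 q1 hcq pl fin pathP lenP e0 e1 (ltW p0) hS; lra.
Qed.

Lemma opt_curve_admissible_path : admissible_path q F len.
Proof.
have h := path_eq_opt_curve c0 q0 q1 hcq near pathP lenP.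
have [p0 pa p1 l0 lge] := pathP; split => //.
- by rewrite /F -h ?lexx ?ler01.
- by rewrite /F -h ?(ltW a0)//; rewrite (le_trans (ltW aq))// ltW.
- by rewrite /F -h ?ler01.
- by move=> s s0 s1; rewrite /F -h ?(ltW s0)//; exact: lge.
Qed.

Lemma opt_curve_length_along : length_along e F len.
Proof.
have h := path_eq_opt_curve c0 q0 q1 hcq near pathP lenP.
move=> s t s0 st t1; rewrite /F -!h ?(le_trans s0 (ltW st)) ?(le_trans (ltW st))//.
exact: lenP.
Qed.

(** All rates lie below the optimal rate plus a multiple of the excess. Once the cumulative excess
    is subtracted, [opt_local_action] makes [len - E0] nonincreasing, and the excess is as small as
    desired. *)
Let length_le_action s t : 0 <= s -> s <= t -> t <= 1 -> len t - len s <= E0 t - E0 s.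
Proof.
move=> s0 st t1; apply/ler_addgt0Pr => eps eps0.
pose k := 2 / (3 * c * q); have k0 : 0 < k by rewrite divr_gt0// !mulr_gt0.
have [gam [rho [pl fin _ hX]]] := small_excess (divr_gt0 eps0 k0).
set S := power_sum rho everywhere in hX.
have mrho i : measurable_fun (`[0%R, 1%R] : set R) (rho i).
  by apply: (@admissible_measurable _ gam); case: pl.
have dS : density S by exact: everywhere_density.
have [_ S0 _] := dS; have dX := excess_density c0 q0 dS.
pose r := ((EFin \o opt_rate c q) \+ (fun x => k%:E * excess c q S x))%E.
have dr : density r.
  by apply: densityD; [exact: opt_rate_density|apply: densityZ => //; exact: ltW].
have dom : dominated_by r F len.
  apply: (planted_dominated pl) => //; last exact: opt_curve_length_along.
  move=> i x x01; apply: (@le_trans _ _ (scaled_young c q 1 S x)).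
    by apply: (@rate_le_scaled_young _ c q c0 q0 gam) => //; [case: pl|exact: power_sum_ge].
  by apply: scaled_young_le_excess => //; exact: S0.
pose X := cumul (excess c q S).
have crE u : cumul r u = cumul (EFin \o opt_rate c q) u + k * X u.
  rewrite cumulD; [|exact: opt_rate_density|by apply: densityZ => //; exact: ltW].
  by rewrite cumulZ//; exact: ltW.
have mono : len t - E0 t - k * X t <= len s - E0 s - k * X s.
  apply: (@piecewise_nonincreasing (fun u => len u - E0 u - k * X u)
    (c ^+ 2 / (2 * q ^+ 3))) => // u v u0 uv v1 huv.
  have := dom u v u0 uv v1; rewrite !crE.
  have := cumul_opt_rate_le u0 (ltW uv) v1.
  have := opt_local_action c q0 q1 u0 uv huv; rewrite -/lam -/F -/E0.
  set A := (F v - F u) ^+ 2 / (v - u); set B := lam u ^+ 2 * _; lra.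
have X1 : k * X 1 <= eps by rewrite mulrC -ler_pdivlMr.
have Xs : 0 <= k * X s.
  by rewrite mulr_ge0 ?(ltW k0)// -(cumul0 (excess c q S)) (cumul_nondecreasing dX).
have Xt : k * X t <= k * X 1 by rewrite ler_pM2l// (cumul_nondecreasing dX).
lra.
Qed.

(** The inequality holds on [[0, t]] and on [[t, 1]], whereas the total length is at least the
    Dirichlet value 0, which is the total action. *)
Lemma length_eq_action t : 0 <= t -> t <= 1 -> len t = E0 t.
Proof.
move=> t0 t1; have := length_le_action (lexx 0) t0 t1; have := length_le_action t0 t1 (lexx 1).
have [_ _ p1 l0 lge] := pathP; have := lge 1 ltr01 (lexx 1).
rewrite p1 expr0n/= mul0r oppr0 l0 /E0.
rewrite (@opt_action1 _ c q 0) ?(ltW a0)// (opt_action3 c q0 (ltW qq1)) sqrtr1 subrr expr0n/=.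
rewrite !mulr0; lra.
Qed.

Lemma opt_curve_metric_le : mle (curve_metric F (opt_rate c q)) e.
Proof.
move=> x s y t st; apply: curve_metric_le; first exact: opt_rate_density.
move=> s0 _ t1 -> -> _; rewrite opt_curve_length_along//.
have [_ ->] := opt_curve_action c0 q0 q1 s0 st t1.
by rewrite !length_eq_action// ?(le_trans s0) ?(le_trans (ltW st))// ltW.
Qed.

End LengthIdentification.

(** * Mass off the optimal curve *)

Section Tube.
Context {R : realType}.
Notation mu := (@lebesgue_measure R).
Implicit Types (s t x y v m : R).

Variables (gam rho : nat -> R -> R) (r0 r1 : R -> \bar R) (p : R -> R) (eta L : R).
Hypotheses (adm : forall i, admissible (gam i) (rho i)).
Hypotheses (d0 : density r0) (d1 : density r1).
Hypothesis rho_le0 : forall i t, 0 <= t <= 1 -> ((rho i t)%:E <= r0 t)%E.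
Hypothesis rho_le1 : forall i t, 0 <= t <= 1 -> `|gam i t - p t| < eta ->
  ((rho i t)%:E <= r1 t)%E.

Let drho i : density (EFin \o rho i).
Proof. exact: rate_density (adm i) d0 (@rho_le0 i). Qed.

(* The chain of weight [v] visits [(m, tau)], off the tube, and pays at least
   [A] before and [B] after in energy. *)
Definition off_tube x s y t v := exists m tau A B,
  [/\ s <= tau, tau <= t & eta <= `|m - p tau|] /\ [/\ 0 <= A, 0 <= B,
   (m - x) ^+ 2 <= A * (tau - s), (y - m) ^+ 2 <= B * (t - tau) &
   v <= cumul r0 t - cumul r0 s - A - B].

Let step_tube x s y t v : s < t -> planted_step gam rho x s y t v ->
  v <= cumul r1 t - cumul r1 s - (y - x) ^+ 2 / (t - s) \/ off_tube x s y t v.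
Proof.
move=> st [h|[i h]].
  by left; have := cumul_nondecreasing d1 (ltW st); lra.
have [[s0 _ t1 -> ->] [fin hv]] := curve_metric_ge (drho i) h.
have cs := energy_cauchy_schwarz st fin.
have [hin|] := pselect (forall u, s <= u -> u <= t -> `|gam i u - p u| < eta).
  left; have : cumul (EFin \o rho i) t - cumul (EFin \o rho i) s <= cumul r1 t - cumul r1 s.
    rewrite -lee_fin -!cumulE ?(ltW st)//.
    apply: ge0_le_integral_all => u; rewrite /= in_itv/= => /andP[su ut];
      have u01 : 0 <= u <= 1 by rewrite (le_trans s0) ?(le_trans ut).
      by rewrite lee_fin; have [_ [_]] := adm i; apply.
    by apply: rho_le1 => //; exact: hin.
  lra.
move=> /existsNP[tau /not_implyP[stau /not_implyP[taut /negP]]]; rewrite -leNgt => ht.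
right; exists (gam i tau), tau.
have hr := le_cumulB (drho i) d0 s0 (ltW st) t1 (@rho_le0 i).
have E0 := energy_ge0 (gam i) s t.
have {}E0 : 0 <= fine (energy (gam i) s t) by rewrite -lee_fin fineK.
have slope u w : u < w -> energy (gam i) u w \is a fin_num ->
    (gam i w - gam i u) ^+ 2 <= fine (energy (gam i) u w) * (w - u).
  by move=> uw f; rewrite -ler_pdivrMr ?subr_gt0// energy_cauchy_schwarz.
have cases (u w : R) : u <= w -> u = w \/ u < w by rewrite le_eqVlt => /predU1P.
have [stau'|{}stau] := cases s tau stau.
  rewrite -stau' in ht *; exists 0, (fine (energy (gam i) s t)).
  split; first by split => //; exact: ltW.
  split => //.
  - by rewrite !subrr expr0n mul0r.
  - exact: slope.
  - lra.
have [taut'|{}taut] := cases tau t taut.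
  rewrite taut' in ht *; exists (fine (energy (gam i) s t)), 0.
  split; first by split => //; exact: ltW.
  split => //.
  - exact: slope.
  - by rewrite !subrr expr0n mul0r.
  - lra.
have [f1 f2 fE] := energy_fin_split stau taut fin.
exists (fine (energy (gam i) s tau)), (fine (energy (gam i) tau t)); split.
  by split => //; exact: ltW.
split.
- by rewrite -lee_fin fineK// energy_ge0.
- by rewrite -lee_fin fineK// energy_ge0.
- exact: slope.
- exact: slope.
- by move: hv; rewrite fE; lra.
Qed.

(** If some step leaves the tube, the Dirichlet costs of all other steps are merged into [A] and [B]
    by [sqr_slope_subadd]. *)
Let chain_tube x s y t v : chain (planted_step gam rho) x s y t v ->
  v <= cumul r1 t - cumul r1 s - (y - x) ^+ 2 / (t - s) \/ off_tube x s y t v.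
Proof.
have step0 := @planted_step_le _ gam rho r0 adm d0 rho_le0.
elim=> [{}x {}s {}y {}t {}v st hv|{}x {}s m r {}y {}t {}v w sr hv hc IH].
  exact: step_tube.
have rt := chain_lt hc; have st := lt_trans sr rt.
have sr0 : 0 < r - s by rewrite subr_gt0.
have rt0 : 0 < t - r by rewrite subr_gt0.
have off1 : off_tube x s m r v -> off_tube x s y t (v + w).
  move=> [m' [tau [A [B [[h1 h2 h3] [A0 B0 hA hB hv']]]]]].
  have hw := chain_le step0 hc.
  exists m', tau, A, (B + (y - m) ^+ 2 / (t - r)).
  split; first by split => //; rewrite (le_trans h2)// ltW.
  have k0 : 0 <= (y - m) ^+ 2 / (t - r) by rewrite divr_ge0 ?sqr_ge0// ltW.
  split => //; first exact: addr_ge0.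
    apply: (@sqr_slope_subadd _ m' m y B _ tau r t) => //; first exact: ltW.
    by rewrite divfK// gt_eqF.
  lra.
have off2 : off_tube m r y t w -> off_tube x s y t (v + w).
  move=> [m' [tau [A [B [[h1 h2 h3] [A0 B0 hA hB hv']]]]]].
  have hw := step0 _ _ _ _ _ sr hv.
  exists m', tau, ((m - x) ^+ 2 / (r - s) + A), B.
  split; first by split => //; rewrite (le_trans _ h1)// ltW.
  have k0 : 0 <= (m - x) ^+ 2 / (r - s) by rewrite divr_ge0 ?sqr_ge0// ltW.
  split => //; first exact: addr_ge0.
    apply: (@sqr_slope_subadd _ x m m' _ A s r tau) => //; first exact: ltW.
    by rewrite divfK// gt_eqF.
  lra.
case: (step_tube sr hv) => [h1|/off1]; last by right.
case: IH => [h2|/off2]; last by right.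
left; have := @dirichlet_superadd _ x m y s r t sr rt; lra.
Qed.

Hypotheses (eta0 : 0 < eta) (L0 : 0 < L).
Hypothesis p_lip : forall s t, s <= t -> `|p t - p s| <= L * (t - s).

Let M := cumul r0 1.

Let M0 : 0 <= M.
Proof. by rewrite /M -(cumul0 r0) (cumul_nondecreasing d0). Qed.

(** Within time [eta / (2 * L)] the curve moves at most [eta / 2], so leaving the tube takes a
    displacement of [eta / 2]. The third bound makes its energy at least [M + L ^+ 2]: the whole
    mass [M] plus, as the time is at most 1, the Dirichlet cost along [p]. *)
Let d := Num.min 1 (Num.min (eta / (2 * L)) (eta ^+ 2 / (4 * (M + L ^+ 2)))).

Let ML : 0 < M + L ^+ 2. Proof. by rewrite ltr_wpDl// exprn_gt0. Qed.

Let dgt0 : 0 < d.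
Proof. by rewrite !lt_min ltr01/= !divr_gt0// ?exprn_gt0// mulr_gt0. Qed.

Lemma chain_in_tube s t v : 0 <= s -> s < t -> t <= 1 -> t - s <= d ->
  chain (planted_step gam rho) (p s) s (p t) t v ->
  v <= cumul r1 t - cumul r1 s - (p t - p s) ^+ 2 / (t - s).
Proof.
move=> s0 st t1 td /chain_tube[//|[m [tau [A [B [[h1 h2 h3] [A0 B0 hA hB hv]]]]]]].
have st0 : 0 < t - s by rewrite subr_gt0.
have cr := cumul_nondecreasing d1 (ltW st).
have lip : (p t - p s) ^+ 2 / (t - s) <= L ^+ 2 * (t - s).
  rewrite ler_pdivrMr//; have := p_lip (ltW st) => h.
  have -> : L ^+ 2 * (t - s) * (t - s) = (L * (t - s)) ^+ 2 by ring.
  by rewrite -(real_normK (num_real (p t - p s))) lerXn2r// nnegrE mulr_ge0// ltW.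
have da : t - s <= eta / (2 * L).
  by apply: le_trans td _; rewrite /d !ge_min lexx !orbT.
have db : t - s <= eta ^+ 2 / (4 * (M + L ^+ 2)).
  by apply: le_trans td _; rewrite /d !ge_min lexx !orbT.
have dc : t - s <= 1 by apply: le_trans td _; rewrite /d !ge_min lexx.
have ptau : `|p tau - p s| <= eta / 2.
  apply: le_trans (p_lip h1) _; have : tau - s <= eta / (2 * L) by lra.
  by rewrite ler_pdivlMr ?mulr_gt0//; lra.
have hm : eta / 2 <= `|m - p s|.
  have := ler_normD (m - p s) (p s - p tau); rewrite addrA subrK.
  by rewrite (distrC (p s)); lra.
have hm2 : eta ^+ 2 / 4 <= (m - p s) ^+ 2.
  have -> : eta ^+ 2 / 4 = (eta / 2) ^+ 2 by field.
  rewrite -(real_normK (num_real (m - p s))) lerXn2r// nnegrE//.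
  by rewrite divr_ge0// ltW.
have hA' : eta ^+ 2 / 4 <= A * (t - s).
  apply: le_trans hm2 (le_trans hA _); rewrite ler_wpM2l//; lra.
have hML : (M + L ^+ 2) * (t - s) <= A * (t - s).
  apply: le_trans hA'; move: db; rewrite ler_pdivlMr ?mulr_gt0//; lra.
have {}hML : M + L ^+ 2 <= A by move: hML; rewrite ler_pM2r.
have r01 : cumul r0 t - cumul r0 s <= M.
  have := cumul_nondecreasing d0 t1; have := cumul_nondecreasing d0 s0.
  rewrite cumul0 -/M; lra.
have L2 : L ^+ 2 * (t - s) <= L ^+ 2 by rewrite ler_piMr ?sqr_ge0.
lra.
Qed.

(** For short times chains between points of the curve gain no more than the rates inside the tube
    allow; superadditivity of the Dirichlet cost removes the restriction to short times. *)
Lemma tube_dominated e len : planted gam rho e -> length_along e p len ->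
  dominated_by r1 p len.
Proof.
move=> pl lenP u v u0 uv v1.
apply: (@local_to_global_action _ len p (cumul r1) d) => // s t us st tv td.
have s0 := le_trans u0 us; have t1 := le_trans tv v1.
have := planted_le_metric pl d0 rho_le0 (p s) (p t) st.
rewrite lenP// /planted_metric /to_metric lee_fin => /le_trans; apply.
by apply: planted_metric_le => // w; exact: chain_in_tube.
Qed.

End Tube.

(** * Mass of the rates off the optimal curve *)

Section OffCurveMass.
Context {R : realType}.
Notation mu := (@lebesgue_measure R).
Implicit Types (s t x y eta : R).

Definition in_tube (gam : nat -> R -> R) (p : R -> R) eta i x := `|gam i x - p x| < eta.

Definition off_curve (gam : nat -> R -> R) (p : R -> R) (i : nat) x := gam i x != p x.

Lemma admissible_curve_measurable (g rho : R -> R) : admissible g rho ->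
  measurable_fun (`[0%R, 1%R] : set R) g.
Proof.
by case=> cg _; apply: (@subspace_continuous_measurable_fun _ (`[0%R, 1%R]%classic : set R)).
Qed.

Section Measurability.
Variables (gam rho : nat -> R -> R) (p : R -> R).
Hypotheses (adm : forall i, admissible (gam i) (rho i)) (cp : continuous p).

Let mgam i : measurable_fun (`[0%R, 1%R] : set R) (gam i).
Proof. exact: admissible_curve_measurable (adm i). Qed.

Let mp : measurable_fun (`[0%R, 1%R] : set R) p.
Proof. by apply: measurable_funTS; exact: continuous_measurable_fun. Qed.

Lemma in_tube_measurable eta i : measurable_fun (`[0%R, 1%R] : set R) (in_tube gam p eta i).
Proof.
apply: measurable_fun_ltr => //; apply: measurableT_comp => //.
exact: measurable_funB.
Qed.

Lemma off_tube_measurable eta i :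
  measurable_fun (`[0%R, 1%R] : set R) (predC (in_tube gam p eta i)).
Proof. by apply: measurable_neg; exact: in_tube_measurable. Qed.

Lemma off_curve_measurable i : measurable_fun (`[0%R, 1%R] : set R) (off_curve gam p i).
Proof. by apply: measurable_neg; exact: measurable_fun_eqr. Qed.

(** As the tube shrinks, the sums outside it increase to the sum off the curve, and monotone
    convergence preserves the bound. *)
Lemma off_curve_mass_limit b : (family_rate rho < +oo)%E ->
  (forall eta, 0 < eta ->
    cumul (power_sum rho (fun i => predC (in_tube gam p eta i))) 1 <= b) ->
  cumul (power_sum rho (off_curve gam p)) 1 <= b.
Proof.
move=> rfin hb.
have mrho i : measurable_fun (`[0%R, 1%R] : set R) (rho i).
  exact: admissible_measurable (adm i).
pose g n := power_sum rho (fun i => predC (in_tube gam p n.+1%:R^-1 i)).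
have dg n : density (g n) by apply: power_sum_density => // i; exact: off_tube_measurable.
have doff : density (power_sum rho (off_curve gam p)).
  by apply: power_sum_density => // i; exact: off_curve_measurable.
have nd x : {homo g^~ x : n m / (n <= m)%N >-> (n <= m)%E}.
  move=> n m nm; apply: le_power_sum => i; rewrite /= /in_tube -!leNgt.
  by apply: le_trans; rewrite lef_pV2 ?posrE// ler_nat.
have lb x : (power_sum rho (off_curve gam p) x <= limn (g^~ x))%E.
  apply: lime_le.
    by apply: is_cvg_nneseries => i _ _; exact: power_term_ge0.
  apply: nearW => N.
  (* Among finitely many curves, those off [p] at time [x] have a common positive distance from
     it. *)
  have [n hn] : exists n, forall m i, (n <= m)%N -> (i < N)%N -> off_curve gam p i x ->
      m.+1%:R^-1 <= `|gam i x - p x|.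
    elim: N => [|N [n hn]]; first by exists 0%N.
    have [E|ne] := eqVneq (gam N x) (p x).
      exists n => m i nm; rewrite ltnS leq_eqVlt => /predU1P[->|]; last exact: hn.
      by rewrite /off_curve E eqxx.
    have k0 : 0 < `|gam N x - p x| by rewrite normr_gt0 subr_eq0.
    have k1 : 0 <= `|gam N x - p x|^-1 by rewrite invr_ge0 ltW.
    exists (maxn n (Num.bound `|gam N x - p x|^-1)) => m i; rewrite geq_max => /andP[nm bm].
    rewrite ltnS leq_eqVlt => /predU1P[-> _|]; last exact: hn.
    rewrite invf_ple ?posrE// ltW// (lt_le_trans (archi_boundP k1))//.
    by rewrite ler_nat (leq_trans bm).
  apply: (@le_trans _ _ (g n x)).
    apply: le_trans (power_sum_partial _ _ N x).
    rewrite !big_mkord; apply: lee_sum => i _; rewrite /power_term /=.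
    case: ifP => [h|_]; last by case: ifP => // _; rewrite lee_fin powR_ge0.
    by rewrite /in_tube -leNgt hn.
  have -> : limn (g^~ x) = ereal_sup (range (g^~ x)).
    by apply: cvg_lim => //; exact: ereal_nondecreasing_cvgn.
  by apply: ereal_sup_ubound; exists n.
have D01 : measurable (`[0%R, 1%R]%classic : set R) by exact: measurable_itv.
have mc := @cvg_monotone_convergence _ _ R mu _ D01 g
  (fun n => let: And3 h _ _ := dg n in h)
  (fun n x _ => power_sum_ge0 _ _ x) (fun x _ => nd x).
rewrite -lee_fin -[leLHS](_ : \int[mu]_(x in `[0%R, 1%R]) power_sum rho (off_curve gam p) x = _)%E;
  last by rewrite (cumulE doff)// cumul0 subr0.
apply: (@le_trans _ _ (\int[mu]_(x in `[0%R, 1%R]) limn (g^~ x))%E).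
  by apply: ge0_le_integral_all => x _; [exact: power_sum_ge0|exact: lb].
rewrite -(cvg_lim _ mc)//; apply: lime_le; first by apply/cvg_ex; eexists; exact: mc.
apply: nearW => n; rewrite (cumulE (dg n))// cumul0 subr0 lee_fin.
by apply: hb; rewrite invr_gt0.
Qed.

End Measurability.

Variables c q : R.
Hypotheses (c0 : 0 < c) (q0 : 0 < q) (q1 : q < 1).
Hypothesis hcq : c * (3 - 2 * q) * q ^+ 2 = 2.

Let F := opt_curve c q.

Variables (gam rho : nat -> R -> R) (e : metric4 R) (len : R -> R) (eps : R).
Hypotheses (pl : planted gam rho e) (rfin : (family_rate rho < +oo)%E).
Hypotheses (pathP : admissible_path q F len) (lenP : length_along e F len).
Hypothesis mass : cumul (power_sum rho everywhere) 1 <= 2 * c ^+ 2 + eps.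

Lemma off_curve_mass : cumul (power_sum rho (off_curve gam F)) 1 <= eps.
Proof.
have adm : forall i, admissible (gam i) (rho i) by case: pl.
have cF : continuous F by exact: opt_curve_continuous.
have mrho i : measurable_fun (`[0%R, 1%R] : set R) (rho i).
  exact: admissible_measurable (adm i).
apply: (off_curve_mass_limit adm cF rfin) => eta eta0.
have mB := in_tube_measurable adm cF eta.
have dS := everywhere_density mrho rfin.
have dU := power_sum_density mrho rfin mB.
have d0 := scaled_young_density c0 q0 q1 ltr01 dS.
have d1 := scaled_young_density c0 q0 q1 ltr01 dU.
have dom : dominated_by (scaled_young c q 1 (power_sum rho (in_tube gam F eta))) F len.
  apply: (@tube_dominated _ gam rho _ _ F eta (3 * c) adm d0 d1 _ _ eta0 _ _ e) => //.
  - move=> i t t01; apply: (@rate_le_scaled_young _ c q c0 q0 gam) => //.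
    exact: power_sum_ge.
  - move=> i t t01 hi; apply: (@rate_le_scaled_young _ c q c0 q0 gam) => //.
    exact: power_sum_ge.
  - by rewrite mulr_gt0.
  - by move=> s t st; exact: opt_curve_lipschitz.
have := mass_lower_bound c0 q0 q1 hcq pathP dU dom.
by have := cumul_power_sum_predC mrho rfin 1 mB; move: mass; lra.
Qed.

End OffCurveMass.

(** * Curves touching the optimal curve *)

Section Touching.
Context {R : realType}.
Notation mu := (@lebesgue_measure R).
Implicit Types (s t u x y w : R).

Lemma last_zero (h : R -> R) s w : continuous h -> s <= w ->
  (exists2 z, s <= z <= w & h z = 0) ->
  exists x, [/\ s <= x, x <= w, h x = 0 & forall z, x < z -> z <= w -> h z != 0].
Proof.
move=> ch sw [z0 z0sw hz0].
pose Z : set R := (h @^-1` [set 0] `&` `[s, w])%classic.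
have cZ : compact Z.
  apply: subclosed_compact (@segment_compact _ s w) _; last by move=> z [].
  apply: closedI; last exact: interval_closed.
  by move/continuousP : (ch) => _; apply: preimage_closed => //; exact: closed_eq.
have Z0 : Z !=set0 by exists z0; split => //=; rewrite in_itv.
have cid : {within Z, continuous (@id R)} by apply: continuous_subspaceT => x; exact: cvg_id.
have [x /set_mem[/= hx]] := compact_EVT_max Z0 cZ cid.
rewrite in_itv/= => /andP[sx xw] xmax; exists x; split => // z xz zw.
apply/negP => /eqP hz; have : z <= x.
  by apply: xmax; rewrite inE; split => //=; rewrite in_itv/= zw (le_trans sx)// ltW.
by rewrite leNgt xz.
Qed.

Lemma first_zero (h : R -> R) w t : continuous h -> w <= t ->
  (exists2 z, w <= z <= t & h z = 0) ->
  exists y, [/\ w <= y, y <= t, h y = 0 & forall z, w <= z -> z < y -> h z != 0].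
Proof.
move=> ch wt [z0 /andP[wz0 z0t] hz0].
have cN : continuous (fun x => h (- x)).
  by move=> x; apply: (@continuous_comp _ _ _ -%R h); [exact: opp_continuous|exact: ch].
have [||x [tx xw hx xlast]] := @last_zero (fun x => h (- x)) (- t) (- w) cN.
- by rewrite lerN2.
- by exists (- z0); rewrite ?opprK// !lerN2 z0t.
exists (- x); split => //; [by rewrite lerNr|by rewrite lerNl|move=> z wz zx].
by rewrite -(opprK z); apply: xlast; rewrite ?lerN2// ltrNr.
Qed.

Lemma energy_pt (g : R -> R) s x t : s < t -> s <= x -> x <= t -> abs_cont_on g s t ->
  energy g x x = 0%E.
Proof.
move=> st sx xt /(energyE st)[f [_ h _]]; rewrite h//.
by rewrite set_itv1 integral_set1.
Qed.

Variables c q : R.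
Hypotheses (c0 : 0 < c) (q0 : 0 < q) (q1 : q < 1).

Let lam := opt_weight c q.
Let F := opt_curve c q.
Let E0 := opt_action c q.

(** The part of the candidate density that a curve can share, as it agrees with F only at its
    touching times. *)
Definition touch_rate (g : R -> R) x : \bar R :=
  if g x == F x then (opt_rate c q x)%:E else 0%E.

Variables g r : R -> R.
Hypothesis adm : admissible g r.

Lemma touch_rate_density : density (touch_rate g).
Proof.
have dO := opt_rate_density c q0; have [mO _ _] := dO.
have mF : measurable_fun (`[0%R, 1%R] : set R) F.
  by apply: measurable_funTS; apply: continuous_measurable_fun; exact: opt_curve_continuous.
apply: (density_le _ _ _ dO).
- apply: measurable_fun_if => //.
    exact: measurable_fun_eqr (admissible_curve_measurable adm) mF.
  by apply: measurable_funS mO.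
- by move=> x _; rewrite /touch_rate; case: ifP => // _; rewrite lee_fin sqr_ge0.
- by move=> x _; rewrite /touch_rate/=; case: ifP => // _; rewrite lee_fin sqr_ge0.
Qed.

Let h x := g (clamp 0 1 x) - F x.

Let h_continuous : continuous h.
Proof.
move=> x; apply: continuousB; last exact: opt_curve_continuous.
have [cg _] := adm; move/subspace_continuousP : cg => /(_ (clamp 0 1 x)).
have cx : (`[0%R, 1%R]%classic : set R) (clamp 0 1 x).
  by rewrite /= in_itv/= clamp_ge clamp_le.
move=> /(_ cx) cG; apply: (@cvg_comp _ _ _ (clamp 0 1) g) cG => A; rewrite /within /= => nA.
have H := @clamp_continuous _ 0%R 1%R x _ nA.
apply: (@filterS _ (nbhs x) _ _ _ _ H) => y /=; apply.
by rewrite in_itv/= clamp_ge clamp_le.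
Qed.

Let hE x : 0 <= x -> x <= 1 -> h x = g x - F x.
Proof. by move=> x0 x1; rewrite /h clamp_id. Qed.

Let cumul_touch_gap x y : 0 <= x -> x <= y -> y <= 1 ->
  (forall z, x < z -> z < y -> g z != F z) ->
  cumul (touch_rate g) y = cumul (touch_rate g) x.
Proof.
move=> x0 xy y1 gap; apply/eqP; rewrite -subr_eq0; apply/eqP/EFin_inj.
rewrite -(cumulE touch_rate_density)//.
rewrite -[RHS](@integral0 _ _ R mu (`[x, y]%classic : set R)).
apply: ge0_ae_eq_integral_all => //.
- by move=> z _; rewrite /touch_rate; case: ifP => // _; rewrite lee_fin sqr_ge0.
apply: filterS2 (ae_neq x) (ae_neq y); first exact: (ae_filter_ringOfSetsType mu).
move=> z zx zy; rewrite /= in_itv/= => /andP[xz yz].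
rewrite /touch_rate ifN// gap//.
  by rewrite lt_neqAle eq_sym zx.
by rewrite lt_neqAle zy.
Qed.

Section Interval.
Variables s0 t0 : R.
Hypotheses (s00 : 0 <= s0) (st0 : s0 < t0) (t01 : t0 <= 1).
Hypothesis fin : energy g s0 t0 \is a fin_num.

Let En x y := fine (energy g x y).

Let gac : abs_cont_on g s0 t0. Proof. exact: energy_fin_abs_cont. Qed.

Let En0 x : s0 <= x -> x <= t0 -> En x x = 0.
Proof. by move=> sx xt; rewrite /En (energy_pt st0 sx xt gac). Qed.

Let fin_sub x y : s0 <= x -> x <= y -> y <= t0 -> energy g x y \is a fin_num.
Proof.
move=> sx xy yt; have xt' := le_trans xy yt.
move: xy; rewrite le_eqVlt => /predU1P[<-|xy]; first by rewrite (energy_pt st0 sx xt' gac).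
have xt : x < t0 by exact: lt_le_trans yt.
have fx : energy g x t0 \is a fin_num.
  move: sx; rewrite le_eqVlt => /predU1P[<-//|sx].
  by case: (energy_fin_split sx xt fin).
by move: yt; rewrite le_eqVlt => /predU1P[->//|yt]; case: (energy_fin_split xy yt fx).
Qed.

Let En_split x u y : s0 <= x -> x <= u -> u <= y -> y <= t0 -> En x y = En x u + En u y.
Proof.
move=> sx xu uy yt; have xy := le_trans xu uy.
move: (xy); rewrite le_eqVlt => /predU1P[E|xy'].
  have ux : u = x by apply/le_anti; rewrite xu andbT E.
  by rewrite ux -E En0 ?addr0// E.
have fx := fin_sub sx xy yt.
rewrite /En (energy_split xu uy xy' (energy_fin_abs_cont fx)) fineD//.
  by apply: fin_sub => //; exact: le_trans yt.
by apply: fin_sub => //; exact: le_trans xu.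
Qed.

Let En_ge x y : s0 <= x -> x < y -> y <= t0 -> (g y - g x) ^+ 2 / (y - x) <= En x y.
Proof.
by move=> sx xy yt; apply: energy_cauchy_schwarz => //; apply: fin_sub => //; exact: ltW.
Qed.

Let T x := cumul (touch_rate g) x.

(** What [g], with the touching rate planted on it, earns beyond the action of F; the aim is that it
    is nonpositive between touching times. *)
Let gain x y := T y - T x - En x y - (E0 y - E0 x).

Let gain_split x u y : s0 <= x -> x <= u -> u <= y -> y <= t0 ->
  gain x y = gain x u + gain u y.
Proof. by move=> sx xu uy yt; rewrite /gain (En_split sx xu uy yt); ring. Qed.

(** During an excursion there is no touching rate, and the energy is at least the Dirichlet cost,
    which by [opt_curve_excursion] is no better than following F. *)
Let gain_gap x y : s0 <= x -> x <= y -> y <= t0 -> g x = F x -> g y = F y ->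
  (forall z, x < z -> z < y -> g z != F z) -> gain x y <= 0.
Proof.
move=> sx xy yt gx gy gap; have x0 := le_trans s00 sx.
rewrite /gain /T (cumul_touch_gap x0 xy (le_trans yt t01) gap) subrr sub0r.
move: (xy); rewrite le_eqVlt => /predU1P[<-|xy'].
  by rewrite En0 ?(le_trans xy)//; lra.
have := En_ge sx xy' yt; rewrite gx gy.
have := opt_curve_excursion c q0 x0 xy; rewrite -/F -/E0.
have yx : 0 < y - x by rewrite subr_gt0.
rewrite -(pmulr_lge0 _ (_ : 0 < (y - x)^-1)) ?invr_gt0// mulrDl mulfK ?gt_eqF//.
lra.
Qed.

(** Around [w] the last touching time before and the first one after bound an excursion, which can
    be discarded. *)
Let touch_split x w y : s0 <= x -> x <= w -> w <= y -> y <= t0 -> g x = F x -> g y = F y ->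
  exists u v, [/\ x <= u, v <= y, u <= w & w <= v] /\
    [/\ g u = F u, g v = F v & gain x y <= gain x u + gain v y].
Proof.
move=> sx xw wy yt gx gy; have x0 := le_trans s00 sx; have y1 := le_trans yt t01.
have w0 := le_trans x0 xw; have w1 := le_trans wy y1.
have [|u [xu uw hu ulast]] := last_zero h_continuous xw.
  by exists x; rewrite ?lexx// hE ?gx ?subrr// (le_trans xw).
have [|v [wv vy hv vfirst]] := first_zero h_continuous wy.
  by exists y; rewrite ?lexx ?wy// hE ?gy ?subrr// (le_trans w0).
have u0 := le_trans x0 xu; have v1 := le_trans vy y1.
have gu : g u = F u by apply/eqP; rewrite -subr_eq0 -hE ?hu// (le_trans uw).
have gv : g v = F v by apply/eqP; rewrite -subr_eq0 -hE ?hv// (le_trans w0).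
exists u, v; split => //; split => //.
rewrite (gain_split sx (le_trans xw wv) vy yt) lerD2r.
rewrite (gain_split sx xu (le_trans uw wv) (le_trans vy yt)) gerDl.
apply: gain_gap => //; [exact: le_trans xu|exact: le_trans wv|exact: le_trans yt|].
move=> z uz zv; rewrite -subr_eq0 -hE ?(le_trans u0 (ltW uz)) ?(le_trans (ltW zv) v1)//.
by have [zw|wz] := leP z w; [exact: ulast|apply: vfirst => //; exact: ltW].
Qed.

(** The halving argument on pairs of touching times: [touch_split] supplies the cuts and
    [opt_local_action] the quadratic bound. *)
Let gain_piece x y : s0 <= x -> x <= y -> y <= t0 -> same_piece q x y ->
  g x = F x -> g y = F y -> gain x y <= 0.
Proof.
move=> sx0 xy yt0 hxy gx gy.
apply: (@le0_halving _ (fun s t => [/\ x <= s, t <= y, g s = F s & g t = F t])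
  gain (c ^+ 2 / (2 * q ^+ 3)) x y) => // s t st [xs ty gs gt].
- have s0' : 0 <= s by rewrite (le_trans s00)// (le_trans sx0).
  have t1' : t <= 1 by rewrite (le_trans ty)// (le_trans yt0).
  have sx := le_trans sx0 xs; have tt0 := le_trans ty yt0.
  move: (st); rewrite le_eqVlt => /predU1P[E|st'].
    by rewrite /gain -E En0 ?(le_trans st)//; lra.
  have hst : same_piece q s t.
    case: hxy => [h1|[h1 h2]|h1].
    + by apply: Or31; exact: le_trans h1.
    + by apply: Or32; split; [exact: le_trans xs|exact: le_trans h2].
    + by apply: Or33; exact: le_trans xs.
  have := opt_local_action c q0 q1 s0' st' hst; rewrite -/lam -/F -/E0.
  have := cumul_opt_rate_le c0 q0 s0' st t1'; rewrite -/lam.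
  have := En_ge sx st' tt0; rewrite gs gt.
  have : T t - T s <= cumul (EFin \o opt_rate c q) t - cumul (EFin \o opt_rate c q) s.
    apply: le_cumulB => //; [exact: touch_rate_density|exact: opt_rate_density|].
    by move=> z _; rewrite /touch_rate/=; case: ifP => // _; rewrite lee_fin sqr_ge0.
  rewrite /gain.
  set A := (F t - F s) ^+ 2 / (t - s); set B := lam s ^+ 2 * _.
  set D := _ - cumul _ s; lra.
- have [||||u [v [[h1 h2 h3 h4] [h5 h6 h7]]]] := @touch_split s ((s + t) / 2) t _ _ _ _ gs gt.
  + exact: le_trans xs.
  + lra.
  + lra.
  + exact: le_trans yt0.
  exists u, v; split => //; split => //; split => //.
    by rewrite (le_trans h3)//; lra.
  by rewrite (le_trans xs)//; lra.
Qed.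

Let gain_le0 x y : s0 <= x -> x <= y -> y <= t0 -> g x = F x -> g y = F y -> gain x y <= 0.
Proof.
have late s t : s0 <= s -> s <= t -> t <= t0 -> q ^+ 2 / 2 <= s ->
    g s = F s -> g t = F t -> gain s t <= 0.
  move=> ss st tt sa gs gt.
  have [tq|qt] := leP t (q ^+ 2); first by apply: gain_piece => //; apply: Or32.
  have [qs|sq] := leP (q ^+ 2) s; first by apply: gain_piece => //; apply: Or33.
  have [u [v [[h1 h2 h3 h4] [h5 h6 h7]]]] := touch_split ss (ltW sq) (ltW qt) tt gs gt.
  apply: le_trans h7 _; rewrite -[leRHS]addr0; apply: lerD; apply: gain_piece => //.
  - by rewrite (le_trans h3)// (le_trans (ltW qt)).
  - by apply: Or32.
  - by rewrite (le_trans ss)// (le_trans (ltW sq)).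
  - by apply: Or33.
move=> sx xy yt gx gy.
have [ya|ay] := leP y (q ^+ 2 / 2); first by apply: gain_piece => //; apply: Or31.
have [ax|xa] := leP (q ^+ 2 / 2) x; first exact: late.
have [u [v [[h1 h2 h3 h4] [h5 h6 h7]]]] := touch_split sx (ltW xa) (ltW ay) yt gx gy.
apply: le_trans h7 _; rewrite -[leRHS]addr0; apply: lerD.
  apply: gain_piece => //; last by apply: Or31.
  by rewrite (le_trans h3)// (le_trans (ltW ay)).
by apply: late => //; rewrite (le_trans sx)// (le_trans (ltW xa)).
Qed.

Variable m4 : R -> R -> R -> R -> R.
Hypothesis m4_dirichlet : forall x s y t, s < t -> - ((y - x) ^+ 2 / (t - s)) <= m4 x s y t.
Hypothesis m4_superadd : forall x s y t z u, s < t -> t < u ->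
  m4 x s y t + m4 y t z u <= m4 x s z u.
Hypothesis m4_curve : forall s t, 0 <= s -> s < t -> t <= 1 ->
  E0 t - E0 s <= m4 (F s) s (F t) t.

(** Before the first touching time and after the last one a straight segment is at least as good as
    [g]; in between following F is. Superadditivity of [m4], which stands for the optimal metric,
    joins the three parts. *)
Lemma touch_rate_le : cumul (touch_rate g) t0 - cumul (touch_rate g) s0 -
  fine (energy g s0 t0) <= m4 (g s0) s0 (g t0) t0.
Proof.
rewrite -/(T t0) -/(T s0) -/(En s0 t0).
(* The value 0 covers a curve that touches F at an endpoint, where one of the three parts is
   empty. *)
pose b x y := if x < y then m4 (g x) x (g y) y else 0.
have bD x u y : x <= u -> u <= y -> b x u + b u y <= b x y.
  rewrite /b le_eqVlt => /predU1P[<- _|xu]; first by rewrite ltxx add0r.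
  rewrite le_eqVlt => /predU1P[<-|uy]; first by rewrite ltxx addr0.
  by rewrite xu uy (lt_trans xu uy) m4_superadd.
have free x y : s0 <= x -> x <= y -> y <= t0 -> (forall z, x < z -> z < y -> g z != F z) ->
    T y - T x - En x y <= b x y.
  move=> sx xy yt gap; have x0 := le_trans s00 sx.
  rewrite /T (cumul_touch_gap x0 xy (le_trans yt t01) gap) subrr sub0r /b.
  move: (xy); rewrite le_eqVlt => /predU1P[<-|xy'].
    by rewrite ltxx En0 ?(le_trans xy)// oppr0.
  rewrite xy'; apply: le_trans (m4_dirichlet _ _ xy').
  by rewrite lerN2 En_ge.
have -> : m4 (g s0) s0 (g t0) t0 = b s0 t0 by rewrite /b st0.
have [[z [zs zt gz]]|none] := pselect (exists z, [/\ s0 <= z, z <= t0 & g z = F z]); last first.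
  apply: free => //; rewrite ?ltW// => z sz zt.
  apply/negP => /eqP gz; apply: none; exists z; split => //; exact: ltW.
have hz : h z = 0 by rewrite hE ?gz ?subrr// ?(le_trans s00)// (le_trans zt).
have [|u [su ut hu ufirst]] := first_zero h_continuous (ltW st0).
  by exists z; rewrite ?zs.
have [|v [uv vt hv vlast]] := last_zero h_continuous ut; first by exists u; rewrite ?lexx.
have u0 := le_trans s00 su; have v1 := le_trans vt t01.
have gu : g u = F u by apply/eqP; rewrite -subr_eq0 -hE ?hu// (le_trans ut).
have gv : g v = F v by apply/eqP; rewrite -subr_eq0 -hE ?hv// (le_trans u0).
have sv := le_trans su uv.
have h1 : T u - T s0 - En s0 u <= b s0 u.
  apply: free => // w sw wu; rewrite -subr_eq0 -hE ?(le_trans s00 (ltW sw))//.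
    by apply: ufirst => //; exact: ltW.
  by rewrite (le_trans (ltW wu))// (le_trans uv).
have h2 : T t0 - T v - En v t0 <= b v t0.
  apply: free => // w vw wt; rewrite -subr_eq0 -hE ?(le_trans (ltW wt))//.
    by apply: vlast => //; exact: ltW.
  by rewrite (le_trans _ (ltW vw))// (le_trans u0).
have h3 : T v - T u - En u v <= b u v.
  have := gain_le0 su uv vt gu gv; rewrite /gain /b.
  move: (uv); rewrite le_eqVlt => /predU1P[<-|uv'].
    by rewrite ltxx En0//; lra.
  rewrite uv'; have := m4_curve u0 uv' v1; rewrite gu gv; lra.
have := En_split (lexx s0) su ut (lexx t0); have := En_split su uv vt (lexx t0).
have := bD s0 u t0 su ut; have := bD u v t0 uv vt; lra.
Qed.

End Interval.

End Touching.

(** * The optimal metric *)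

Section OptimalMetric.
Context {R : realType}.
Notation mu := (@lebesgue_measure R).
Implicit Types (s t u x y v : R).
Variables c q : R.
Hypotheses (c0 : 0 < c) (q0 : 0 < q) (q1 : q < 1).
Hypothesis hcq : c * (3 - 2 * q) * q ^+ 2 = 2.

Let F := opt_curve c q.
Let E0 := opt_action c q.
Let a := q ^+ 2 / 2.

Definition opt_curves (_ : nat) : R -> R := opt_curve c q.

(** A single planted curve written as a countable family: all mass sits at index 0. *)
Definition opt_rates (i : nat) : R -> R := if i is 0%N then opt_rate c q else cst 0.

Definition opt_value : R -> R -> R -> R -> R :=
  chain_metric (planted_step opt_curves opt_rates).

Definition opt_metric : metric4 R := planted_metric opt_curves opt_rates.

Let dO : density (EFin \o opt_rate c q). Proof. exact: opt_rate_density. Qed.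

Let adm i : admissible (opt_curves i) (opt_rates i).
Proof.
have [h1 [h2 h3]] := opt_curve_admissible c0 q0 q1.
case: i => [|i]; first by split.
by split => //; split => [|t _]; [exact: measurable_cst|exact: lexx].
Qed.

Let rate_le i t : 0 <= t <= 1 -> ((opt_rates i t)%:E <= (EFin \o opt_rate c q) t)%E.
Proof. by case: i => [|i] _ //=; rewrite lee_fin sqr_ge0. Qed.

Lemma opt_metric_planted : planted opt_curves opt_rates opt_metric.
Proof. exact: planted_metricP adm dO rate_le. Qed.

Lemma opt_value_continuous : real_continuous4 opt_value.
Proof. exact: planted_metric_continuous adm dO rate_le. Qed.

Let exc s t : 0 <= s -> s < t -> - ((F t - F s) ^+ 2 / (t - s)) <= E0 t - E0 s.
Proof.
move=> s0 st; have := opt_curve_excursion c q0 s0 (ltW st); rewrite -/F -/E0.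
have yx : 0 < t - s by rewrite subr_gt0.
rewrite -(pmulr_lge0 _ (_ : 0 < (t - s)^-1)) ?invr_gt0// mulrDl mulfK ?gt_eqF//.
lra.
Qed.

Let step_le x s y t v : s < t -> planted_step opt_curves opt_rates x s y t v ->
  v <= - ((y - x) ^+ 2 / (t - s)) \/
  [/\ 0 <= s, t <= 1, x = F s, y = F t & v <= E0 t - E0 s].
Proof.
move=> st [|[i h]]; first by left.
have dr := rate_density (adm i) dO (@rate_le i).
have [[s0 _ t1 xs yt] [fin hv]] := curve_metric_ge dr h.
right; split => //; apply: le_trans hv _.
have [_ <-] := opt_curve_action c0 q0 q1 s0 st t1; rewrite lerD2r.
exact: (le_cumulB dr dO s0 (ltW st) t1 (@rate_le i)).
Qed.

(** A chain may leave F, so the induction also covers chains starting off F, preceded by a straight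
    segment from an earlier point of F. Consecutive straight segments merge, and one that returns to
    F is beaten by F. *)
Let chain_action x s y t v : chain (planted_step opt_curves opt_rates) x s y t v ->
  t <= 1 -> y = F t ->
  (0 <= s -> x = F s -> v <= E0 t - E0 s) /\
  (forall u, 0 <= u -> u < s -> - ((x - F u) ^+ 2 / (s - u)) + v <= E0 t - E0 u).
Proof.
elim=> [{}x {}s {}y {}t {}v st /(step_le st) hv|
    {}x {}s m r {}y {}t {}v w sr /(step_le sr) hv hc IH] t1 yt.
  case: hv => [hv|[s0 _ xs _ hv]].
    split=> [s0 xs|u u0 us].
      by have := exc s0 st; move: hv; rewrite yt xs; lra.
    have := exc u0 (lt_trans us st); have := @dirichlet_superadd _ (F u) x (F t) u s t us st.
    by move: hv; rewrite yt; lra.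
  split=> [//|u u0 us].
  by have := exc u0 us; rewrite xs; lra.
have [IH1 IH2] := IH t1 yt; have rt := chain_lt hc.
case: hv => [hv|[s0 r1 xs mr hv]].
  split=> [s0 xs|u u0 us].
    by have := IH2 s s0 sr; rewrite -xs; lra.
  have := IH2 u u0 (lt_trans us sr); have := @dirichlet_superadd _ (F u) x m u s r us sr.
  lra.
have r0 : 0 <= r by rewrite (le_trans s0)// ltW.
have h1 := IH1 r0 mr.
split=> [_ _|u u0 us]; first by lra.
by have := exc u0 us; rewrite xs; lra.
Qed.

Lemma opt_value_curve s t : 0 <= s -> s < t -> t <= 1 ->
  opt_value (F s) s (F t) t = E0 t - E0 s.
Proof.
move=> s0 st t1; apply/le_anti/andP; split.
  apply: planted_metric_le => // v hv.
  by have [h _] := chain_action hv t1 erefl; exact: h.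
apply: (chain_le_planted_metric adm dO rate_le); apply: chain_step => //; right; exists 0%N.
have [fin <-] := opt_curve_action c0 q0 q1 s0 st t1.
by rewrite (curve_metricE dO).
Qed.

Let curve_metric_opt i : mle (curve_metric (opt_curves i) (opt_rates i))
  (curve_metric F (opt_rate c q)).
Proof.
move=> x s y t st; apply: curve_metric_le; first exact: rate_density (adm i) dO (@rate_le i).
move=> s0 _ t1 -> -> fin; rewrite curve_metricE// lee_fin lerD2r.
exact: (le_cumulB (rate_density (adm i) dO (@rate_le i)) dO s0 (ltW st) t1 (@rate_le i)).
Qed.

Lemma opt_metric_min e : directed_metric e -> mle (@dirichlet R) e ->
  mle (curve_metric F (opt_rate c q)) e -> mle opt_metric e.
Proof.
move=> ed edir ec; apply: planted_metric_min => // i x s y t st.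
exact: le_trans (@curve_metric_opt i x s y t st) (ec _ _ _ _ st).
Qed.

Lemma opt_metric_planted1 : planted1 F (opt_rate c q) opt_metric.
Proof.
have [_ [h1 [h2 [h3 _]]]] := opt_metric_planted.
split; first exact: opt_curve_admissible.
by split => //; split => //; split; [exact: (h3 0%N)|exact: opt_metric_min].
Qed.

Lemma opt_family_rate : family_rate opt_rates = (4 / 3 * (2 * c ^+ 2))%:E.
Proof.
rewrite /family_rate nneseries_recl//; last first.
  move=> i _; apply: mule_ge0; first by rewrite lee_fin; lra.
  by apply: integral_ge0 => x _; rewrite lee_fin powR_ge0.
rewrite [X in (_ + X)%E]eseries0 => [|[|i]// _ _]; last first.
  rewrite [X in (_ * X)%E](_ : _ = 0%E) ?mule0//=.
  by apply: integral0_eq => x _ /=; rewrite powR0//; lra.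
rewrite adde0 [RHS]EFinM; congr (_ * _)%E.
rewrite -(opt_weight_cube_integral c0 q0 q1 hcq); apply: eq_integral => x _ /=.
have l0 := opt_weight_gt0 c0 q0 x; congr (_%:E).
rewrite /opt_rate -powR_mulrn ?(ltW l0)// -powRrM -powR_mulrn ?(ltW l0)//.
by congr (_ `^ _); field.
Qed.

(** Along F the metric is the increment of [E0], so all partition sums telescope to the same
    value. *)
Lemma opt_metric_geodesic : geodesic opt_metric F 0 0 0 1.
Proof.
have a0 : 0 <= a by rewrite divr_ge0// sqr_ge0.
have qq1 : q ^+ 2 <= 1 by rewrite expr_le1// ltW.
have F0 : F 0 = 0 by rewrite /F (@opt_curve1 _ c q 0)// mulr0.
have F1 : F 1 = 0 by rewrite /F (opt_curve3 c q0 qq1) sqrtr1 subrr mulr0.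
have E00 : E0 0 = 0 by rewrite /E0 (@opt_action1 _ c q 0)// mulr0.
have E01 : E0 1 = 0.
  by rewrite /E0 (opt_action3 c q0 qq1) sqrtr1 subrr expr0n/= mulr0.
have along s t : 0 <= s -> s < t -> t <= 1 -> opt_metric (F s) s (F t) t = (E0 t - E0 s)%:E.
  by move=> s0 st t1; congr (_%:E); exact: opt_value_curve.
split; first by apply: continuous_subspaceT; exact: opt_curve_continuous.
split => //; split => //; apply/le_anti/andP; split.
  apply: ereal_inf_lbound; exists 1%N, (fun i => i%:R); split => //; split => //; split => //.
  split; last by rewrite big_ord_recl big_ord0 adde0 F0 F1.
  by move=> i _; rewrite ltr_nat.
apply: le_ereal_inf_tmp => _ [k [tt [k0 [t0 [tk [tinc ->]]]]]].
have mono i j : (i <= j)%N -> (j <= k)%N -> tt i <= tt j.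
  elim: j => [|j IH]; first by rewrite leqn0 => /eqP ->.
  rewrite leq_eqVlt => /predU1P[->//|]; rewrite ltnS => ij jk.
  by rewrite (le_trans (IH ij (ltnW jk)))// ltW// tinc.
have := along 0 1 (lexx 0) ltr01 (lexx 1); rewrite F0 F1 => ->.
have -> : (\sum_(i < k) opt_metric (F (tt i)) (tt i) (F (tt i.+1)) (tt i.+1))%E =
    (\sum_(i < k) (E0 (tt i.+1) - E0 (tt i)))%:E.
  rewrite -sumEFin; apply: eq_bigr => i _; apply: along.
  - by rewrite -t0 mono// ltnW.
  - exact: tinc.
  - by rewrite -tk mono.
rewrite -(big_mkord xpredT (fun i => E0 (tt i.+1) - E0 (tt i))) telescope_sumr//.
by rewrite t0 tk.
Qed.

End OptimalMetric.

(** * Comparison of a near-optimal metric with the optimal one *)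

Section Uniqueness.
Context {R : realType}.
Notation mu := (@lebesgue_measure R).
Implicit Types (s t u x y v k th : R).
Variables c q : R.
Hypotheses (c0 : 0 < c) (q0 : 0 < q) (q1 : q < 1).
Hypothesis hcq : c * (3 - 2 * q) * q ^+ 2 = 2.

Let F := opt_curve c q.

Section Perturbation.
Variables (gam rho : nat -> R -> R) (e : metric4 R) (th : R).
Hypotheses (pl : planted gam rho e) (rfin : (family_rate rho < +oo)%E) (th0 : 0 < th).

Let S := power_sum rho everywhere.
Let O := power_sum rho (off_curve gam F).
Let k := 2 / (3 * c * q).

Let adm i : admissible (gam i) (rho i). Proof. by case: pl. Qed.
Let cF : continuous F. Proof. exact: opt_curve_continuous. Qed.
Let mrho i : measurable_fun (`[0%R, 1%R] : set R) (rho i).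
Proof. exact: admissible_measurable (adm i). Qed.
Let dS : density S. Proof. exact: everywhere_density. Qed.
Let dO : density O.
Proof. by apply: power_sum_density => // i; exact: off_curve_measurable adm cF i. Qed.
Let k0 : 0 <= k. Proof. by rewrite divr_ge0// !mulr_ge0// ltW. Qed.

(** The first term covers rates on F above the optimal one. The second covers rates off F by a
    tangent at the constant [th], whose mass is small when the off-curve mass is small compared with
    [th]. *)
Definition surplus : R -> \bar R :=
  ((fun x => (2 / (3 * c * q))%:E * excess c q (power_sum rho everywhere) x) \+
   young_bound (cst th) (power_sum rho (off_curve gam (opt_curve c q))))%E.

Let dX : density (excess c q S). Proof. exact: excess_density. Qed.

Let dkX : density (fun x => k%:E * excess c q S x)%E. Proof. exact: densityZ. Qed.

Let dY : density (young_bound (cst th) O).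
Proof.
apply: (@young_bound_density _ _ _ th) => //.
by move=> x; exact: cvg_cst.
Qed.

Lemma surplus_density : density surplus.
Proof. exact: densityD. Qed.

Lemma surplus_mass : cumul surplus 1 =
  2 / (3 * c * q) * cumul (excess c q S) 1 + (2 / (3 * th) * cumul O 1 + th ^+ 2 / 3).
Proof.
rewrite /surplus cumulD// cumulZ//; congr (_ + _).
have h0 : 0 <= 2 / (3 * th) by rewrite divr_ge0// mulr_ge0// ltW.
have h1 : 0 <= th ^+ 3 / 2 by rewrite divr_ge0// exprn_ge0// ltW.
have dth := density_cst h1.
rewrite (cumulZ _ h0 (densityD dO dth)) (cumulD _ dO dth).
by rewrite cumul_cst mulrDr; congr (_ + _); field; rewrite gt_eqF.
Qed.

Lemma rate_le_touch_surplus i x : 0 <= x <= 1 ->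
  ((rho i x)%:E <= (touch_rate c q (gam i) \+ surplus) x)%E.
Proof.
move=> x01; have [_ S0 _] := dS; have [_ Y0 _] := dY.
have kX0 : (0 <= k%:E * excess c q S x)%E by rewrite mule_ge0 ?lee_fin// excess_ge0.
rewrite /touch_rate /surplus /=; case: ifPn => [_|ne].
  apply: (@le_trans _ _ (scaled_young c q 1 S x)).
    by apply: (@rate_le_scaled_young _ c q c0 q0 gam) => //; exact: power_sum_ge.
  apply: le_trans (scaled_young_le_excess c0 q0 q1 x01 (S0 x x01)) _.
  by apply: leeD2l; rewrite leeDl// Y0.
rewrite add0e; apply: (@le_trans _ _ (young_bound (cst th) O x)).
  apply: young_bound_ge => //; last exact: power_sum_ge.
  by have [_ [_]] := adm i; apply.
by rewrite leeDr.
Qed.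

(** Adding the increment of the cumulative surplus to the optimal value gives a directed metric
    above every planted curve: [touch_rate_le] deals with the touching part of the rate, the surplus
    with the rest. Minimality of [e] then gives the bound. *)
Lemma planted_le_surplus x s y t : s < t ->
  (e x s y t <= (opt_value c q x s y t + cumul surplus 1)%:E)%E.
Proof.
move=> st.
have [_ [dir [dle [_ _]]]] := opt_metric_planted c0 q0 q1.
pose m4 x s y t := opt_value c q x s y t + (cumul surplus t - cumul surplus s).
have ds := surplus_density; have sn := cumul_nondecreasing ds.
have [_ [_ sup]] := dir.
have m4dir : directed_metric (to_metric m4).
  apply: directed_to_metric.
    apply: real_continuous4D; first exact: opt_value_continuous.
    by apply: real_continuous4_incr; exact: cumul_continuous.
  move=> x' s' y' t' z' u' h1 h2; have := sup x' s' y' t' z' u' h1 h2.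
  by rewrite -EFinD lee_fin /m4 -/(opt_value c q); lra.
have le_m4 : mle e (to_metric m4).
  have [_ [_ [_ [_ emin]]]] := pl; apply: emin => //.
    move=> x' s' y' t' st'; apply: le_trans (dle x' s' y' t' st') _.
    by rewrite lee_fin /m4 lerDl subr_ge0 sn// ltW.
  move=> i x' s' y' t' st'.
  have dr : density (EFin \o rho i).
    apply: rate_density (adm i) (scaled_young_density c0 q0 q1 ltr01 dS) _ => u u01.
    by apply: (@rate_le_scaled_young _ c q c0 q0 gam) => //; exact: power_sum_ge.
  apply: curve_metric_le => // s0 _ t1 -> -> fin; rewrite lee_fin /m4.
  have dt := touch_rate_density c0 q0 q1 (adm i).
  have := le_cumulB dr (densityD dt ds) s0 (ltW st') t1 (@rate_le_touch_surplus i).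
  rewrite !cumulD//.
  have m4d (x1 s1 y1 u1 : R) : s1 < u1 ->
      - ((y1 - x1) ^+ 2 / (u1 - s1)) <= opt_value c q x1 s1 y1 u1.
    by move=> h1; have := dle x1 s1 y1 u1 h1; rewrite lee_fin.
  have m4s (x1 s1 y1 u1 z1 w1 : R) : s1 < u1 -> u1 < w1 ->
      opt_value c q x1 s1 y1 u1 + opt_value c q y1 u1 z1 w1 <= opt_value c q x1 s1 z1 w1.
    by move=> h1 h2; have := sup x1 s1 y1 u1 z1 w1 h1 h2; rewrite -EFinD lee_fin.
  have m4c (u w : R) : 0 <= u -> u < w -> w <= 1 ->
      opt_action c q w - opt_action c q u <= opt_value c q (F u) u (F w) w.
    by move=> u0 uw w1; rewrite (opt_value_curve c0 q0 q1 u0 uw w1).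
  have := touch_rate_le c0 q0 q1 (adm i) s0 st' t1 fin m4d m4s m4c.
  lra.
apply: le_trans (le_m4 x s y t st) _; rewrite lee_fin /m4 lerD2l.
have h1 : cumul surplus t <= cumul surplus 1.
  rewrite cumul_clamp; apply: sn; exact: clamp_le.
have h2 : 0 <= cumul surplus s.
  by rewrite cumul_clamp -[leLHS](cumul0 surplus); apply: sn; exact: clamp_ge.
lra.
Qed.

End Perturbation.

Variables (e : metric4 R) (path len : R -> R).
Hypotheses (near : near_optimal c e) (pathP : admissible_path q path len).
Hypothesis (lenP : length_along e path len).

Lemma near_optimal_le : mle e (opt_metric c q).
Proof.
move=> x s y t st; apply/lee_addgt0Pr => d d0.
pose k := 2 / (3 * c * q); have k0 : 0 < k by rewrite divr_gt0// !mulr_gt0.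
pose th := Num.min 1 d.
have th0 : 0 < th by rewrite lt_min ltr01.
have th1 : th <= 1 by rewrite ge_min lexx.
have thd : th <= d by rewrite ge_min lexx orbT.
(* Chosen after [th], so that the excess term and the off-curve term are each at most [d / 3]; the
   third term is [th ^+ 2 / 3 <= d / 3]. *)
pose k1 := Num.min (d / (3 * k)) (th * d / 2).
have k10 : 0 < k1.
  by rewrite lt_min; apply/andP; split; apply: divr_gt0 => //; apply: mulr_gt0.
have [gam [rho [pl fin hm hX]]] := small_excess c0 q0 q1 hcq near pathP lenP k10.
have hO := off_curve_mass c0 q0 q1 hcq pl fin
  (opt_curve_admissible_path c0 q0 q1 hcq near pathP lenP)
  (opt_curve_length_along c0 q0 q1 hcq near pathP lenP) hm.
apply: le_trans (planted_le_surplus pl fin th0 x y st) _.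
rewrite -EFinD lee_fin lerD2l (surplus_mass pl fin th0) -/k.
have h1 : k * cumul (excess c q (power_sum rho everywhere)) 1 <= d / 3.
  have : k1 <= d / (3 * k) by rewrite ge_min lexx.
  have k30 : 0 < 3 * k by exact: mulr_gt0.
  rewrite ler_pdivlMr// => h.
  have := ler_wpM2l (ltW k0) hX; lra.
have h2 : 2 / (3 * th) * cumul (power_sum rho (off_curve gam (opt_curve c q))) 1 <= d / 3.
  have h : k1 <= th * d / 2 by rewrite ge_min lexx orbT.
  have -> : d / 3 = 2 / (3 * th) * (th * d / 2) by field; rewrite gt_eqF.
  rewrite ler_wpM2l ?(le_trans hO)//.
  by rewrite divr_ge0// mulr_ge0// ltW.
have h3 : th ^+ 2 <= d.
  by rewrite expr2; apply: le_trans thd; rewrite ler_piMr// ltW.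
lra.
Qed.

Lemma near_optimal_eq : directed_metric e -> mle (@dirichlet R) e -> meq e (opt_metric c q).
Proof.
move=> edir ed x s y t st; apply/le_anti; rewrite near_optimal_le//=.
apply: opt_metric_min => //; exact: (opt_curve_metric_le c0 q0 q1 hcq near pathP lenP).
Qed.

End Uniqueness.

Lemma geodesic_admissible_path {R : realType} (q : R) (e : metric4 R) pi :
  finite_rate e -> geodesic e pi 0 0 0 1 -> pi (q ^+ 2 / 2) = 1 ->
  [/\ directed_metric e, mle (@dirichlet R) e &
   exists len, admissible_path q pi len /\ length_along e pi len].
Proof.
move=> [gam [rho [[_ [dir [dle _]]] _]]] geo pia; split => //.
have [len [len0 along lenge]] := geodesic_length dir dle geo.
by have [_ [pi0 [pi1 _]]] := geo; exists len; split.
Qed.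

(** * Explicit form of the optimum *)

Section Optimum.
Context {R : realType}.
Notation mu := (@lebesgue_measure R).
Variables c q : R.
Hypotheses (c0 : 0 < c) (q0 : 0 < q) (q1 : q < 1).
Hypothesis hcq : c * (3 - 2 * q) * q ^+ 2 = 2.
Implicit Types (s t : R).

Let F := opt_curve c q.
Let a := q ^+ 2 / 2.
(** The value [2 c q (q - q^2)] of F at [q ^+ 2], with [c] eliminated by [hcq]. *)
Let xB := 4 * (1 - q) / (3 - 2 * q).
Let G t := xB * (Num.sqrt t - t) / (Num.sqrt (q ^+ 2) - q ^+ 2).

Let q20 : 0 < q ^+ 2. Proof. by rewrite exprn_gt0. Qed.
Let a0 : 0 < a. Proof. by rewrite /a divr_gt0. Qed.
Let aq : a < q ^+ 2.
Proof. by rewrite /a ltr_pdivrMr// ltr_pMr//; lra. Qed.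
Let sqrtq2 : Num.sqrt (q ^+ 2) = q.
Proof. by rewrite sqrtr_sqr ger0_norm// ltW. Qed.
Let q32 : 0 < 3 - 2 * q. Proof. have := q1; lra. Qed.
Let qq : 0 < 1 - q. Proof. by rewrite subr_gt0. Qed.
Let cE : c = 2 / ((3 - 2 * q) * q ^+ 2).
Proof. by rewrite -[X in X / _]hcq; field; rewrite !gt_eqF. Qed.

Lemma opt_rate_min e : finite_rate e ->
  (exists pi, geodesic e pi 0 0 0 1 /\ pi a = 1) ->
  ((4 / 3 * (2 * c ^+ 2))%:E <= rate e)%E.
Proof.
move=> fr [pi [geo pia]].
have [_ _ [len [hp hl]]] := geodesic_admissible_path fr geo pia.
exact: (rate_ge c0 q0 q1 hcq hp hl).
Qed.

Lemma opt_metric_unique e : finite_rate e ->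
  (exists pi, geodesic e pi 0 0 0 1 /\ pi a = 1) ->
  rate e = (4 / 3 * (2 * c ^+ 2))%:E -> meq e (opt_metric c q).
Proof.
move=> fr [pi [geo pia]] re.
have [dir dle [len [hp hl]]] := geodesic_admissible_path fr geo pia.
exact: (near_optimal_eq c0 q0 q1 hcq (rate_near_optimal re) hp hl dir dle).
Qed.

Lemma opt_metric_finite_rate : finite_rate (opt_metric c q).
Proof.
exists (opt_curves c q), (opt_rates c q); split; first exact: opt_metric_planted.
by rewrite (opt_family_rate c0 q0 q1 hcq) ltry.
Qed.

Lemma opt_curve_a : F a = 1.
Proof. by rewrite /F opt_curve1// /a; move: hcq; lra. Qed.

Lemma opt_metric_rate : rate (opt_metric c q) = (4 / 3 * (2 * c ^+ 2))%:E.
Proof.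
apply/le_anti/andP; split; last first.
  apply: opt_rate_min; first exact: opt_metric_finite_rate.
  by exists F; split; [exact: opt_metric_geodesic|exact: opt_curve_a].
rewrite -(opt_family_rate c0 q0 q1 hcq); apply: ereal_inf_lbound.
by exists (opt_rates c q) => //; exists (opt_curves c q); exact: opt_metric_planted.
Qed.

Lemma opt_curve_segment1 t : t <= a -> F t = t / a.
Proof.
move=> ta; rewrite /F opt_curve1// cE /a.
by field; rewrite !gt_eqF.
Qed.

Lemma opt_curve_segment2 t : a <= t -> t <= q ^+ 2 ->
  F t = 1 + (xB - 1) * (t - a) / (q ^+ 2 - a).
Proof.
move=> at_ tq; rewrite /F opt_curve2// cE /xB /a.
have -> : q ^+ 2 - q ^+ 2 / 2 = q ^+ 2 / 2 by field.
by field; rewrite !gt_eqF.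
Qed.

Let GE t : G t = 2 * c * q * (Num.sqrt t - t).
Proof.
rewrite /G sqrtq2 /xB cE.
have -> : q - q ^+ 2 = q * (1 - q) by ring.
by field; rewrite !gt_eqF.
Qed.

Lemma opt_curve_segment3 t : q ^+ 2 <= t -> F t = G t.
Proof. by move=> qt; rewrite GE /F opt_curve3. Qed.

Let derive1_G t : 0 < t -> derive1 G t = 2 * c * q * ((2 * Num.sqrt t)^-1 - 1).
Proof.
move=> t0; have h := is_derive1_sqrt t0.
have -> : G = (2 * c * q) \*: (Num.sqrt - @id R) by apply/funext => u; rewrite GE.
have hd : is_derive t 1 ((2 * c * q) \*: (Num.sqrt - @id R))
    (2 * c * q * ((2 * Num.sqrt t)^-1 - 1)).
  by apply: is_derive_eq; rewrite scaler0 addr0.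
by rewrite derive1E derive_val.
Qed.

(** The slope from the origin is [2 c q (1 / sqrt t - 1)] and [G'] is [c q / sqrt t - 2 c q]; they
    differ by [c q / sqrt t], which is the weight. *)
Lemma opt_rate_late t : q ^+ 2 <= t -> opt_rate c q t = (F t / t - derive1 G t) ^+ 2.
Proof.
move=> qt; have t0 : 0 < t by exact: lt_le_trans qt.
rewrite derive1_G// /F (opt_curve3 c q0 qt) /opt_rate (opt_weight2 c q0 qt); congr (_ ^+ 2).
have w0 : 0 < Num.sqrt t by rewrite sqrtr_gt0.
have tE : t = Num.sqrt t ^+ 2 by rewrite sqr_sqrtr// ltW.
set w := Num.sqrt t in w0 tE *; rewrite tE.
by field; rewrite !gt_eqF.
Qed.

Lemma opt_curve_derive1_continuous : {for q ^+ 2, continuous (derive1 F)}.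
Proof.
have h : \forall x \near q ^+ 2, opt_weight c q x - 2 * c * q = derive1 F x.
  near=> x; rewrite opt_curve_derive1_late//.
  by near: x; exact: lt_nbhsr.
have E : derive1 F (q ^+ 2) = opt_weight c q (q ^+ 2) - 2 * c * q.
  by rewrite opt_curve_derive1_late.
rewrite /prop_for /continuous_at E; apply: (cvg_trans (near_eq_cvg h)).
by apply: cvgB; [exact: opt_weight_continuous|exact: cvg_cst].
Unshelve. all: by end_near. Qed.

Lemma opt_action_segment1 :
  (\int[mu]_(t in `[0%R, a]) (opt_rate c q t - (derive1 F t) ^+ 2)%:E + (a^-1)%:E =
   (c ^+ 2 * a)%:E)%E.
Proof.
pose k := c ^+ 2 - (a^-1) ^+ 2.
have E t : t < a -> opt_rate c q t - (derive1 F t) ^+ 2 = k.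
  move=> ta; rewrite opt_curve_derive1_early// /opt_rate opt_weight1.
    rewrite /k; congr (_ - _ ^+ 2); rewrite cE /a; by field; rewrite !gt_eqF.
  by rewrite ltW// (lt_trans ta).
(* F has a kink at [a], so the formula for [derive1 F] is available only before [a]; the endpoint is
   dropped from the integral. *)
rewrite -integral_itv_bndo_bndc; last first.
  apply: (eq_measurable_fun (cst k%:E)) => [x|]; last exact: measurable_cst.
  by rewrite inE/= in_itv/= => /andP[_ xa]; rewrite E.
rewrite (eq_integral (cst k%:E)); last first.
  by move=> x; rewrite inE/= in_itv/= => /andP[_ xa]; rewrite E.
rewrite integral_cst//= lebesgue_measure_itv/= lte_fin a0 -EFinB -EFinM -EFinD.
by congr (_%:E); rewrite /k; field; rewrite gt_eqF.
Qed.

(** Since [a^-1 = c (3 - 2 q)] and [q < 1], [c] is at most [a^-1], and already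
    [c ^+ 2 * a <= a^-1]. *)
Lemma opt_action_segment1_bounds : 0 < c ^+ 2 * a <= (1 - a)^-1 + a^-1.
Proof.
rewrite mulr_gt0 ?exprn_gt0//=.
have a1 : 0 < 1 - a by rewrite subr_gt0 (lt_trans aq)// expr_lt1// ltW.
apply: (@le_trans _ _ a^-1); last by rewrite lerDr invr_ge0 ltW.
have ca : c <= a^-1.
  have -> : a^-1 = c * (3 - 2 * q) by rewrite cE /a; field; rewrite !gt_eqF.
  by rewrite ler_pMr//; have := q1; lra.
have -> : a^-1 = (a^-1) ^+ 2 * a by field; rewrite gt_eqF.
by rewrite ler_pM2r// lerXn2r// nnegrE ?invr_ge0 ltW.
Qed.

End Optimum.

Theorem theorem4 (R : realType) (a : R) (ha0 : 0 < a) (ha1 : a < 1 / 2) :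
  let admissible_class (e : metric4 R) :=
    finite_rate e /\
    exists pi : R -> R, geodesic e pi 0 0 0 1 /\ pi a = 1 in
  exists e0 : metric4 R,
    admissible_class e0 /\
    (forall e, admissible_class e -> (rate e0 <= rate e)%E) /\
    (forall e, admissible_class e -> rate e = rate e0 -> meq e e0) /\
    exists (F rho : R -> R) (xB tB : R),
      let G := fun t : R => xB * (Num.sqrt t - t) / (Num.sqrt tB - tB) in
          a < tB /\ tB < 1 /\ xB < tB / a /\
          (forall t, 0 <= t <= a -> F t = t / a) /\
          (forall t, a <= t <= tB -> F t = 1 + (xB - 1) * (t - a) / (tB - a)) /\
          (forall t, tB <= t <= 1 -> F t = G t) /\
          (exists c : R, forall t, 0 <= t <= tB -> rho t = c) /\
          (forall t, tB <= t <= 1 -> rho t = (F t / t - derive1 G t) ^+ 2) /\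
          derivable F tB 1 /\ {for tB, continuous (derive1 F)} /\
          {for tB, continuous rho} /\
          (let b := (\int[lebesgue_measure]_(t in `[0%R, a])
                        ((rho t - (derive1 F t) ^+ 2)%:E) + (a^-1)%:E)%E in
           (0 < b)%E /\ (b <= ((1 - a)^-1 + a^-1)%:E)%E) /\
          planted1 F rho e0.
Proof.
set q := Num.sqrt (2 * a).
have qE : q ^+ 2 = 2 * a by rewrite sqr_sqrtr// mulr_ge0// ltW.
have aE : a = q ^+ 2 / 2 by rewrite qE; field.
have q0 : 0 < q by rewrite sqrtr_gt0 mulr_gt0.
have q1 : q < 1.
  by rewrite -(@ltr_pXn2r _ 2) ?nnegrE ?(ltW q0)// expr1n qE; lra.
have q32 : 0 < 3 - 2 * q by lra.
(* The value for which F passes through [(1, a)]. *)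
pose c := 2 / ((3 - 2 * q) * q ^+ 2).
have c0 : 0 < c by rewrite divr_gt0 ?mulr_gt0// exprn_gt0.
have hcq : c * (3 - 2 * q) * q ^+ 2 = 2 by rewrite /c; field; rewrite !gt_eqF.
clearbody q; clear qE; rewrite aE in ha0 ha1 *; clear aE a => cls.
have q20 : 0 < q ^+ 2 by rewrite exprn_gt0.
exists (opt_metric c q); split; [|split; [|split]].
- split; first exact: opt_metric_finite_rate.
  by exists (opt_curve c q); split; [exact: opt_metric_geodesic|exact: opt_curve_a].
- by move=> e [fr geo]; rewrite (opt_metric_rate c0 q0 q1 hcq); exact: (opt_rate_min c0 q0 q1 hcq fr geo).
- by move=> e [fr geo]; rewrite (opt_metric_rate c0 q0 q1 hcq); exact: (opt_metric_unique c0 q0 q1 hcq fr geo).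
exists (opt_curve c q), (opt_rate c q), (4 * (1 - q) / (3 - 2 * q)), (q ^+ 2) => G.
split; first by lra.
split; first by rewrite expr_lt1// ltW.
split.
  have -> : q ^+ 2 / (q ^+ 2 / 2) = 2 by field; rewrite gt_eqF.
  by rewrite ltr_pdivrMr//; lra.
split; first by move=> t /andP[_ ta]; exact: opt_curve_segment1.
split; first by move=> t /andP[at_ tq]; exact: opt_curve_segment2.
split; first by move=> t /andP[qt _]; exact: opt_curve_segment3.
split; first by exists (c ^+ 2) => t /andP[_ tq]; rewrite /opt_rate opt_weight1.
split; first by move=> t /andP[qt _]; exact: opt_rate_late.
split.
  have q22 : q ^+ 2 / 2 < q ^+ 2 by lra.
  by have [] := opt_curve_is_derive c0 q0 q22.
split; first exact: opt_curve_derive1_continuous.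
split; first exact: opt_rate_continuous.
split; last exact: opt_metric_planted1.
have /andP[b0 b1] := opt_action_segment1_bounds c0 q0 q1 hcq.
by cbv zeta; rewrite (opt_action_segment1 q0 q1 hcq) lte_fin lee_fin.
Qed.
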